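(* Suppose $n \geq 2$, $\mathbb{B}_n \cap B_r(c) \neq \emptyset$, and $\mathbb{B}_N \cap B_R(C) \neq \emptyset$. There exist no proper holomorphic maps $f \colon \mathbb{B}_n \setminus \overline{B_r(c)} \to \mathbb{C}^N \setminus \overline{\mathbb{B}_N}$ nor $f \colon \mathbb{C}^n \setminus \overline{\mathbb{B}_n} \to \mathbb{B}_N \setminus \overline{B_R(C)}$.
   Context: $\mathbb{B}_n = \{z \in \mathbb{C}^n : \lVert z\rVert < 1\}$ is the open unit ball in $\mathbb{C}^n$, and $\mathbb{B}_N$ is the open unit ball in $\mathbb{C}^N$. $B_r(c)$ denotes the ball of radius $r$ centered at $c$ (in $\mathbb{C}^n$), and similarly $B_R(C)$ in $\mathbb{C}^N$. A continuous map is proper if preimages of compact sets are compact. *)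

(* Defs.v *)
From HB Require Import structures.
From mathcomp Require Import all_boot all_order all_algebra complex.
From mathcomp Require Import all_classical all_reals all_analysis.

Set Implicit Arguments.
Unset Strict Implicit.
Unset Printing Implicit Defensive.
Import Order.TTheory GRing.Theory Num.Theory.
Import numFieldNormedType.Exports.

Local Open Scope classical_set_scope.
Local Open Scope ring_scope.

(* The normed space structure of numFieldNormedType, keyed on complex. *)
#[export, non_forgetful_inheritance]
HB.instance Definition _ (R : rcfType) :=
  NormedModule.copy R[i] (R[i] : numFieldType)^o.

(* The library norm on 'rV[R[i]]_n is the sup norm; it induces the same
   topology, but the balls below must be Euclidean. *)
Definition enorm (R : realType) (n : nat) (z : 'rV[R[i]]_n) : R :=
  Num.sqrt (\sum_(i < n) Normc.normc (z 0 i) ^+ 2).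

Definition eball (R : realType) (n : nat) (c : 'rV[R[i]]_n) (r : R) :
    set 'rV[R[i]]_n :=
  [set z | enorm (z - c) < r].

Definition unit_ball (R : realType) (n : nat) : set 'rV[R[i]]_n :=
  [set z | enorm z < 1].
Arguments unit_ball : clear implicits.

(* Meant for open U.  The scalar field of both normed modules is R[i], so
   differentiability at a point is complex (Frechet) differentiability. *)
Definition holomorphic_on (R : realType) (n N : nat) (U : set 'rV[R[i]]_n)
    (f : 'rV[R[i]]_n -> 'rV[R[i]]_N) : Prop :=
  forall z, U z -> differentiable f z.

(* A map U -> V between subspaces is represented by a total function sending
   U into V, whose values outside U are irrelevant; compactness of a subset of
   U (or V) does not depend on whether it is taken in the subspace or in the
   ambient space. *)
Definition proper_map (X Y : topologicalType) (U : set X) (V : set Y)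
    (f : X -> Y) : Prop :=
  [/\ set_fun U V f,
      {within U, continuous f} &
      forall K : set Y, K `<=` V -> compact K -> compact (U `&` f @^-1` K)].

(* Main.v *)
Require Import Defs.
From HB Require Import structures.
From mathcomp Require Import all_boot all_order all_algebra complex.
From mathcomp Require Import all_classical all_reals all_analysis.
From mathcomp Require Import ring lra.
Import Order.TTheory GRing.Theory Num.Theory.
Import numFieldNormedType.Exports.
Import Normc.

(** A map [f] from the exterior of the unit ball of [C^n], [n >= 2], into a
    bounded set is bounded and holomorphic on every complex line that misses
    the ball, hence constant there by Liouville's theorem, so its fibres are
    not compact.

    For the difference of two balls, one works in a two-dimensional complex
    subspace through both centres, with coordinates [(x, y)] in which the removed ball is the unit ball and
    the outer ball is [|x - b|^2 + |y|^2 < R0^2].  The map extends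
    holomorphically across [(1, 0)] (Hartogs) and properness forces [|f| = 1] on
    the unit sphere there.  Polarizing, [<f(w), f(z)> = 1] for [w] on the complex
    tangent line of the sphere at [z].  For [z = (a, t)] with [a] fixed, all these
    lines pass through [(1 / a, 0)], and the jets of [f] along them at this point
    are polynomials in [conj t] which span [f(z)]; solving the Gram system gives
    [f(a, t)] as a rational function of [t] and [conj t], thus of [t] on the
    circle.  So [t |-> f(a, t)] is rational on the whole disc cut out by the
    outer ball.  Properness then forces [|f| <= 1] on the boundary of that disc away
    from the poles; such a rational map has no poles on the closed disc, and
    the maximum principle contradicts [|f| > 1] outside the unit
    ball. *)

(** Properness enters only through paths: if a path runs out of the domain while the values along it
    converge, the limit is not in the target, so its norm is at most 1. The obstacle is that finite
    limits must exist, as the map may be unbounded near the boundary. The domain lies on the concave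
    side of the unit sphere, and there Hartogs extension provides them. It lies on the convex side
    of the outer sphere, where nothing extends in general; rationality is what makes the boundary
    values exist, up to finitely many poles in the slice.

    The span condition holds because z itself is on its tangent line: a linear functional that kills
    every jet kills f along the line, hence at z. The jets involve only conj t because the tangent
    line at (a, t) is a x + (conj t) y = 1, of slope - conj t / a over the y-axis.

    The function theory is built on means over circles, with crude constants that disappear on
    taking powers or letting a radius grow. *)

Set Implicit Arguments.
Unset Strict Implicit.
Unset Printing Implicit Defensive.

Local Open Scope classical_set_scope.
Local Open Scope ring_scope.
Local Open Scope complex_scope.
Local Notation Re := complex.Re.
Local Notation Im := complex.Im.
Local Notation "x ^*" := (conjc x) : ring_scope.
Arguments Normc.normc {R} x : simpl never.

(** * Limits of complex-valued functions *)

Section ComplexLimits.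
Variable R : realType.
Local Notation C := R[i].
Implicit Types (x y z w : C) (e r : R).

Lemma normc_ge0 z : 0 <= normc z.
Proof. by case: z => a b; exact: sqrtr_ge0. Qed.

Lemma normc_eq0 z : (normc z == 0) = (z == 0).
Proof. by apply/eqP/eqP => [/eq0_normc//|->]; exact: normc0. Qed.

Lemma normc_gt0 z : (0 < normc z) = (z != 0).
Proof. by rewrite lt_def normc_ge0 andbT normc_eq0. Qed.

Lemma normcX z n : normc (z ^+ n) = normc z ^+ n.
Proof. by elim: n => [|n IH]; rewrite ?expr0 ?normc1// !exprS normcM IH. Qed.

Lemma normc_real (a : R) : normc a%:C = `|a|.
Proof. by rewrite /normc /= expr0n addr0 sqrtr_sqr. Qed.

Lemma normc_sqr z : normc z ^+ 2 = Re z ^+ 2 + Im z ^+ 2.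
Proof. by case: z => a b; rewrite /normc /= sqr_sqrtr// addr_ge0 ?sqr_ge0. Qed.

Lemma normc_conj z : normc z^* = normc z.
Proof. by case: z => a b; rewrite /normc /= sqrrN. Qed.

Lemma Re_le_normc z : `|Re z| <= normc z.
Proof.
by rewrite -(ler_pXn2r (n := 2))// ?nnegrE ?normc_ge0// normc_sqr real_normK ?num_real// lerDl sqr_ge0.
Qed.

Lemma Im_le_normc z : `|Im z| <= normc z.
Proof.
by rewrite -(ler_pXn2r (n := 2))// ?nnegrE ?normc_ge0// normc_sqr real_normK ?num_real// lerDr sqr_ge0.
Qed.

Lemma normc_i : normc 'i%C = 1 :> R.
Proof. by rewrite /normc expr0n expr1n add0r sqrtr1. Qed.

Lemma normc_le_ReIm z : normc z <= `|Re z| + `|Im z|.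
Proof.
rewrite {1}[z]complexE (le_trans (le_normcD _ _))//.
by rewrite normcM !normc_real normc_i mul1r.
Qed.

Lemma normcB x y : normc (x - y) = normc (y - x).
Proof. by rewrite -opprB normcN. Qed.

Lemma le_normcB_dist x y : `|normc x - normc y| <= normc (x - y).
Proof.
have h u v : normc u - normc v <= normc (u - v).
  by rewrite lerBlDr (le_trans _ (le_normcD _ _))// subrK.
by rewrite ler_norml h andbT lerNl opprB normcB h.
Qed.

Lemma le_normc_sum (I : Type) (s : seq I) (P : pred I) (F : I -> C) :
  normc (\sum_(i <- s | P i) F i) <= \sum_(i <- s | P i) normc (F i).
Proof.
elim/big_ind2: _ => [|a b c d h1 h2|//]; first by rewrite normc0.
by rewrite (le_trans (le_normcD _ _))// lerD.
Qed.

Lemma normc_mulJ z : z * z^* = (normc z ^+ 2)%:C.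
Proof.
rewrite normc_sqr; case: z => a b /=; apply/eqP; rewrite eq_complex /=.
by apply/andP; split; apply/eqP; ring.
Qed.

Lemma normcV_lt z w : normc (z - w) < normc w -> z != 0.
Proof. by apply: contraTneq => ->; rewrite sub0r normcN ltxx. Qed.

(* The library norm on R[i] takes its values in R[i]; neighbourhoods are taken
   here with respect to the real-valued modulus [normc]. *)
Definition cnb z : set_system C := [set A | exists2 e, 0 < e & forall w, normc (w - z) < e -> A w].

Global Instance cnb_filter z : ProperFilter (cnb z).
Proof.
split=> [[e e0 /(_ z)]|]; first by rewrite subrr normc0; apply.
split.
- by exists 1.
- move=> A B [e e0 hA] [f f0 hB]; exists (Num.min e f); first by rewrite lt_min e0.
  by move=> w; rewrite lt_min => /andP[h1 h2]; split; [exact: hA|exact: hB].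
- by move=> A B AB [e e0 hA]; exists e => // w /hA /AB.
Qed.

Lemma cnb_ball z e : 0 < e -> \forall w \near cnb z, normc (w - z) < e.
Proof. by move=> e0; exists e. Qed.

Lemma cnb_open z e w : normc (w - z) < e -> \forall v \near cnb w, normc (v - z) < e.
Proof.
move=> h; exists (e - normc (w - z)); first by rewrite subr_gt0.
move=> v hv; rewrite -(subrK w v) -addrA (le_lt_trans (le_normcD _ _))//.
by rewrite -ltrBrDr.
Qed.

Definition clim (T : Type) (F : set_system T) (f : T -> C) (l : C) :=
  forall e, 0 < e -> \forall t \near F, normc (f t - l) < e.

Definition ccont (f : C -> C) z := clim (cnb z) f (f z).

Definition ccont2 (g : C -> C -> C) x y :=
  clim (filter_prod (cnb x) (cnb y)) (fun p => g p.1 p.2) (g x y).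

Section Calculus.
Variables (T : Type) (F : set_system T).
Context {FF : Filter F}.
Implicit Types (f g : T -> C) (l m : C).

Lemma clim_near f g l : (\forall t \near F, f t = g t) -> clim F f l -> clim F g l.
Proof. by move=> fg h e /h he; near=> t; rewrite -(near fg)//; near: t. Unshelve. all: by end_near. Qed.

Lemma clim_cst l : clim F (fun=> l) l.
Proof. by move=> e e0; apply: filterE => t; rewrite subrr normc0. Qed.

Lemma climD f g l m : clim F f l -> clim F g m -> clim F (fun t => f t + g t) (l + m).
Proof.
move=> hf hg e e0; have e2 : 0 < e / 2 by rewrite divr_gt0.
near=> t; rewrite opprD addrACA (le_lt_trans (le_normcD _ _))// (splitr e) ltrD//; near: t.
- exact: hf.
- exact: hg.
Unshelve. all: by end_near. Qed.

Lemma climN f l : clim F f l -> clim F (fun t => - f t) (- l).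
Proof. by move=> hf e /hf; apply: filterS => t; rewrite -opprD normcN. Qed.

Lemma climB f g l m : clim F f l -> clim F g m -> clim F (fun t => f t - g t) (l - m).
Proof. by move=> hf /climN; exact: climD. Qed.

Lemma climM f g l m : clim F f l -> clim F g m -> clim F (fun t => f t * g t) (l * m).
Proof.
move=> hf hg e e0.
(* The error is at most d^2 + d |m| + |l| d, and d <= 1 turns d^2 into d. *)
pose d := Num.min 1 (e / (1 + normc l + normc m)).
have k0 : 0 < 1 + normc l + normc m by rewrite -addrA ltr_pwDl// addr_ge0 ?normc_ge0.
have d0 : 0 < d by rewrite lt_min ltr01 divr_gt0.
have d1 : d <= 1 by rewrite ge_min lexx.
have de : d * (1 + normc l + normc m) <= e by rewrite -ler_pdivlMr// ge_min lexx orbT.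
near=> t.
have ft : normc (f t - l) < d by near: t; exact: hf.
have gt : normc (g t - m) < d by near: t; exact: hg.
have -> : f t * g t - l * m = (f t - l) * (g t - m) + (f t - l) * m + l * (g t - m) by ring.
apply: lt_le_trans de.
rewrite (le_lt_trans (le_normcD _ _))// (le_lt_trans (lerD (le_normcD _ _) (lexx _)))//.
rewrite !normcM.
have := normc_ge0 (f t - l); have := normc_ge0 (g t - m); have := normc_ge0 l; have := normc_ge0 m.
nra.
Unshelve. all: by end_near. Qed.

Lemma climV f l : l != 0 -> clim F f l -> clim F (fun t => (f t)^-1) l^-1.
Proof.
move=> l0 hf e e0; have L0 : 0 < normc l by rewrite normc_gt0.
near=> t.
have h1 : normc (f t - l) < normc l / 2 by near: t; apply: hf; rewrite divr_gt0.
(* The inverses differ by |l - f t| / (|f t| |l|), and |f t| > |l| / 2 by the first bound. *)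
have h2 : normc (f t - l) < e * (normc l ^+ 2 / 2).
  by near: t; apply: hf; rewrite mulr_gt0// divr_gt0// exprn_gt0.
have f0 : f t != 0 by apply: normcV_lt (lt_trans h1 _); rewrite ltr_pdivrMr// mulr_natr mulr2n ltrDl.
have h3 : normc l / 2 < normc (f t).
  have := le_trans (ler_norm _) (le_normcB_dist l (f t)); rewrite normcB; lra.
have -> : (f t)^-1 - l^-1 = (l - f t) * ((f t)^-1 * l^-1) by field; rewrite f0 l0.
rewrite !normcM !normcV// normcB mulrA -ltr_pdivlMr ?invr_gt0// invrK.
rewrite ltr_pdivrMr ?normc_gt0// (lt_le_trans h2)// -mulrA ler_pM2l// expr2 -mulrA ler_pM2l//.
exact: ltW.
Unshelve. all: by end_near. Qed.

Lemma climX f l n : clim F f l -> clim F (fun t => f t ^+ n) (l ^+ n).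
Proof.
move=> hf; elim: n => [|n IH]; first exact: clim_cst.
rewrite exprS; apply: clim_near (climM hf IH); apply: filterE => t.
by rewrite exprS.
Qed.

Lemma clim_sum (I : Type) (s : seq I) (P : pred I) (f : I -> T -> C) (l : I -> C) :
  (forall i, P i -> clim F (f i) (l i)) ->
  clim F (fun t => \sum_(i <- s | P i) f i t) (\sum_(i <- s | P i) l i).
Proof.
move=> h; elim: s => [|i s IH].
  by rewrite big_nil; apply: clim_near (clim_cst 0); apply: filterE => t; rewrite big_nil.
rewrite big_cons; apply: (@clim_near (fun t => if P i then f i t + \sum_(j <- s | P j) f j t
                                 else \sum_(j <- s | P j) f j t)).
  by apply: filterE => t; rewrite big_cons.
by case: ifP => // Pi; apply: climD => //; exact: h.
Qed.

Lemma clim_conj f l : clim F f l -> clim F (fun t => (f t)^*) l^*.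
Proof. by move=> hf e /hf; apply: filterS => t; rewrite -rmorphB normc_conj. Qed.

Lemma clim_comp f (h : C -> C) l : clim F f l -> ccont h l -> clim F (fun t => h (f t)) (h l).
Proof.
move=> hf hh e /hh[d d0 hd]; near=> t; apply: hd; near: t; exact: hf.
Unshelve. all: by end_near. Qed.

Lemma clim_cnb f l : clim F f l -> f @ F `=>` cnb l.
Proof. by move=> hf A [e e0 hA]; have := hf _ e0; apply: filterS => t /hA. Qed.

Lemma clim_comp2 f g (h : C -> C -> C) l m : clim F f l -> clim F g m -> ccont2 h l m ->
  clim F (fun t => h (f t) (g t)) (h l m).
Proof.
move=> hf hg hh e /hh[[A B] [/= [a a0 hA] [b b0 hB]] AB]; near=> t.
apply: (AB (f t, g t)); split => /=.
- by apply: hA; near: t; exact: hf.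
- by apply: hB; near: t; exact: hg.
Unshelve. all: by end_near. Qed.

End Calculus.

Lemma clim_normc_ge (T : Type) (F : set_system T) {FF : ProperFilter F} (f : T -> C) l b :
  clim F f l -> (\forall t \near F, normc (f t) <= b) -> normc l <= b.
Proof.
move=> hf hb; rewrite leNgt; apply/negP => h.
have e0 : 0 < normc l - b by rewrite subr_gt0.
near F => t.
have h1 : normc (f t - l) < normc l - b by near: t; exact: hf.
have h2 : normc (f t) <= b by near: t.
have := le_trans (ler_norm _) (le_normcB_dist l (f t)); rewrite normcB; lra.
Unshelve. all: by end_near. Qed.

Lemma clim_normc_le (T : Type) (F : set_system T) {FF : ProperFilter F} (f : T -> C) l b :
  clim F f l -> (\forall t \near F, b <= normc (f t)) -> b <= normc l.
Proof.
move=> hf hb; rewrite leNgt; apply/negP => h.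
have e0 : 0 < b - normc l by rewrite subr_gt0.
near F => t.
have h1 : normc (f t - l) < b - normc l by near: t; exact: hf.
have h2 : b <= normc (f t) by near: t.
have := le_trans (ler_norm _) (le_normcB_dist (f t) l); lra.
Unshelve. all: by end_near. Qed.

Lemma clim_unique (T : Type) (F : set_system T) {FF : ProperFilter F} (f : T -> C) l m :
  clim F f l -> clim F f m -> l = m.
Proof.
move=> hf hg; apply/eqP; rewrite -subr_eq0 -normc_eq0 eq_le normc_ge0 andbT.
apply: (@clim_normc_ge _ F _ (fun t => f t - f t)); first exact: climB.
by apply: filterE => t; rewrite subrr normc0.
Qed.

Lemma ccont_id z : ccont id z.
Proof. by move=> e e0; exists e. Qed.

Lemma clim_fst x y : clim (filter_prod (cnb x) (cnb y)) fst x.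
Proof.
by move=> e e0; exists ([set w | normc (w - x) < e], setT); [split; [exact: cnb_ball|exact: filterT]|move=> [u v] []].
Qed.

Lemma clim_snd x y : clim (filter_prod (cnb x) (cnb y)) snd y.
Proof.
by move=> e e0; exists (setT, [set w | normc (w - y) < e]); [split; [exact: filterT|exact: cnb_ball]|move=> [u v] []].
Qed.

Lemma clim_prod1 (T S : Type) (F : set_system T) (G : set_system S) {FF : Filter F} {GG : Filter G} (f : T -> C) l :
  clim F f l -> clim (filter_prod F G) (fun p => f p.1) l.
Proof.
move=> hf e /hf he; exists ([set t | normc (f t - l) < e], setT); first by split => //; exact: filterT.
by move=> [u v] [].
Qed.

Lemma clim_prod2 (T S : Type) (F : set_system T) (G : set_system S) {FF : Filter F} {GG : Filter G} (f : S -> C) l :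
  clim G f l -> clim (filter_prod F G) (fun p => f p.2) l.
Proof.
move=> hf e /hf he; exists (setT, [set t | normc (f t - l) < e]); first by split => //; exact: filterT.
by move=> [u v] [].
Qed.

Lemma nbhs_real_clim (a : R) : clim (nbhs a) (fun t : R => t%:C) a%:C.
Proof.
move=> e e0; have : \forall t \near a, `|a - t| < e by exact: (@cvgr_dist_lt _ _ _ (nbhs a) _ id a cvg_id e e0).
by apply: filterS => t; rewrite -rmorphB normc_real distrC.
Qed.

End ComplexLimits.

(** * Integrals of complex-valued functions over segments *)

Section SegmentIntegral.
Variable R : realType.
Local Notation C := R[i].
Local Notation mu := (@lebesgue_measure R).
Implicit Types (f g : R -> C) (a b : R).

Definition rcont f a := clim (nbhs a) f (f a).

Definition rcont_on a b f := forall x, a <= x <= b -> rcont f x.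

Definition cint a b f : C :=
  (\int[mu]_(x in `[a, b]) Re (f x))%:C + 'i%C * (\int[mu]_(x in `[a, b]) Im (f x))%:C.

Let part_integrable (P : C -> R) a b f :
  (forall z w, P (z - w) = P z - P w) -> (forall z, `|P z| <= normc z) ->
  rcont_on a b f -> mu.-integrable `[a, b] (EFin \o (fun x => P (f x))).
Proof.
move=> PB Ple fc; apply: continuous_compact_integrable; first exact: segment_compact.
apply: continuous_in_subspaceT => x; rewrite inE/= in_itv/= => /fc xc.
apply/cvgrPdist_lt => e e0; have := xc _ e0; apply: filterS => y h.
by rewrite distrC -PB (le_lt_trans (Ple _)).
Qed.

Lemma Re_integrable a b f : rcont_on a b f -> mu.-integrable `[a, b] (EFin \o (fun x => Re (f x))).
Proof.
by apply: part_integrable; [case=> ? ? [? ?]|exact: Re_le_normc].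
Qed.

Lemma Im_integrable a b f : rcont_on a b f -> mu.-integrable `[a, b] (EFin \o (fun x => Im (f x))).
Proof.
by apply: part_integrable; [case=> ? ? [? ?]|exact: Im_le_normc].
Qed.

Lemma eq_cint a b f g : (forall x, a <= x <= b -> f x = g x) -> cint a b f = cint a b g.
Proof.
by move=> fg; congr (_%:C + _ * _%:C); apply: eq_Rintegral => x; rewrite inE/= in_itv/= => /fg ->.
Qed.

Lemma cintD a b f g : rcont_on a b f -> rcont_on a b g ->
  cint a b (fun x => f x + g x) = cint a b f + cint a b g.
Proof.
move=> hf hg; rewrite /cint.
have reD x : Re (f x + g x) = Re (f x) + Re (g x) by case: (f x) => ? ?; case: (g x).
have imD x : Im (f x + g x) = Im (f x) + Im (g x) by case: (f x) => ? ?; case: (g x).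
under eq_Rintegral do rewrite reD.
under [in X in _ + _ * X%:C]eq_Rintegral do rewrite imD.
rewrite !RintegralD//; try exact: Re_integrable; try exact: Im_integrable.
by rewrite !rmorphD/=; ring.
Qed.

Lemma cintZ a b (k : C) f : rcont_on a b f -> cint a b (fun x => k * f x) = k * cint a b f.
Proof.
move=> hf; rewrite /cint; case: k => p q.
have reZ x : Re ((p +i* q) * f x) = p * Re (f x) - q * Im (f x) by case: (f x).
have imZ x : Im ((p +i* q) * f x) = p * Im (f x) + q * Re (f x) by case: (f x).
under eq_Rintegral do rewrite reZ.
under [in X in _ + _ * X%:C]eq_Rintegral do rewrite imZ.
have iR := Re_integrable hf; have iI := Im_integrable hf.
have zl (r : R) (h : R -> R) : mu.-integrable `[a, b] (EFin \o h) ->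
    mu.-integrable `[a, b] (EFin \o (fun x => r * h x)).
  by move=> ih; under [X in _.-integrable _ X]eq_fun do rewrite /= EFinM; exact: integrableZl.
rewrite RintegralB ?RintegralD//; try exact: zl.
rewrite !RintegralZl//; apply/eqP; rewrite eq_complex /=.
by apply/andP; split; apply/eqP; ring.
Qed.

Lemma cintN a b f : rcont_on a b f -> cint a b (fun x => - f x) = - cint a b f.
Proof.
move=> hf; rewrite -mulN1r -cintZ//; apply: eq_cint => x _; by rewrite mulN1r.
Qed.

Lemma cintB a b f g : rcont_on a b f -> rcont_on a b g ->
  cint a b (fun x => f x - g x) = cint a b f - cint a b g.
Proof.
move=> hf hg; rewrite cintD// ?cintN// => x /hg; exact: climN.
Qed.

Lemma measure_segment a b : a <= b -> fine (mu `[a, b]) = b - a.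
Proof.
move=> ab; rewrite lebesgue_measure_itv/= lte_fin.
case: ifPn => //; rewrite -leNgt => ba.
by rewrite (@le_anti _ _ a b) ?ab// subrr.
Qed.

Lemma cint_cst a b (k : C) : a <= b -> cint a b (fun=> k) = k * (b - a)%:C.
Proof.
move=> ab; rewrite /cint !Rintegral_cst//= measure_segment//.
case: k => p q; apply/eqP; rewrite eq_complex /=.
by apply/andP; split; apply/eqP; ring.
Qed.

Lemma cint_split a c b f : a <= c <= b -> rcont_on a b f ->
  cint a b f = cint a c f + cint c b f.
Proof.
move=> /andP[ac cb] hf; rewrite /cint.
have split (h : R -> R) : mu.-integrable `[a, b] (EFin \o h) ->
    \int[mu]_(x in `[a, b]) h x = \int[mu]_(x in `[a, c]) h x + \int[mu]_(x in `[c, b]) h x.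
  move=> ih; rewrite -(Rintegral_itv_obnd_cbnd (r := c)).
    by rewrite -(@Rintegral_itvB _ h (BLeft a) (BRight b) c)// addrC subrK.
  by apply: integrableS ih => // x /=; rewrite !in_itv/= => /andP[cx ->]; rewrite (le_trans ac (ltW cx)).
rewrite (split _ (Re_integrable hf)) (split _ (Im_integrable hf)).
by rewrite !rmorphD/=; ring.
Qed.

(** The factor 2 comes from bounding the real and imaginary parts separately; every later use
    absorbs it. *)
Lemma normc_cint_le a b f (B : R) : a <= b -> rcont_on a b f ->
  (forall x, a <= x <= b -> normc (f x) <= B) -> normc (cint a b f) <= 2 * B * (b - a).
Proof.
move=> ab hf hB.
have part (P : C -> R) : (forall z, `|P z| <= normc z) ->
    mu.-integrable `[a, b] (EFin \o (fun x => P (f x))) ->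
    `|\int[mu]_(x in `[a, b]) P (f x)| <= B * (b - a).
  move=> Ple ip; rewrite (le_trans (le_normr_Rintegral _ _))//.
  have -> : B * (b - a) = \int[mu]_(x in `[a, b]) B.
    by rewrite Rintegral_cst//= measure_segment.
  apply: le_Rintegral => //.
  - exact: (@integrable_norm _ _ _ mu _ (fun x => P (f x))).
  - apply: continuous_compact_integrable; first exact: segment_compact.
    by apply: continuous_subspaceT => x; exact: cvg_cst.
  - by move=> x /=; rewrite in_itv/= => /hB; exact: le_trans.
rewrite (le_trans (le_normcD _ _))// normcM !normc_real normc_i mul1r.
rewrite -mulrA mulr_natl mulr2n lerD// part//; try exact: Re_le_normc; try exact: Im_le_normc.
- exact: Re_integrable.
- exact: Im_integrable.
Qed.

End SegmentIntegral.

(** * Complex differentiability and Goursat's theorem *)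

Section ComplexDerivative.
Variable R : realType.
Local Notation C := R[i].
Implicit Types (F G : C -> C) (z w : C).

(* Caratheodory's form of differentiability. *)
Definition cdiff F z := exists2 phi : C -> C,
  ccont phi z & \forall w \near cnb z, F w = F z + phi w * (w - z).

Lemma near_cnb z (P : set C) : (\forall w \near cnb z, P w) -> P z.
Proof. by case=> e e0; apply; rewrite subrr normc0. Qed.

Lemma cdiff_eq F G z : (\forall w \near cnb z, F w = G w) -> cdiff F z -> cdiff G z.
Proof.
move=> FG [phi hp hF]; exists phi => //; near=> w.
rewrite -(near FG w)// -(near_cnb FG); near: w; exact: hF.
Unshelve. all: by end_near. Qed.

Lemma cdiff_ccont F z : cdiff F z -> ccont F z.
Proof.
move=> [phi hp hF]; have : clim (cnb z) (fun w => F z + phi w * (w - z)) (F z + phi z * (z - z)).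
  apply: climD; first exact: clim_cst.
  by apply: climM => //; apply: climB; [exact: ccont_id|exact: clim_cst].
rewrite subrr mulr0 addr0; apply: clim_near.
by apply: filterS hF => w ->.
Qed.

Lemma cdiff_cst (k : C) z : cdiff (fun=> k) z.
Proof.
by exists (fun=> 0); [exact: clim_cst|apply: filterE => w; rewrite mul0r addr0].
Qed.

Lemma cdiff_id z : cdiff id z.
Proof.
by exists (fun=> 1); [exact: clim_cst|apply: filterE => w; rewrite mul1r addrC subrK].
Qed.

Lemma cdiffD F G z : cdiff F z -> cdiff G z -> cdiff (fun w => F w + G w) z.
Proof.
move=> [phi hp hF] [psi hq hG]; exists (fun w => phi w + psi w); first exact: climD.
near=> w; rewrite (near hF w)// (near hG w)//; ring.
Unshelve. all: by end_near. Qed.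

Lemma cdiffM F G z : cdiff F z -> cdiff G z -> cdiff (fun w => F w * G w) z.
Proof.
move=> dF [psi hq hG]; have cF := cdiff_ccont dF; case: dF => phi hp hF.
exists (fun w => F w * psi w + phi w * G z).
  by apply: climD; apply: climM => //; exact: clim_cst.
near=> w; rewrite (near hG w)// (mulrDr (F w)) {1}(near hF w)//; ring.
Unshelve. all: by end_near. Qed.

Lemma cdiffZ (k : C) F z : cdiff F z -> cdiff (fun w => k * F w) z.
Proof. by move=> hF; apply: cdiffM => //; exact: cdiff_cst. Qed.

Lemma cdiffN F z : cdiff F z -> cdiff (fun w => - F w) z.
Proof.
by move=> /(cdiffZ (-1)); apply: cdiff_eq; apply: filterE => w; rewrite mulN1r.
Qed.

Lemma cdiffB F G z : cdiff F z -> cdiff G z -> cdiff (fun w => F w - G w) z.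
Proof. by move=> hF /cdiffN; exact: cdiffD. Qed.

Lemma cdiffX F n z : cdiff F z -> cdiff (fun w => F w ^+ n) z.
Proof.
move=> hF; elim: n => [|n IH]; first exact: cdiff_cst.
by apply: cdiff_eq (cdiffM hF IH); apply: filterE => w; rewrite exprS.
Qed.

Lemma cdiff_sum (I : Type) (s : seq I) (F : I -> C -> C) z :
  (forall i, cdiff (F i) z) -> cdiff (fun w => \sum_(i <- s) F i w) z.
Proof.
move=> h; elim: s => [|i s IH].
  by apply: cdiff_eq (cdiff_cst 0 z); apply: filterE => w; rewrite big_nil.
by apply: cdiff_eq (cdiffD (h i) IH); apply: filterE => w; rewrite big_cons.
Qed.

Lemma ccont_neq0 F z : ccont F z -> F z != 0 -> \forall w \near cnb z, F w != 0.
Proof.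
move=> cF F0; have := cF _ (_ : 0 < normc (F z)); rewrite normc_gt0 => /(_ F0).
by apply: filterS => w; exact: normcV_lt.
Qed.

Lemma cdiffV F z : F z != 0 -> cdiff F z -> cdiff (fun w => (F w)^-1) z.
Proof.
move=> F0 dF; have cF := cdiff_ccont dF; case: dF => phi hp hF.
exists (fun w => - phi w * ((F w)^-1 * (F z)^-1)).
  apply: climM; first exact: climN.
  by apply: climM; [exact: climV|exact: clim_cst].
near=> w; have Fw0 : F w != 0 by near: w; exact: ccont_neq0.
have hw : phi w * (w - z) = F w - F z by rewrite (near hF w)// addrAC subrr add0r.
have -> : - phi w * ((F w)^-1 * (F z)^-1) * (w - z) =
  - (phi w * (w - z)) * ((F w)^-1 * (F z)^-1) by ring.
by rewrite hw; field; rewrite F0 Fw0.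
Unshelve. all: by end_near. Qed.

Lemma cdiff_comp F G z : cdiff F z -> cdiff G (F z) -> cdiff (fun w => G (F w)) z.
Proof.
move=> dF [psi hq hG]; have cF := cdiff_ccont dF; case: dF => phi hp hF.
exists (fun w => psi (F w) * phi w).
  by apply: climM => //; exact: (clim_comp cF hq).
have hGF := clim_cnb cF hG.
near=> w; have -> : G (F w) = G (F z) + psi (F w) * (F w - F z) by near: w; exact: hGF.
have -> : F w - F z = phi w * (w - z) by rewrite (near hF w)// addrAC subrr add0r.
by rewrite mulrA.
Unshelve. all: by end_near. Qed.

Lemma cnb_conj z (A : set C) : cnb z^* A -> cnb z [set w | A w^*].
Proof.
by move=> [e e0 h]; exists e => // w hw; apply: h; rewrite -rmorphB normc_conj.
Qed.

(** Schwarz reflection; in [sphere_polarization] it keeps the conjugated factors holomorphic. *)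
Lemma cdiff_conj F z : cdiff F z^* -> cdiff (fun w => (F w^*)^*) z.
Proof.
move=> [phi hp hF]; exists (fun w => (phi w^*)^*).
  by apply: clim_conj => e /hp /cnb_conj.
have := cnb_conj hF; apply: filterS => w /= ->.
by rewrite rmorphD rmorphM rmorphB/= !conjcK.
Qed.

Lemma cdiff_quot F t z : z != t -> cdiff F z -> cdiff (fun w => (F w - F t) / (w - t)) z.
Proof.
move=> zt hF; apply: cdiffM; first by apply: cdiffB => //; exact: cdiff_cst.
by apply: cdiffV; [rewrite subr_eq0|apply: cdiffB; [exact: cdiff_id|exact: cdiff_cst]].
Qed.

Lemma cdiff_horner (p : {poly C}) z : cdiff (fun w => p.[w]) z.
Proof.
apply: (@cdiff_eq (fun w => \sum_(i < size p) p`_i * w ^+ i)).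
  by apply: filterE => w; rewrite horner_coef.
by apply: cdiff_sum => i; apply: cdiffZ; apply: cdiffX; exact: cdiff_id.
Qed.

End ComplexDerivative.

(** * Goursat's theorem on rectangles *)

Section NestedIntervals.
Variable R : realType.

Lemma nested_intervals (a b : nat -> R) :
  (forall n, [/\ a n <= a n.+1, b n.+1 <= b n & a n <= b n]) ->
  exists x, forall n, a n <= x <= b n.
Proof.
move=> h.
have am m n : (m <= n)%N -> a m <= a n.
  elim: n => [|n IH]; first by rewrite leqn0 => /eqP ->.
  rewrite leq_eqVlt ltnS => /predU1P[->//|/IH]; by case: (h n) => h1 _ _ /le_trans; apply.
have bm m n : (m <= n)%N -> b n <= b m.
  elim: n => [|n IH]; first by rewrite leqn0 => /eqP ->.
  rewrite leq_eqVlt ltnS => /predU1P[->//|/IH]; by case: (h n) => _ h1 _; exact: le_trans.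
have ab m n : a m <= b n.
  apply: (le_trans (am _ _ (leq_maxl m n))); apply: (le_trans _ (bm _ _ (leq_maxr m n))).
  by case: (h (maxn m n)).
have hs : has_sup (range a).
  by split; [exists (a 0%N), 0%N|exists (b 0%N) => _ [n _ <-]].
exists (sup (range a)) => n; apply/andP; split.
  by apply: ub_le_sup; [case: hs|exists n].
by apply: ge_sup; [case: hs|move=> _ [m _ <-]].
Qed.

End NestedIntervals.

Section Goursat.
Variable R : realType.
Local Notation C := R[i].

(** The counterclockwise boundary integral of h dz; the factor i is dz = i dy on the vertical
    sides. *)
Definition rect_int (h : C -> C) (a b c d : R) : C :=
  cint a b (fun x => h (x +i* c)) - cint a b (fun x => h (x +i* d)) +
  'i%C * (cint c d (fun y => h (b +i* y)) - cint c d (fun y => h (a +i* y))).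

Definition cont_rect (h : C -> C) a b c d :=
  forall x y, a <= x <= b -> c <= y <= d -> ccont h (x +i* y).

Lemma rcont_horizontal (h : C -> C) a b c d y : cont_rect h a b c d -> c <= y <= d ->
  rcont_on a b (fun x => h (x +i* y)).
Proof.
move=> hc hy x hx e e0; have [d' d0 hd] := hc x y hx hy e e0.
have : \forall t \near x, `|x - t| < d' by exact: (@cvgr_dist_lt _ _ _ (nbhs x) _ id x cvg_id d' d0).
apply: filterS => t ht; apply: hd.
have -> : t +i* y - (x +i* y) = (t - x)%:C by apply/eqP; rewrite eq_complex/= subrr !eqxx.
by rewrite normc_real distrC.
Qed.

Lemma rcont_vertical (h : C -> C) a b c d x : cont_rect h a b c d -> a <= x <= b ->
  rcont_on c d (fun y => h (x +i* y)).
Proof.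
move=> hc hx y hy e e0; have [d' d0 hd] := hc x y hx hy e e0.
have : \forall t \near y, `|y - t| < d' by exact: (@cvgr_dist_lt _ _ _ (nbhs y) _ id y cvg_id d' d0).
apply: filterS => t ht; apply: hd.
have -> : x +i* t - (x +i* y) = 'i%C * (t - y)%:C.
  by apply/eqP; rewrite eq_complex/=; apply/andP; split; apply/eqP; ring.
by rewrite normcM normc_i mul1r normc_real distrC.
Qed.

Lemma rect_int_split h a b c d m n : a <= m <= b -> c <= n <= d -> cont_rect h a b c d ->
  rect_int h a b c d = rect_int h a m c n + rect_int h m b c n +
                       rect_int h a m n d + rect_int h m b n d.
Proof.
move=> mab ncd hc; have /andP[am mb] := mab; have /andP[cn nd] := ncd.
have ab := le_trans am mb; have cd := le_trans cn nd.
rewrite /rect_int (cint_split mab (rcont_horizontal hc _)) ?lexx//.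
rewrite (cint_split mab (rcont_horizontal hc _)) ?lexx ?cd//.
rewrite (cint_split ncd (rcont_vertical hc _)) ?lexx ?ab//.
rewrite (cint_split ncd (rcont_vertical hc _)) ?lexx ?ab//.
ring.
Qed.

(** Opposite sides differ by constants, l i (c - d) and l (b - a), whose contributions cancel. This
    removes the first-order part of [h] in Goursat's theorem. *)
Lemma rect_int_affine (k l z : C) a b c d : a <= b -> c <= d ->
  rect_int (fun w => k + l * (w - z)) a b c d = 0.
Proof.
move=> ab cd.
have aff w : ccont (fun w => k + l * (w - z)) w.
  apply: climD; first exact: clim_cst.
  by apply: climM; [exact: clim_cst|apply: climB; [exact: ccont_id|exact: clim_cst]].
have hc : cont_rect (fun w => k + l * (w - z)) a b c d by [].
rewrite /rect_int -!cintB ?lexx ?ab ?cd//; try exact: (rcont_horizontal hc); try exact: (rcont_vertical hc).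
all: rewrite ?lexx ?ab ?cd//.
all: try by apply: (rcont_horizontal hc); rewrite ?lexx ?cd.
all: try by apply: (rcont_vertical hc); rewrite ?lexx ?ab.
rewrite (@eq_cint _ _ _ _ (fun=> l * ('i%C * (c - d)%:C))); last first.
  by move=> x _; apply/eqP; rewrite eq_complex; case: k l z {aff hc} => ? ? [? ?] [? ?] /=;
     apply/andP; split; apply/eqP; ring.
rewrite cint_cst//.
rewrite (@eq_cint _ _ _ _ (fun=> l * (b - a)%:C)); last first.
  by move=> x _; apply/eqP; rewrite eq_complex; case: k l z {aff hc} => ? ? [? ?] [? ?] /=;
     apply/andP; split; apply/eqP; ring.
by rewrite cint_cst// !rmorphB/=; ring.
Qed.

Lemma normc_rect_int_le h a b c d (B : R) : a <= b -> c <= d -> cont_rect h a b c d ->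
  (forall x y, a <= x <= b -> c <= y <= d -> normc (h (x +i* y)) <= B) ->
  normc (rect_int h a b c d) <= 4 * B * ((b - a) + (d - c)).
Proof.
move=> ab cd hc hB.
rewrite (le_trans (le_normcD _ _))// normcM normc_i mul1r.
have b1 y : c <= y <= d -> normc (cint a b (fun x => h (x +i* y))) <= 2 * B * (b - a).
  move=> hy; apply: normc_cint_le => //; first exact: rcont_horizontal hc hy.
  by move=> x hx; exact: hB.
have b2 x : a <= x <= b -> normc (cint c d (fun y => h (x +i* y))) <= 2 * B * (d - c).
  move=> hx; apply: normc_cint_le => //; first exact: rcont_vertical hc hx.
  by move=> y hy; exact: hB.
have := le_normcD (cint a b (fun x => h (x +i* c))) (- cint a b (fun x => h (x +i* d))).
have := le_normcD (cint c d (fun y => h (b +i* y))) (- cint c d (fun y => h (a +i* y))).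
rewrite !normcN.
have := b1 c; rewrite lexx cd => /(_ isT).
have := b1 d; rewrite lexx cd => /(_ isT).
have := b2 a; rewrite lexx ab => /(_ isT).
have := b2 b; rewrite lexx ab => /(_ isT).
lra.
Qed.

End Goursat.

Section GoursatRectangle.
Variable R : realType.
Local Notation C := R[i].

(** Some quarter of each rectangle carries at least a fourth of the integral. Near the common point
    of the nested rectangles [h] is affine up to e times the distance; side lengths and distances
    both shrink like 2^-n, which balances the factor 4^n. *)
Theorem goursat (h : C -> C) (a b c d : R) : a <= b -> c <= d ->
  (forall x y, a <= x <= b -> c <= y <= d -> cdiff h (x +i* y)) ->
  rect_int h a b c d = 0.
Proof.
move=> ab cd hd.
pose T := (R * R * (R * R))%type.
pose J (q : T) : R := normc (rect_int h q.1.1 q.1.2 q.2.1 q.2.2).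
pose sub (q q' : T) := [/\ q.1.1 <= q'.1.1, q'.1.2 <= q.1.2, q.2.1 <= q'.2.1 & q'.2.2 <= q.2.2].
pose valid (q : T) := [/\ q.1.1 <= q.1.2, q.2.1 <= q.2.2 & sub ((a, b), (c, d)) q].
pose half (q q' : T) := [/\ valid q', sub q q', q'.1.2 - q'.1.1 = (q.1.2 - q.1.1) / 2,
  q'.2.2 - q'.2.1 = (q.2.2 - q.2.1) / 2 & J q <= 4 * J q'].
have vcont q : valid q -> cont_rect h q.1.1 q.1.2 q.2.1 q.2.2.
  move=> [_ _ [/= h1 h2 h3 h4]] x y /andP[x1 x2] /andP[y1 y2]; apply: cdiff_ccont; apply: hd;
    apply/andP; split.
  - exact: le_trans x1.
  - exact: le_trans h2.
  - exact: le_trans y1.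
  - exact: le_trans h4.
have tri4 (w1 w2 w3 w4 : C) : normc (w1 + w2 + w3 + w4) <= normc w1 + normc w2 + normc w3 + normc w4.
  by do 3! (rewrite (le_trans (le_normcD _ _))// lerD//).
(* The premise stands under the existential so that [choice] yields a function on all quadruples. *)
have step q : exists q', valid q -> half q q'.
  have [vq|nvq] := pselect (valid q); last by exists q.
  have [ab' cd' [/= s1 s2 s3 s4]] := vq.
  move: q vq ab' cd' s1 s2 s3 s4 => [[p q] [r s]] /= vq pq rs s1 s2 s3 s4.
  pose m := (p + q) / 2; pose n := (r + s) / 2.
  have pm : p <= m by rewrite /m; lra.
  have mq : m <= q by rewrite /m; lra.
  have rn : r <= n by rewrite /n; lra.
  have ns : n <= s by rewrite /n; lra.
  have hm1 : m - p = (q - p) / 2 by rewrite /m; field.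
  have hm2 : q - m = (q - p) / 2 by rewrite /m; field.
  have hn1 : n - r = (s - r) / 2 by rewrite /n; field.
  have hn2 : s - n = (s - r) / 2 by rewrite /n; field.
  have am := le_trans s1 pm; have mb := le_trans mq s2.
  have cn := le_trans s3 rn; have nd := le_trans ns s4.
  have := @rect_int_split _ h p q r s m n; rewrite pm mq rn ns => /(_ isT isT (vcont _ vq)) spl.
  have hJ : J (p, q, (r, s)) <= J (p, m, (r, n)) + J (m, q, (r, n)) + J (p, m, (n, s)) + J (m, q, (n, s)).
    exact: (eq_ind_r (fun z => normc z <= _) (tri4 _ _ _ _) spl).
  have [h1|h1] := lerP (J (p, q, (r, s))) (4 * J (p, m, (r, n))).
    by exists (p, m, (r, n)) => _; split => //; split => //; split.
  have [h2|h2] := lerP (J (p, q, (r, s))) (4 * J (m, q, (r, n))).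
    by exists (m, q, (r, n)) => _; split => //; split => //; split.
  have [h3|h3] := lerP (J (p, q, (r, s))) (4 * J (p, m, (n, s))).
    by exists (p, m, (n, s)) => _; split => //; split => //; split.
  have h4 : J (p, q, (r, s)) <= 4 * J (m, q, (n, s)).
    by clear - hJ h1 h2 h3; lra.
  by exists (m, q, (n, s)) => _; split => //; split => //; split.
have [f hf] := choice step.
pose s n := iter n f ((a, b), (c, d)).
have vs n : valid (s n).
  elim: n => [|n IH]; first by split => //; split => /=.
  by have [] := hf _ IH.
have hs n : half (s n) (s n.+1) by exact: hf.
have [x hx] : exists x, forall n, (s n).1.1 <= x <= (s n).1.2.
  by apply: nested_intervals => n; have [_ [] //= s1 s2 _ _ _ _ _] := hs n; have [? ? _] := vs n; split.
have [y hy] : exists y, forall n, (s n).2.1 <= y <= (s n).2.2.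
  by apply: nested_intervals => n; have [_ [] //= _ _ s1 s2 _ _ _] := hs n; have [? ? _] := vs n; split.
have wx n : (s n).1.2 - (s n).1.1 = (b - a) / 2 ^+ n.
  elim: n => [|n IH]; first by rewrite expr0 divr1.
  by have [_ _ -> _ _] := hs n; rewrite IH exprS invfM mulrCA mulrC.
have wy n : (s n).2.2 - (s n).2.1 = (d - c) / 2 ^+ n.
  elim: n => [|n IH]; first by rewrite expr0 divr1.
  by have [_ _ _ -> _] := hs n; rewrite IH exprS invfM mulrCA mulrC.
have JJ n : J (s 0%N) <= 4 ^+ n * J (s n).
  elim: n => [|n IH]; first by rewrite expr0 mul1r.
  by have [_ _ _ _ h1] := hs n; rewrite (le_trans IH)// exprSr -mulrA ler_wpM2l// exprn_ge0.
pose l := (b - a) + (d - c).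
have l0 : 0 <= l by rewrite addr_ge0// subr_ge0.
have [phi hp hF] : cdiff h (x +i* y) by apply: hd; [exact: (hx 0%N)|exact: (hy 0%N)].
suff H : forall e, 0 < e -> J (s 0%N) <= 4 * e * l ^+ 2.
  apply/eqP; rewrite -normc_eq0 eq_le normc_ge0 andbT.
  rewrite leNgt; apply/negP => J0.
  have : J (s 0%N) <= J (s 0%N) / 2; last by rewrite /J/= in J0 *; lra.
  (* The [+ 1] guards against [l = 0]. *)
  have e0 : 0 < J (s 0%N) / 2 / (4 * (l ^+ 2 + 1)).
    by rewrite !divr_gt0// mulr_gt0// ltr_wpDl// sqr_ge0.
  rewrite (le_trans (H _ e0))//.
  have p0 : 0 < l ^+ 2 + 1 by rewrite ltr_wpDl// sqr_ge0.
  rewrite [X in X <= _](_ : _ = J (s 0%N) / 2 * (l ^+ 2 / (l ^+ 2 + 1))); last by field; exact: lt0r_neq0.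
  rewrite ler_piMr// ?divr_ge0 ?(ltW J0)//.
  by rewrite ler_pdivrMr// mul1r lerDl.
move=> e e0.
have [d1 d10 H] : \forall w \near cnb (x +i* y),
    h w = h (x +i* y) + phi w * (w - (x +i* y)) /\ normc (phi w - phi (x +i* y)) < e.
  near=> w; split; near: w; [exact: hF|exact: hp].
have [n hn] : exists n, l / 2 ^+ n < d1.
  exists (Num.bound (l / d1)); have : l / d1 < (2 ^ Num.bound (l / d1))%N%:R.
    by rewrite (lt_le_trans (archi_boundP _))// ?divr_ge0 ?(ltW d10)// ler_nat ltnW// ltn_expl.
  by rewrite natrX ltr_pdivrMr// ltr_pdivrMr ?exprn_gt0// mulrC.
have [v1 v2 [/= s1 s2 s3 s4]] := vs n.
set z0 := x +i* y in H *.
have ln : ((s n).1.2 - (s n).1.1) + ((s n).2.2 - (s n).2.1) = l / 2 ^+ n.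
  by rewrite wx wy -mulrDl.
have hclose u v : (s n).1.1 <= u <= (s n).1.2 -> (s n).2.1 <= v <= (s n).2.2 ->
    normc (u +i* v - z0) <= l / 2 ^+ n.
  move=> /andP[u1 u2] /andP[w1 w2]; have /andP[x1 x2] := hx n; have /andP[y1 y2] := hy n.
  rewrite (le_trans (normc_le_ReIm _))// -ln lerD//= ler_norml; apply/andP; split; lra.
have hcont := vcont _ (vs n).
have haff w : ccont (fun w => h z0 + phi z0 * (w - z0)) w.
  apply: climD; first exact: clim_cst.
  by apply: climM; [exact: clim_cst|apply: climB; [exact: ccont_id|exact: clim_cst]].
have cr : cont_rect (fun w => h w - (h z0 + phi z0 * (w - z0))) (s n).1.1 (s n).1.2 (s n).2.1 (s n).2.2.
  by move=> u v hu hv; apply: climB; [exact: hcont|exact: haff].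
have caff : cont_rect (fun w => h z0 + phi z0 * (w - z0)) (s n).1.1 (s n).1.2 (s n).2.1 (s n).2.2.
  by move=> u v hu hv; exact: haff.
have split : rect_int h (s n).1.1 (s n).1.2 (s n).2.1 (s n).2.2 =
    rect_int (fun w => h w - (h z0 + phi z0 * (w - z0))) (s n).1.1 (s n).1.2 (s n).2.1 (s n).2.2.
  rewrite -[LHS]subr0 -(@rect_int_affine _ (h z0) (phi z0) z0 (s n).1.1 (s n).1.2 (s n).2.1 (s n).2.2)//.
  rewrite /rect_int.
  rewrite !cintB ?lexx ?v1 ?v2//; last first.
  all: try by apply: (rcont_horizontal hcont); rewrite ?lexx ?v2.
  all: try by apply: (rcont_vertical hcont); rewrite ?lexx ?v1.
  all: try by apply: (rcont_horizontal caff); rewrite ?lexx ?v2.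
  all: try by apply: (rcont_vertical caff); rewrite ?lexx ?v1.
  ring.
have Jn : J (s n) <= 4 * (e * (l / 2 ^+ n)) * (l / 2 ^+ n).
  rewrite /J split -{2}ln; apply: normc_rect_int_le => // u v hu hv.
  have [-> h2] := H (u +i* v) (le_lt_trans (hclose _ _ hu hv) hn).
  have -> : h z0 + phi (u +i* v) * (u +i* v - z0) - (h z0 + phi z0 * (u +i* v - z0)) =
    (phi (u +i* v) - phi z0) * (u +i* v - z0) by ring.
  by rewrite normcM ler_pM ?normc_ge0 ?(ltW h2)// hclose.
rewrite (le_trans (JJ n))//.
have -> : 4 * e * l ^+ 2 = 4 ^+ n * (4 * (e * (l / 2 ^+ n)) * (l / 2 ^+ n)).
  have -> : (4 : R) = 2 ^+ 2 by rewrite -natrX.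
  rewrite -exprM mulnC exprM; field; by rewrite expf_neq0.
by rewrite ler_wpM2l// exprn_ge0.
Unshelve. all: by end_near. Qed.

End GoursatRectangle.

(** * Means over circles and Cauchy's formula *)

Section CircleMean.
Variable R : realType.
Local Notation C := R[i].

Lemma is_derive_bound (f : R -> R) (x df : R) : is_derive x 1 f df -> forall e, 0 < e ->
  exists2 d, 0 < d & forall h, `|h| < d -> `|f (x + h) - f x - df * h| <= e * `|h|.
Proof.
move=> [fd fdf] e e0; move: fd; rewrite /derivable => /cvg_ex[l hl].
have ll : l = df by rewrite -fdf /derive; apply/esym/cvg_lim.
move: hl; rewrite ll => /cvgrPdist_lt/(_ e e0) => -[d /= d0 hd].
exists d => // h hh; have [->|h0] := eqVneq h 0; first by rewrite addr0 !subrr mulr0 subrr normr0 mulr0.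
have := hd h; rewrite /ball_/= sub0r normrN => /(_ hh h0).
rewrite /GRing.scale/= mulr1 => h1.
have -> : f (x + h) - f x - df * h = (df - h^-1 * (f (h + x) - f x)) * - h.
  by rewrite (addrC h x); field.
by rewrite normrM normrN ler_wpM2r// ltW.
Qed.

Definition cis (t : R) : C := cos t +i* sin t.

Definition expC (z : C) : C := (expR (Re z))%:C * cis (Im z).

Lemma normc_cis t : normc (cis t) = 1.
Proof.
apply/eqP; rewrite -(@eqrXn2 _ 2)// ?normc_ge0// normc_sqr expr1n /=; apply/eqP.
exact: cos2Dsin2.
Qed.

Lemma cisD s t : cis (s + t) = cis s * cis t.
Proof. by rewrite /cis cosD sinD; apply/eqP; rewrite eq_complex/= [cos s * sin t + _]addrC !eqxx. Qed.

Lemma expCD z w : expC (z + w) = expC z * expC w.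
Proof.
case: z w => a b [c d]; rewrite /expC/= expRD cisD rmorphM/=; ring.
Qed.

(** The complex derivative at 0, to which the addition law [expCD] reduces every other point. *)
Lemma expC_bound e : 0 < e -> \forall h \near cnb (0 : C), normc (expC h - 1 - h) <= e * normc h.
Proof.
move=> e0.
(* The three terms of the decomposition below take 1, 4 and 1 shares of e / 6. *)
have e6 : 0 < e / 6 by rewrite divr_gt0.
have [d1 d10 h1] := is_derive_bound (is_derive_expR 0) e6.
have [d2 d20 h2] := is_derive_bound (is_derive_sin 0) e6.
have [d3 d30 h3] := is_derive_bound (is_derive_cos 0) e6.
exists (Num.min (Num.min d1 d2) (Num.min d3 (Num.min 1 (e / 6)))); first by rewrite !lt_min d10 d20 d30 e6 ltr01.
move=> [x y]; rewrite subr0 !lt_min => /andP[/andP[l1 l2] /andP[l3 /andP[l4 l5]]].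
have hx := Re_le_normc (x +i* y); have hy := Im_le_normc (x +i* y); simpl in hx, hy.
have := h1 x (le_lt_trans hx l1); rewrite add0r expR0 mul1r => k1.
have := h2 y (le_lt_trans hy l2); rewrite add0r sin0 cos0 mul1r subr0 => k2.
have := h3 y (le_lt_trans hy l3); rewrite add0r sin0 cos0 oppr0 mul0r subr0 => k3.
set n := normc _ in hx hy l1 l2 l3 l4 l5 *.
have -> : expC (x +i* y) - 1 - (x +i* y) = (expR x - 1 - x)%:C * cis y +
   (1 + x)%:C * ((cos y - 1)%:C + 'i%C * (sin y - y)%:C) + x%:C * ('i%C * y%:C).
  by apply/eqP; rewrite eq_complex/=; apply/andP; split; apply/eqP; ring.
rewrite (le_trans (le_normcD _ _))// (le_trans (lerD (le_normcD _ _) (lexx _)))//.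
rewrite !normcM !normc_real normc_cis normc_i mul1r mulr1.
have q1 : normc ((cos y - 1)%:C + 'i%C * (sin y - y)%:C) <= e / 6 * n + e / 6 * n.
  rewrite (le_trans (le_normcD _ _))// normcM normc_i mul1r !normc_real lerD//.
    by rewrite (le_trans k3)// ler_wpM2l// ltW.
  by rewrite (le_trans k2)// ler_wpM2l// ltW.
have q2 : `|1 + x| <= 2.
  by rewrite (le_trans (ler_normD _ _))// normr1 (_ : 2 = 1 + 1)// lerD2l (le_trans hx)// ltW.
have q3 : `|1 + x| * normc ((cos y - 1)%:C + 'i%C * (sin y - y)%:C) <= 2 * (e / 6 * n + e / 6 * n).
  by rewrite ler_pM// normc_ge0.
have q4 : `|x| * `|y| <= e / 6 * n by rewrite ler_pM// (le_trans hx)// ltW.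
have q5 : `|expR x - 1 - x| <= e / 6 * n by rewrite (le_trans k1)// ler_wpM2l// ltW.
clear - q3 q4 q5; lra.
Qed.

Lemma cdiff_expC z : cdiff expC z.
Proof.
exists (fun w => expC z * (if w == z then 1 else (expC (w - z) - 1) / (w - z))).
  apply: climM; first exact: clim_cst.
  rewrite eqxx => e e0.
  have e2 : 0 < e / 2 by rewrite divr_gt0.
  have [d d0 hd] := expC_bound e2; exists d => // w hw.
  case: eqVneq => [_|wz]; first by rewrite subrr normc0.
  have := hd (w - z); rewrite subr0 => /(_ hw).
  have wz0 : w - z != 0 by rewrite subr_eq0.
  have -> : (expC (w - z) - 1) / (w - z) - 1 = (expC (w - z) - 1 - (w - z)) / (w - z) by field.
  rewrite normcM normcV// -ler_pdivrMr ?normc_gt0// => /le_lt_trans; apply.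
  by rewrite ltr_pdivrMr// mulr_natr mulr2n ltrDl.
apply: filterE => w; case: eqVneq => [->|wz]; first by rewrite subrr mulr0 addr0.
have wz0 : w - z != 0 by rewrite subr_eq0.
have {1}-> : w = z + (w - z) by ring.
by rewrite expCD; field.
Qed.

(** Equals (1 / 2 pi i) times the integral of phi(s) ds / s over the unit circle. Other circles
    centred at 0 are reached by rescaling the argument of [phi]. *)
Definition mean (phi : C -> C) : C :=
  ((pi *+ 2)^-1)%:C * cint 0 (pi *+ 2) (fun t => phi (cis t)).

Definition ucnb (s : C) : set_system C := within [set w | normc w = 1] (cnb s).

Global Instance ucnb_filter s : Filter (ucnb s).
Proof. exact: within_filter. Qed.

Lemma ucnb_unit s : \forall w \near ucnb s, normc w = 1.
Proof. by rewrite /ucnb near_withinE; apply: filterE. Qed.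

Lemma clim_ucnb (phi : C -> C) s l : clim (cnb s) phi l -> clim (ucnb s) phi l.
Proof. by move=> h e /h; apply: cvg_within. Qed.

Lemma clim_ucnb_id s : clim (ucnb s) id s.
Proof. by apply: clim_ucnb; exact: ccont_id. Qed.

Definition ccirc (phi : C -> C) := forall s, normc s = 1 -> clim (ucnb s) phi (phi s).

Lemma pi2_gt0 : 0 < pi *+ 2 :> R.
Proof. by rewrite pmulrn_lgt0 ?pi_gt0. Qed.

Lemma cis_rcont t : rcont cis t.
Proof.
have hc : clim (nbhs t) (fun u => (cos u)%:C) (cos t)%:C.
  move=> e e0; have := @continuous_cos R t; move=> /cvgrPdist_lt/(_ e e0).
  by apply: filterS => u; rewrite -rmorphB normc_real distrC.
have hs : clim (nbhs t) (fun u => (sin u)%:C) (sin t)%:C.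
  move=> e e0; have := @continuous_sin R t; move=> /cvgrPdist_lt/(_ e e0).
  by apply: filterS => u; rewrite -rmorphB normc_real distrC.
rewrite /rcont; have -> : cis t = (cos t)%:C + 'i%C * (sin t)%:C by exact: complexE.
apply: clim_near (climD hc (climM (clim_cst 'i%C) hs)).
by apply: filterE => u; rewrite [RHS]complexE.
Qed.

Lemma ccirc_rcont phi : ccirc phi -> rcont_on 0 (pi *+ 2) (fun t => phi (cis t)).
Proof.
move=> h t _ e /(h _ (normc_cis t))[d d0 hd].
have := @cis_rcont t _ d0; apply: filterS => u hu; apply: hd => //; exact: normc_cis.
Qed.

Lemma eq_mean phi psi : (forall s, normc s = 1 -> phi s = psi s) -> mean phi = mean psi.
Proof. by move=> h; congr (_ * _); apply: eq_cint => t _; rewrite h ?normc_cis. Qed.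

Lemma meanD phi psi : ccirc phi -> ccirc psi -> mean (fun s => phi s + psi s) = mean phi + mean psi.
Proof. by move=> h1 h2; rewrite /mean cintD ?mulrDr//; exact: ccirc_rcont. Qed.

Lemma meanZ k phi : ccirc phi -> mean (fun s => k * phi s) = k * mean phi.
Proof. by move=> h1; rewrite /mean cintZ; [ring|exact: ccirc_rcont]. Qed.

Lemma meanB phi psi : ccirc phi -> ccirc psi -> mean (fun s => phi s - psi s) = mean phi - mean psi.
Proof. by move=> h1 h2; rewrite /mean cintB ?mulrBr//; exact: ccirc_rcont. Qed.

Lemma mean_cst k : mean (fun=> k) = k.
Proof.
rewrite /mean cint_cst; last by rewrite ltW// pi2_gt0.
rewrite subr0 mulrCA -rmorphM/= mulVf ?mulr1//.
by rewrite gt_eqF// pi2_gt0.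
Qed.

Lemma ccirc_cst k : ccirc (fun=> k).
Proof. by move=> s _; exact: clim_cst. Qed.

Lemma mean_sum (I : Type) (r : seq I) (phi : I -> C -> C) : (forall i, ccirc (phi i)) ->
  mean (fun s => \sum_(i <- r) phi i s) = \sum_(i <- r) mean (phi i).
Proof.
move=> h; elim: r => [|i r IH].
  by rewrite big_nil -{2}(mean_cst 0); apply: eq_mean => s _; rewrite big_nil.
rewrite big_cons -IH -meanD//; last first.
  by move=> s hs; apply: clim_sum => j _; exact: h.
by apply: eq_mean => s _; rewrite big_cons.
Qed.

Lemma normc_mean_le phi B : ccirc phi ->
  (forall t, 0 <= t <= pi *+ 2 -> normc (phi (cis t)) <= B) -> normc (mean phi) <= 2 * B.
Proof.
move=> h hB; rewrite /mean normcM normc_real ger0_norm ?invr_ge0 ?(ltW pi2_gt0)//.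
rewrite mulrC ler_pdivrMr ?pi2_gt0//.
rewrite -[X in _ * X]subr0; apply: normc_cint_le; first by rewrite ltW// pi2_gt0.
  exact: ccirc_rcont.
exact: hB.
Qed.

(* Goursat's theorem on the rectangle [ln r1, ln r2] x [0, 2 pi] in logarithmic
   coordinates, whose horizontal sides cancel by periodicity. *)
Theorem mean_annulus (F : C -> C) (r1 r2 : R) : 0 < r1 -> r1 <= r2 ->
  (forall z, r1 <= normc z <= r2 -> cdiff F z) ->
  mean (fun s => F (r1%:C * s)) = mean (fun s => F (r2%:C * s)).
Proof.
move=> r10 r12 hF.
have r20 := lt_le_trans r10 r12.
have l12 : ln r1 <= ln r2 by rewrite ler_ln.
have nexp z : normc (expC z) = expR (Re z).
  by rewrite normcM normc_cis mulr1 normc_real ger0_norm// expR_ge0.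
have := @goursat _ (fun w => F (expC w)) (ln r1) (ln r2) 0 (pi *+ 2) l12 (ltW pi2_gt0).
have h x y : ln r1 <= x <= ln r2 -> 0 <= y <= pi *+ 2 -> cdiff (fun w => F (expC w)) (x +i* y).
  move=> /andP[x1 x2] _; apply: cdiff_comp; first exact: cdiff_expC.
  apply: hF; rewrite nexp/= -(lnK r10) -(lnK r20) !ler_expR//.
  by rewrite x1.
move=> /(_ h); rewrite /rect_int.
rewrite (@eq_cint _ _ _ (fun x => F (expC (x +i* (pi *+ 2)))) (fun x => F (expC (x +i* 0)))); last first.
  by move=> x _; rewrite /expC/= /cis cos2pi sin2pi cos0 sin0.
rewrite subrr add0r => /eqP; rewrite mulf_eq0 subr_eq0 => /orP[|/eqP].
  by rewrite -normc_eq0 normc_i oner_eq0.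
by rewrite /expC/= !lnK// /mean => ->.
Qed.

End CircleMean.

(** * Cauchy's formula, Taylor coefficients, maximum principle and Liouville's theorem *)

Section CauchyFormula.
Variable R : realType.
Local Notation C := R[i].

(** Joint limits at each point of the circle become uniform ones by compactness of the parameter
    segment, and uniform limits pass through the mean. *)
Lemma mean_clim (T : Type) (F : set_system T) {FF : Filter F} (Phi : T -> C -> C) (phi0 : C -> C) :
  ccirc phi0 -> (\forall t \near F, ccirc (Phi t)) ->
  (forall s, normc s = 1 -> clim (filter_prod F (ucnb s)) (fun p => Phi p.1 p.2) (phi0 s)) ->
  clim F (fun t => mean (Phi t)) (mean phi0).
Proof.
move=> h0 hP hj e e0; have e4 : 0 < e / 4 by rewrite divr_gt0.
have e8 : 0 < e / 4 / 2 by rewrite divr_gt0.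
have /compact_near_coveringP/(_ T F (fun t x => normc (Phi t (cis x) - phi0 (cis x)) < e / 4) FF) H :=
  @segment_compact R 0 (pi *+ 2).
have {}H : \forall t \near F, `[0, pi *+ 2] `<=` (fun x => normc (Phi t (cis x) - phi0 (cis x)) < e / 4).
  apply: H => x _.
  have u1 := normc_cis x.
  have [[P Q] [/= hA [d d0 hB]] AB] := hj _ u1 _ e8.
  have [d' d'0 hd'] := h0 _ u1 _ e8.
  exists ([set y | normc (cis y - cis x) < Num.min d d'], P).
    by split => //=; apply: (@cis_rcont _ x); rewrite lt_min d0.
  move=> [y t] /= [+ At]; rewrite lt_min => /andP[l1 l2].
  have -> : Phi t (cis y) - phi0 (cis y) =
      (Phi t (cis y) - phi0 (cis x)) - (phi0 (cis y) - phi0 (cis x)) by ring.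
  rewrite (le_lt_trans (le_normcD _ _))// normcN (splitr (e / 4)) ltrD//.
    apply: (AB (t, cis y)); split => //=; apply: hB => //; exact: normc_cis.
  by apply: hd' => //; exact: normc_cis.
near=> t; have ct : ccirc (Phi t) by near: t.
rewrite -meanB//.
have : normc (mean (fun s => Phi t s - phi0 s)) <= 2 * (e / 4).
  apply: normc_mean_le; first by move=> s hs; apply: climB; [exact: ct|exact: h0].
  move=> x hx; have /(_ x) : `[0, pi *+ 2] `<=` (fun x => normc (Phi t (cis x) - phi0 (cis x)) < e / 4) by near: t.
  by rewrite /= in_itv/= => /(_ hx)/ltW.
move/le_lt_trans; apply; clear - e0; lra.
Unshelve. all: by end_near. Qed.

Lemma ccirc_bounded (phi : C -> C) : ccirc phi ->
  exists2 B : R, 0 <= B & forall t, 0 <= t <= pi *+ 2 -> normc (phi (cis t)) <= B.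
Proof.
move=> h.
have /compact_near_coveringP/(_ _ (pinfty_nbhs R) (fun B x => normc (phi (cis x)) <= B) _) H :=
  @segment_compact R 0 (pi *+ 2).
have {}H : \forall B \near +oo, `[0, pi *+ 2] `<=` (fun x => normc (phi (cis x)) <= B).
  apply: H => x _.
  have [d d0 hd] := h _ (normc_cis x) 1 ltr01.
  exists ([set y | normc (cis y - cis x) < d], [set B | normc (phi (cis x)) + 1 <= B]).
    split => /=; first exact: (@cis_rcont _ x).
    exact: nbhs_pinfty_ge (num_real _).
  move=> [y B] /= [hy hB]; apply: le_trans hB.
  rewrite -lerBlDl (le_trans (ler_norm _))// (le_trans (le_normcB_dist _ _))// ltW//.
  by apply: hd => //; exact: normc_cis.
near (pinfty_nbhs R) => B.
exists B; first by near: B; exact: nbhs_pinfty_ge (num_real _).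
move=> t ht; have /(_ t) : `[0, pi *+ 2] `<=` (fun x => normc (phi (cis x)) <= B) by near: B.
by rewrite /= in_itv/=; apply.
Unshelve. all: by end_near. Qed.

Lemma normc_scale (r : R) s : 0 <= r -> normc s = 1 -> normc (r%:C * s) = r.
Proof. by move=> r0 hs; rewrite normcM normc_real hs mulr1 ger0_norm. Qed.

Lemma ccirc_scale (G : C -> C) r : 0 <= r -> (forall z, normc z = r -> ccont G z) -> ccirc (fun s => G (r%:C * s)).
Proof.
move=> r0 h s hs; apply: (@clim_comp _ _ _ _ _ G).
  by apply: climM; [exact: clim_cst|exact: clim_ucnb_id].
by apply: h; exact: normc_scale.
Qed.

Lemma mean_radius_cont (G : C -> C) (r x0 : R) : 0 <= x0 <= r ->
  (forall z, normc z <= r -> ccont G z) -> forall e, 0 < e ->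
  exists2 d, 0 < d & forall x, 0 <= x <= r -> `|x - x0| < d ->
    normc (mean (fun s => G (x%:C * s)) - mean (fun s => G (x0%:C * s))) < e.
Proof.
move=> /andP[x00 x0r] hG e e0.
pose F := within [set x | 0 <= x <= r] (nbhs x0).
have FF : Filter F by exact: within_filter.
have idF : clim F (fun x => x%:C) x0%:C by move=> e' e'0; apply: cvg_within; exact: nbhs_real_clim.
have : clim F (fun x => mean (fun s => G (x%:C * s))) (mean (fun s => G (x0%:C * s))).
  apply: mean_clim.
  - by apply: ccirc_scale => // z hz; apply: hG; rewrite hz.
  - rewrite /F near_withinE; apply: filterE => x /= /andP[h1 h2].
    by apply: ccirc_scale => // z hz; apply: hG; rewrite hz.
  - move=> s hs; apply: (@clim_comp _ _ _ _ _ G); last by apply: hG; rewrite normc_scale.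
    apply: climM.
      exact: (@clim_prod1 _ _ _ _ _ _ _ (fun x : R => x%:C)).
    exact: (@clim_prod2 _ _ _ _ _ _ _ (fun w : C => w) _ (@clim_ucnb_id _ s)).
move=> /(_ e e0); rewrite /F near_withinE => /nbhs_ballP[d /= d0 hd].
by exists d => // x hx xx0; apply: hd => //; rewrite /ball/= distrC.
Qed.

(* The exceptional circle |z| = rho is harmless: the mean is constant on each
   side of it and continuous across it. *)
Lemma mean_center (G : C -> C) (r rho : R) : 0 < r ->
  (forall z, normc z <= r -> ccont G z) ->
  (forall z, normc z <= r -> normc z != rho -> cdiff G z) ->
  mean (fun s => G (r%:C * s)) = G 0.
Proof.
move=> r0 cG dG; pose m x := mean (fun s => G (x%:C * s)).
have H a b : 0 <= a -> a < b -> b <= r -> (forall x, a < x -> x < b -> x != rho) -> m a = m b.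
  move=> a0 ab br hx.
  have cst x y : a < x -> x <= y -> y < b -> m x = m y.
    move=> ax xy yb; apply: mean_annulus => //; first exact: le_lt_trans ax.
    move=> z /andP[z1 z2]; apply: dG; first by rewrite (le_trans z2)// (le_trans (ltW yb)).
    by apply: hx; [exact: lt_le_trans z1|exact: le_lt_trans yb].
  apply/eqP; rewrite -subr_eq0 -normc_eq0 eq_le normc_ge0 andbT leNgt; apply/negP => N0.
  have N2 : 0 < normc (m a - m b) / 2 by rewrite divr_gt0.
  have b0 : 0 <= b by rewrite (le_trans a0)// ltW.
  have ar : a <= r by rewrite (le_trans (ltW ab)).
  have := @mean_radius_cont G r a; rewrite a0 ar => /(_ isT cG _ N2)[d d0 hd].
  have := @mean_radius_cont G r b; rewrite b0 br => /(_ isT cG _ N2)[d' d'0 hd'].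
  (* [x] is close to [a], [y] is close to [b], and the midpoint separates them, so a < x <= y < b
     and the means at [x] and [y] coincide. *)
  pose x := Num.min (a + d / 2) ((a + b) / 2).
  pose y := Num.max (b - d' / 2) ((a + b) / 2).
  have ax : a < x by rewrite lt_min; apply/andP; split; clear - d0 ab; lra.
  have xb : x <= (a + b) / 2 by rewrite ge_min lexx orbT.
  have xd : x <= a + d / 2 by rewrite ge_min lexx.
  have yb : y < b by rewrite gt_max; apply/andP; split; clear - d'0 ab; lra.
  have ya : (a + b) / 2 <= y by rewrite le_max lexx orbT.
  have yd : b - d' / 2 <= y by rewrite le_max lexx.
  have mx : normc (m x - m a) < normc (m a - m b) / 2.
    apply: hd; first by apply/andP; split; clear - a0 ax xb ab br; lra.
    by rewrite ltr_norml; apply/andP; split; clear - ax xd d0; lra.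
  have my : normc (m y - m b) < normc (m a - m b) / 2.
    apply: hd'; first by apply/andP; split; clear - a0 ya yb ab br; lra.
    by rewrite ltr_norml; apply/andP; split; clear - yb yd d'0; lra.
  have xy : m x = m y by apply: cst => //; exact: le_trans ya.
  have : normc (m a - m b) < normc (m a - m b); last by rewrite ltxx.
  have {1}-> : m a - m b = (m y - m b) - (m x - m a) by rewrite xy; ring.
  rewrite (le_lt_trans (le_normcD _ _))// normcN (splitr (normc (m a - m b))) ltrD//.
have -> : G 0 = m 0 by rewrite /m -(mean_cst (G 0)); apply: eq_mean => s _; rewrite mul0r.
have [rr|rr] := lerP r rho.
  by apply/esym/H => // x _ xr; rewrite lt_eqF// (lt_le_trans xr).
have [rr0|rr0] := lerP rho 0.
  by apply/esym/H => // x x0 _; rewrite gt_eqF// (le_lt_trans rr0).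
rewrite (@H 0 rho) ?(ltW rr)// ?(@H rho r) ?(ltW rr0)//.
- by move=> x h _; rewrite gt_eqF.
- by move=> x _ h; rewrite lt_eqF.
Qed.

Lemma mean_value (F : C -> C) r : 0 < r -> (forall z, normc z <= r -> cdiff F z) ->
  mean (fun s => F (r%:C * s)) = F 0.
Proof.
move=> r0 h; apply: (@mean_center _ _ 0) => // z hz; [apply: cdiff_ccont|move=> _]; exact: h.
Qed.

Lemma pole_neq0 (r : R) s t : 0 <= r -> normc s = 1 -> normc t < r -> r%:C * s - t != 0.
Proof. by move=> r0 hs; rewrite subr_eq0; apply: contraTneq => <-; rewrite normc_scale// ltxx. Qed.

Lemma ccirc_pole (r : R) t : normc t < r -> ccirc (fun s => (r%:C * s - t)^-1).
Proof.
move=> tr s hs; apply: climV; first by apply: pole_neq0 => //; rewrite (le_trans (normc_ge0 _) (ltW tr)).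
by apply: climB; [apply: climM; [exact: clim_cst|exact: clim_ucnb_id]|exact: clim_cst].
Qed.

Lemma ccircM (phi psi : C -> C) : ccirc phi -> ccirc psi -> ccirc (fun s => phi s * psi s).
Proof. by move=> h1 h2 s hs; apply: climM; [exact: h1|exact: h2]. Qed.

Lemma ccircX (phi : C -> C) n : ccirc phi -> ccirc (fun s => phi s ^+ n).
Proof. by move=> h1 s hs; apply: climX; exact: h1. Qed.

Lemma ccirc_rescale (r : R) : ccirc (fun s => r%:C * s).
Proof. by move=> s hs; apply: climM; [exact: clim_cst|exact: clim_ucnb_id]. Qed.

(** The mean does not change when the radius grows, while the kernel tends uniformly to 1. *)
Lemma mean_kernel (r : R) t : normc t < r -> mean (fun s => r%:C * s / (r%:C * s - t)) = 1.
Proof.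
move=> tr; have r0 := le_lt_trans (normc_ge0 t) tr.
have cK p : normc t < p -> ccirc (fun s => p%:C * s / (p%:C * s - t)).
  by move=> tp; apply: ccircM; [exact: ccirc_rescale|exact: ccirc_pole].
have cst p : r <= p -> mean (fun s => r%:C * s / (r%:C * s - t)) = mean (fun s => p%:C * s / (p%:C * s - t)).
  move=> rp; apply: (@mean_annulus _ (fun z => z / (z - t))) => // z /andP[z1 _].
  apply: cdiffM; first exact: cdiff_id.
  apply: cdiffV; last by apply: cdiffB; [exact: cdiff_id|exact: cdiff_cst].
  by rewrite subr_eq0; apply: contraTneq (lt_le_trans tr z1) => ->; rewrite ltxx.
apply/eqP; rewrite -subr_eq0 -normc_eq0 eq_le normc_ge0 andbT leNgt; apply/negP => N0.
set N := normc _ in N0.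
have NE p : r <= p -> N = normc (mean (fun s => p%:C * s / (p%:C * s - t)) - 1).
  by move=> rp; rewrite /N (cst p rp).
clearbody N; clear cst.
have T0 := normc_ge0 t.
(* Chosen so that |z - t| >= 4 |t| / N on the circle of radius [p], whence the kernel differs from 1
   by at most N / 4. *)
pose p := r + 4 * normc t / N.
have q0 : 0 <= 4 * normc t / N by rewrite divr_ge0 ?mulr_ge0// ltW.
have rp : r <= p by rewrite lerDl.
have tp : normc t < p by exact: lt_le_trans rp.
have p0 := lt_le_trans r0 rp.
have : N <= 2 * (N / 4); last by clear - N0; lra.
rewrite [X in X <= _](NE _ rp) -{1}(mean_cst (1 : C)) -meanB; [|exact: cK|exact: ccirc_cst].
apply: normc_mean_le.
  by move=> s hs; apply: climB; [exact: cK|exact: clim_cst].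
move=> x _; have pz := pole_neq0 (ltW p0) (normc_cis x) tp.
have -> : p%:C * cis x / (p%:C * cis x - t) - 1 = t / (p%:C * cis x - t) by field.
rewrite normcM normcV// ler_pdivrMr ?normc_gt0//.
have h1 : 4 * normc t / N <= normc (p%:C * cis x - t).
  rewrite (le_trans _ (le_trans (ler_norm _) (le_normcB_dist _ _)))// normc_scale ?normc_cis ?(ltW p0)//.
  rewrite /p addrAC lerDr subr_ge0; exact: ltW.
have <- : N / 4 * (4 * normc t / N) = normc t by field; exact: lt0r_neq0.
by rewrite ler_wpM2l// divr_ge0// ltW.
Qed.

(** [mean_center] applies to z q(z), with [q] the difference quotient at [t]: the one doubtful point
    [t] lies on the permitted exceptional circle |z| = |t|. So z q(z) has mean 0, and the kernel has
    mean 1. *)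
Theorem cauchy_formula (F : C -> C) r t : normc t < r ->
  (forall z, normc z <= r -> cdiff F z) ->
  F t = mean (fun s => F (r%:C * s) * (r%:C * s / (r%:C * s - t))).
Proof.
move=> tr dF; have r0 := le_lt_trans (normc_ge0 t) tr.
have [phi hp hF] := dF _ (ltW tr).
pose q z := if z == t then phi t else (F z - F t) / (z - t).
have cF : ccirc (fun s => F (r%:C * s)).
  by apply: ccirc_scale; [exact: ltW|move=> z hz; apply: cdiff_ccont; apply: dF; rewrite hz].
have cK : ccirc (fun s => r%:C * s / (r%:C * s - t)).
  by apply: ccircM; [exact: ccirc_rescale|exact: ccirc_pole].
have dq z : normc z <= r -> z != t -> cdiff q z.
  move=> zr zt; apply: (@cdiff_eq _ (fun w => (F w - F t) / (w - t))).
    have zt0 : 0 < normc (z - t) by rewrite normc_gt0 subr_eq0.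
    have := cnb_ball z zt0; apply: filterS => w hw; rewrite /q ifN//.
    by apply: contraTneq hw => ->; rewrite normcB ltxx.
  by apply: cdiff_quot => //; exact: dF.
have cq : ccont q t.
  rewrite /ccont /q eqxx; apply: clim_near hp.
  apply: filterS hF => w hw; case: eqVneq => [->//|wt].
  by rewrite hw addrAC subrr add0r mulfK// subr_eq0.
have : mean (fun s => r%:C * s * q (r%:C * s)) = 0 * q 0.
  apply: (@mean_center (fun z => z * q z) r (normc t)) => // z zr.
    apply: climM; first exact: ccont_id.
    by have [->//|zt] := eqVneq z t; apply: cdiff_ccont; exact: dq.
  move=> zt; apply: cdiffM; first exact: cdiff_id.
  by apply: dq => //; apply: contra_neq zt => ->.
rewrite mul0r => h.
apply/eqP; rewrite eq_sym -subr_eq0 -[F t]mulr1 -(mean_kernel tr) -meanZ// -meanB//; last first.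
- by move=> s hs; apply: climM; [exact: clim_cst|exact: cK].
- exact: ccircM.
rewrite -h; apply/eqP; apply: eq_mean => s hs.
have rz := pole_neq0 (ltW r0) hs tr.
by rewrite /q ifN; [field|rewrite -subr_eq0].
Qed.

Lemma geometric_le0 (x K q : R) : 0 <= K -> 0 <= q < 1 -> (forall n, x <= K * q ^+ n) -> x <= 0.
Proof.
move=> K0 /andP[q0 q1] h; rewrite leNgt; apply/negP => x0.
have xK : 0 < x / (K + 1) by rewrite divr_gt0// ltr_wpDl.
have := @cvg_expr R q; rewrite ger0_norm// => /(_ q1)/cvgr_lt/(_ _ xK)[n _ /(_ n (leqnn n))/=].
rewrite ltr_pdivlMr ?ltr_wpDl// => h1; have := h n; apply/negP; rewrite -ltNge.
by apply: le_lt_trans h1; rewrite mulrC ler_wpM2l ?exprn_ge0// lerDl.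
Qed.

(** The Laurent coefficient of index k on the circle of radius r, for k >= 0; it is the Taylor
    coefficient when F is holomorphic on the closed disc. *)
Definition coef (F : C -> C) (r : R) k := mean (fun s => F (r%:C * s) * (r%:C * s) ^- k).

Lemma scale_neq0 (r : R) s : 0 < r -> normc s = 1 -> r%:C * s != 0.
Proof. by move=> r0 hs; rewrite -normc_gt0 normc_scale// ltW. Qed.

Lemma ccirc_powV (r : R) k : 0 < r -> ccirc (fun s => (r%:C * s) ^- k).
Proof.
move=> r0 s hs; apply: climV; first by rewrite expf_neq0// scale_neq0.
by apply: climX; apply: climM; [exact: clim_cst|exact: clim_ucnb_id].
Qed.

(** The Cauchy kernel is expanded one geometric term at a time. The remainder is kept as an integral
    because [jet_polynomial] needs its holomorphic dependence on a parameter. *)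
Lemma taylor (F : C -> C) r t n : normc t < r -> (forall z, normc z <= r -> cdiff F z) ->
  F t = \sum_(i < n) coef F r i * t ^+ i +
    t ^+ n * mean (fun s => F (r%:C * s) * ((r%:C * s) ^- n * (r%:C * s / (r%:C * s - t)))).
Proof.
move=> tr dF; have r0 := le_lt_trans (normc_ge0 t) tr.
have cF : ccirc (fun s => F (r%:C * s)).
  by apply: ccirc_scale; [exact: ltW|move=> z hz; apply: cdiff_ccont; apply: dF; rewrite hz].
have cK : ccirc (fun s => r%:C * s / (r%:C * s - t)).
  by apply: ccircM; [exact: ccirc_rescale|exact: ccirc_pole].
elim: n => [|n IH].
  rewrite big_ord0 add0r expr0 mul1r {1}(cauchy_formula tr dF); apply: eq_mean => s _.
  by rewrite expr0 invr1 mul1r.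
rewrite big_ord_recr/= -addrA {1}IH; congr (_ + _).
have cn m : ccirc (fun s => F (r%:C * s) * ((r%:C * s) ^- m * (r%:C * s / (r%:C * s - t)))).
  by apply: ccircM => //; apply: ccircM => //; exact: ccirc_powV.
rewrite [X in t ^+ n * X](_ : _ = coef F r n + t * mean (fun s => F (r%:C * s) *
    ((r%:C * s) ^- n.+1 * (r%:C * s / (r%:C * s - t))))); first by rewrite exprS; ring.
rewrite -meanZ// /coef -meanD.
- apply: eq_mean => s hs; have rz := pole_neq0 (ltW r0) hs tr; have sz := scale_neq0 r0 hs.
  by rewrite exprS; move: (r%:C * s) rz sz => z rz sz; field; rewrite ?rz ?sz ?expf_neq0.
- by apply: ccircM => //; exact: ccirc_powV.
- by apply: ccircM => //; exact: ccirc_cst.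
Qed.

(** Only the remainder of [taylor] is left, and it is O((|t| / r)^n). *)
Lemma coef_eq0 (F : C -> C) r t : normc t < r -> (forall z, normc z <= r -> cdiff F z) ->
  (forall k, coef F r k = 0) -> F t = 0.
Proof.
move=> tr dF h; have r0 := le_lt_trans (normc_ge0 t) tr.
have cF : ccirc (fun s => F (r%:C * s)).
  by apply: ccirc_scale; [exact: ltW|move=> z hz; apply: cdiff_ccont; apply: dF; rewrite hz].
have [B B0 hB] := ccirc_bounded cF.
apply/eqP; rewrite -normc_eq0 eq_le normc_ge0 andbT.
have rt : 0 < r - normc t by rewrite subr_gt0.
apply: (@geometric_le0 _ (2 * (B * (r / (r - normc t)))) (normc t / r)).
- by rewrite !mulr_ge0// ?invr_ge0 ltW.
- by rewrite divr_ge0 ?normc_ge0 ?(ltW r0)//= ltr_pdivrMr// mul1r.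
move=> n; rewrite (taylor n tr dF) big1 ?add0r; last by move=> i _; rewrite h mul0r.
rewrite normcM normcX expr_div_n [X in _ <= X]mulrCA; rewrite ler_wpM2l ?exprn_ge0 ?normc_ge0//.
rewrite -mulrA; apply: normc_mean_le.
  apply: ccircM => //; apply: ccircM; first exact: ccirc_powV.
  by apply: ccircM; [exact: ccirc_rescale|exact: ccirc_pole].
move=> x hx; have u := normc_cis x.
rewrite normcM -[X in _ <= X]mulrA ler_pM ?normc_ge0 ?hB//.
rewrite normcM [normc (_ / _)]normcM !normcV normcX normc_scale ?(ltW r0)//.
rewrite mulrC ler_wpM2r ?invr_ge0 ?exprn_ge0 ?(ltW r0)//.
rewrite ler_wpM2l ?(ltW r0)// lef_pV2 ?posrE// ?normc_gt0 ?pole_neq0 ?(ltW r0)//.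
by rewrite (le_trans _ (le_trans (ler_norm _) (le_normcB_dist _ _)))// normc_scale// ltW.
Qed.

(** Cauchy's formula gives the bound up to the factor 2 r / (r - |t|). Applied to F^n it bounds (|F
    t| / B)^n by that same factor for all n. *)
Lemma maximum_principle (F : C -> C) r t B : normc t < r -> (forall z, normc z <= r -> cdiff F z) ->
  (forall z, normc z = r -> normc (F z) <= B) -> normc (F t) <= B.
Proof.
move=> tr dF hB; have r0 := le_lt_trans (normc_ge0 t) tr.
have rt : 0 < r - normc t by rewrite subr_gt0.
have B0 : 0 <= B.
  by rewrite (le_trans (normc_ge0 _) (hB (r%:C * cis 0) _))// normc_scale ?normc_cis// ltW.
rewrite leNgt; apply/negP => h.
have F0 := le_lt_trans B0 h.
suff : (1 : R) <= 0 by rewrite ler10.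
apply: (@geometric_le0 _ (2 * (r / (r - normc t))) (B / normc (F t))).
- by rewrite !mulr_ge0// ?invr_ge0 ltW.
- by rewrite divr_ge0 ?(ltW F0)//= ltr_pdivrMr// mul1r.
move=> n; rewrite expr_div_n (mulrA (2 * _)) ler_pdivlMr ?exprn_gt0// mul1r -normcX.
have dFn z : normc z <= r -> cdiff (fun w => F w ^+ n) z by move=> /dF; exact: cdiffX.
rewrite (cauchy_formula tr dFn) -mulrA; apply: normc_mean_le.
  apply: ccircM; first by apply: (@ccirc_scale (fun w => F w ^+ n));
    [exact: ltW|move=> z hz; apply: cdiff_ccont; apply: dFn; rewrite hz].
  by apply: ccircM; [exact: ccirc_rescale|exact: ccirc_pole].
move=> x hx; have u := normc_cis x.
rewrite normcM mulrC ler_pM ?normc_ge0//; last first.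
  by rewrite normcX lerXn2r ?nnegrE ?normc_ge0// hB// normc_scale// ltW.
rewrite normcM normcV.
rewrite normc_scale ?(ltW r0)// ler_wpM2l ?(ltW r0)// lef_pV2 ?posrE// ?normc_gt0 ?pole_neq0 ?(ltW r0)//.
by rewrite (le_trans _ (le_trans (ler_norm _) (le_normcB_dist _ _)))// normc_scale// ltW.
Qed.

(** Cauchy's formula at [t] minus the mean value at 0 has kernel t / (z - t), which vanishes as the
    radius grows. *)
Lemma liouville (F : C -> C) B : (forall z, cdiff F z) -> (forall z, normc (F z) <= B) ->
  forall t, F t = F 0.
Proof.
move=> dF hB t; apply/eqP; rewrite -subr_eq0 -normc_eq0 eq_le normc_ge0 andbT.
have B0 : 0 <= B by exact: le_trans (normc_ge0 _) (hB 0).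
rewrite leNgt; apply/negP => N0.
have H r : normc t < r -> normc (F t - F 0) <= 2 * (B * (normc t / (r - normc t))).
  move=> tr; have r0 := le_lt_trans (normc_ge0 t) tr.
  have rt : 0 < r - normc t by rewrite subr_gt0.
  have cF : ccirc (fun s => F (r%:C * s)).
    by apply: ccirc_scale; [exact: ltW|move=> z hz; exact: cdiff_ccont].
  rewrite (cauchy_formula tr (fun z _ => dF z)) -(mean_value r0 (fun z _ => dF z)) -meanB//; last first.
    by apply: ccircM => //; apply: ccircM; [exact: ccirc_rescale|exact: ccirc_pole].
  apply: normc_mean_le.
    move=> s hs; apply: climB; last exact: cF.
    by apply: ccircM hs => //; apply: ccircM; [exact: ccirc_rescale|exact: ccirc_pole].
  move=> x hx; have u := normc_cis x; have pz := pole_neq0 (ltW r0) u tr.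
  have -> : F (r%:C * cis x) * (r%:C * cis x / (r%:C * cis x - t)) - F (r%:C * cis x) =
     F (r%:C * cis x) * (t / (r%:C * cis x - t)) by field.
  rewrite !normcM normcV ler_pM ?normc_ge0 ?hB// ?mulr_ge0 ?invr_ge0 ?normc_ge0//.
  rewrite ler_wpM2l ?normc_ge0// lef_pV2 ?posrE// ?normc_gt0//.
  by rewrite (le_trans _ (le_trans (ler_norm _) (le_normcB_dist _ _)))// normc_scale// ltW.
move: (normc (F t - F 0)) N0 H => N N0 H.
have T0 := normc_ge0 t.
have BT : 0 <= B * normc t by rewrite mulr_ge0.
(* At radius |t| + d the estimate reads N d <= 2 B |t|, whereas N d = 4 B |t| + N. *)
pose d := 4 * (B * normc t) / N + 1.
have d0 : 0 < d by rewrite ltr_wpDl// divr_ge0 ?mulr_ge0// ltW.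
have := H (normc t + d); rewrite ltrDl d0 => /(_ isT).
rewrite addrAC subrr add0r !mulrA ler_pdivlMr// /d mulrDr mulr1 mulrCA divff ?gt_eqF// mulr1.
clear - BT N0; lra.
Qed.

(** Doubling the radius leaves the mean unchanged, yet multiplies it by 2^-k. *)
Lemma mean_powV (r : R) k : 0 < r -> (0 < k)%N -> mean (fun s => (r%:C * s) ^- k) = 0.
Proof.
move=> r0 k0; have r2 : r <= 2 * r by rewrite ler_peMl ?(ltW r0)// ler1n.
have := @mean_annulus _ (fun z => z ^- k) r (2 * r) r0 r2.
have h z : r <= normc z <= 2 * r -> cdiff (fun w => w ^- k) z.
  move=> /andP[z1 _]; apply: cdiffV; last by apply: cdiffX; exact: cdiff_id.
  by rewrite expf_neq0// -normc_gt0 (lt_le_trans r0).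
move=> /(_ h) e.
have e2 : mean (fun s => ((2 * r)%:C * s) ^- k) = 2 ^- k * mean (fun s => (r%:C * s) ^- k).
  rewrite -meanZ; last exact: ccirc_powV.
  by apply: eq_mean => s _; rewrite rmorphM/= -mulrA exprMn invfM rmorph_nat.
move: e; rewrite e2 => /eqP; rewrite eq_sym -subr_eq0 -{2}[mean _]mul1r -mulrBl mulf_eq0.
move=> /orP[|/eqP//]; rewrite subr_eq0 invr_eq1 -natrX pnatr_eq1.
by rewrite -[1%N](expn0 2) eqn_exp2l// gtn_eqF.
Qed.

Lemma coef_annulus (F : C -> C) (r1 r2 : R) k : 0 < r1 -> r1 <= r2 ->
  (forall z, r1 <= normc z <= r2 -> cdiff F z) -> coef F r1 k = coef F r2 k.
Proof.
move=> r10 r12 dF; apply: (@mean_annulus _ (fun z => F z * z ^- k)) => // z zr.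
apply: cdiffM; first exact: dF.
apply: cdiffV; last by apply: cdiffX; exact: cdiff_id.
by case/andP: zr => z1 _; rewrite expf_neq0// -normc_gt0 (lt_le_trans r10).
Qed.

(** The coefficients vanish when computed on the circle of radius [e], and they do not depend on the
    radius. *)
Lemma identity_disc (F : C -> C) (T e : R) t : 0 < e -> e < T -> normc t < T ->
  (forall z, normc z < T -> cdiff F z) -> (forall z, normc z = e -> F z = 0) -> F t = 0.
Proof.
move=> e0 eT tT dF F0.
pose r := (Num.max e (normc t) + T) / 2.
have m1 : e <= Num.max e (normc t) by rewrite le_max lexx.
have m2 : normc t <= Num.max e (normc t) by rewrite le_max lexx orbT.
have m3 : Num.max e (normc t) < T by rewrite gt_max eT.
have er : e <= r by rewrite /r; clear - m1 m3; lra.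
have tr : normc t < r by rewrite /r; clear - m2 m3; lra.
have rT : r < T by rewrite /r; clear - m3; lra.
apply: (coef_eq0 tr) => [z zr|k]; first by apply: dF; exact: le_lt_trans rT.
rewrite -(coef_annulus k e0 er); last by move=> z /andP[_ zr]; apply: dF; exact: le_lt_trans rT.
rewrite -(mean_cst (0 : C)); apply: eq_mean => s hs; rewrite F0 ?mul0r//.
by rewrite normc_scale// ltW.
Qed.

Lemma coef_pos_eq0 (F : C -> C) r t : normc t < r -> (forall z, normc z <= r -> cdiff F z) ->
  (forall k, (0 < k)%N -> coef F r k = 0) -> F t = F 0.
Proof.
move=> tr dF h; have r0 := le_lt_trans (normc_ge0 t) tr.
have cF : ccirc (fun s => F (r%:C * s)).
  by apply: ccirc_scale; [exact: ltW|move=> z hz; apply: cdiff_ccont; apply: dF; rewrite hz].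
apply/eqP; rewrite -subr_eq0; apply/eqP.
apply: (@coef_eq0 (fun z => F z - F 0) r) => // [z zr|k].
  by apply: cdiffB; [exact: dF|exact: cdiff_cst].
have -> : coef (fun z => F z - F 0) r k = coef F r k - F 0 * mean (fun s => (r%:C * s) ^- k).
  rewrite /coef -meanZ; last exact: ccirc_powV.
  rewrite -meanB; last 2 first.
  - by apply: ccircM => //; exact: ccirc_powV.
  - by apply: ccircM; [exact: ccirc_cst|exact: ccirc_powV].
  by apply: eq_mean => s _; ring.
case: k => [|k]; last by rewrite h// mean_powV// mulr0 subrr.
have -> : mean (fun s => (r%:C * s) ^- 0) = 1.
  by rewrite -[RHS](mean_cst (1 : C)); apply: eq_mean => s _; rewrite expr0 invr1.
rewrite mulr1 -(mean_value r0 dF); apply/eqP; rewrite subr_eq0; apply/eqP.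
by apply: eq_mean => s _; rewrite expr0 invr1 mulr1.
Qed.

(* Writing the difference quotient in s as a Cauchy integral makes it jointly
   continuous, so that it can be averaged. *)
Lemma mean_cdiff (Phi : C -> C -> C) (s0 : C) (r : R) : 0 < r ->
  (forall s w, normc (s - s0) <= r -> normc w = 1 -> cdiff (fun s => Phi s w) s) ->
  (forall s w, normc (s - s0) <= r -> normc w = 1 ->
     clim (filter_prod (cnb s) (ucnb w)) (fun p => Phi p.1 p.2) (Phi s w)) ->
  cdiff (fun s => mean (Phi s)) s0.
Proof.
move=> r0 dPhi cPhi.
have sh z : normc z <= r -> normc (z + s0 - s0) <= r by rewrite addrK.
have cirP s : normc (s - s0) <= r -> ccirc (Phi s).
  move=> hs w hw e e0; have [[P Q] [/= [d d0 hP] hQ] PQ] := cPhi s w hs hw e e0.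
  apply: filterS hQ => v hv; apply: (PQ (s, v)); split => //=; apply: hP.
  by rewrite subrr normc0.
(* By z / (z - t) - 1 = t / (z - t), this is the difference quotient in the first variable between
   [s0] and [s], written without a division by s - s0. *)
pose psi s w := mean (fun v => Phi (r%:C * v + s0) w * (r%:C * v - (s - s0))^-1).
have shn v : normc v = 1 -> normc (r%:C * v + s0 - s0) <= r by move=> hv; rewrite addrK normc_scale// ltW.
have c1 w : normc w = 1 -> ccirc (fun v => Phi (r%:C * v + s0) w).
  move=> hw; apply: (@ccirc_scale (fun z => Phi (z + s0) w)); first exact: ltW.
  move=> z hz; apply: (@clim_comp _ _ _ _ _ (fun s => Phi s w)).
    by apply: climD; [exact: ccont_id|exact: clim_cst].
  by apply: cdiff_ccont; apply: dPhi => //; apply: sh; rewrite hz.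
have psi_lim s w : normc (s - s0) < r -> normc w = 1 ->
    clim (filter_prod (cnb s) (ucnb w)) (fun p => psi p.1 p.2) (psi s w).
  move=> hs hw; apply: mean_clim.
  - by apply: ccircM; [exact: c1|exact: ccirc_pole].
  - exists ([set s' | normc (s' - s0) < r], [set w' | normc w' = 1]).
      by split => /=; [exact: cnb_open|exact: ucnb_unit].
    by move=> [s' w'] /= [hs' hw']; apply: ccircM; [exact: c1|exact: ccirc_pole].
  - move=> v hv; apply: climM.
      move=> e e0; have [[P Q] [/= hP hQ] PQ] := cPhi _ w (shn v hv) hw e e0.
      have hv' : clim (ucnb v) (fun v' => r%:C * v' + s0) (r%:C * v + s0).
        by apply: climD; [exact: ccirc_rescale|exact: clim_cst].
      exists (setT `*` [set w' | Q w'], [set v' | P (r%:C * v' + s0)]) => /=.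
        split; last exact: (clim_cnb hv' hP).
        by exists (setT, Q); [split => //; exact: filterT|move=> [a b] [_ qb]; split].
      by move=> [[a b] v'] /= [[_ qb] pv]; apply: (PQ (r%:C * v' + s0, b)).
    apply: climV; first by apply: pole_neq0 => //; exact: ltW.
    apply: climB.
      by apply: (@clim_prod2 _ _ _ _ _ _ _ (fun v' => r%:C * v')); exact: ccirc_rescale.
    apply: (@clim_prod1 _ _ _ _ _ _ _ (fun p : C * C => p.1 - s0)).
    apply: (@clim_prod1 _ _ _ _ _ _ _ (fun a : C => a - s0)).
    by apply: climB; [exact: ccont_id|exact: clim_cst].
have psiE s w : normc (s - s0) < r -> normc w = 1 -> Phi s w = Phi s0 w + psi s w * (s - s0).
  move=> hs hw.
  have dF z : normc z <= r -> cdiff (fun z => Phi (z + s0) w) z.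
    move=> hz; apply: (@cdiff_comp _ (fun z => z + s0) (fun s => Phi s w)).
      by apply: cdiffD; [exact: cdiff_id|exact: cdiff_cst].
    by apply: dPhi => //; exact: sh.
  have := cauchy_formula hs dF; rewrite subrK => ->.
  have := mean_value r0 dF; rewrite add0r => <-.
  rewrite [psi s w * _]mulrC /psi -meanZ; last by apply: ccircM; [exact: c1|exact: ccirc_pole].
  rewrite -meanD; last 2 first.
  - exact: c1.
  - by apply: ccircM; [exact: ccirc_cst|apply: ccircM; [exact: c1|exact: ccirc_pole]].
  apply: eq_mean => v hv; have := pole_neq0 (ltW r0) hv hs => pz.
  by field.
have cpsi s : normc (s - s0) < r -> ccirc (psi s).
  move=> hs w hw e e0; have [[P Q] [/= [d d0 hP] hQ] PQ] := psi_lim s w hs hw e e0.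
  apply: filterS hQ => v hv; apply: (PQ (s, v)); split => //=; apply: hP.
  by rewrite subrr normc0.
have s00 : normc (s0 - s0) < r by rewrite subrr normc0.
have near0 : \forall s \near cnb s0, normc (s - s0) < r by exact: cnb_ball.
exists (fun s => mean (psi s)).
  apply: mean_clim => //; first exact: cpsi.
    by apply: filterS near0 => s; exact: cpsi.
  by move=> w hw; exact: psi_lim.
apply: filterS near0 => s hs; rewrite [mean (psi s) * _]mulrC -meanZ; last exact: cpsi.
rewrite -meanD; first by apply: eq_mean => w hw; rewrite mulrC psiE.
  by apply: cirP; exact: ltW.
by apply: ccircM; [exact: ccirc_cst|exact: cpsi].
Qed.

End CauchyFormula.

(** * Hartogs extension *)

Section HartogsExtension.
Variable R : realType.
Local Notation C := R[i].

(** Joint continuity with differentiability along every complex line through the point. It follows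
    directly from Frechet differentiability and is what the one-variable arguments consume. *)
Definition holo2 (g : C -> C -> C) x y :=
  ccont2 g x y /\ forall u v, cdiff (fun s => g (x + s * u) (y + s * v)) 0.

Lemma holo2_line (g : C -> C -> C) x y u v s0 : holo2 g (x + s0 * u) (y + s0 * v) ->
  cdiff (fun s => g (x + s * u) (y + s * v)) s0.
Proof.
move=> [_ /(_ u v) h].
apply: (@cdiff_eq _ (fun s => g (x + s0 * u + (s - s0) * u) (y + s0 * v + (s - s0) * v))).
  by apply: filterE => s; congr g; ring.
apply: (@cdiff_comp _ (fun s => s - s0) (fun s => g (x + s0 * u + s * u) (y + s0 * v + s * v))).
  by apply: cdiffB; [exact: cdiff_id|exact: cdiff_cst].
by rewrite subrr.
Qed.

Lemma holo2_snd (g : C -> C -> C) x y : holo2 g x y -> cdiff (g x) y.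
Proof.
move=> h; apply: (@cdiff_eq _ (fun s => g (x + s * 0) (0 + s * 1))).
  by apply: filterE => s; rewrite mulr0 addr0 mulr1 add0r.
by apply: holo2_line; rewrite mulr0 addr0 mulr1 add0r.
Qed.

Definition shell (b R0 : R) (x y : C) :=
  1 < normc x ^+ 2 + normc y ^+ 2 /\ normc (x - b%:C) ^+ 2 + normc y ^+ 2 < R0 ^+ 2.

(** The Cauchy integral in y: the circle |y| = rho lies in the shell even where the disc it bounds
    meets the unit ball. *)
Definition ext (g : C -> C -> C) (rho : R) x y :=
  mean (fun s => g x (rho%:C * s) * (rho%:C * s / (rho%:C * s - y))).

Variables (b R0 eta rho : R).
Hypotheses (eta0 : 0 < eta) (eta1 : eta <= 1) (rho0 : 0 < rho).
(** The Hartogs figure at (1, 0): the bidisc stays in the outer ball, and its side |y| = rho misses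
    the closed unit ball. *)
Hypothesis inside : forall x y : C, normc (x - 1) < eta -> normc y <= rho ->
  normc (x - b%:C) ^+ 2 + normc y ^+ 2 < R0 ^+ 2.
Hypothesis outside : forall x y : C, normc (x - 1) < eta -> normc y = rho ->
  1 < normc x ^+ 2 + normc y ^+ 2.
Variable g : C -> C -> C.
Hypothesis hg : forall x y, shell b R0 x y -> holo2 g x y.

Lemma circle_shell x s : normc (x - 1) < eta -> normc s = 1 -> shell b R0 x (rho%:C * s).
Proof.
move=> hx hs; have hn := normc_scale (ltW rho0) hs.
by split; [exact: outside|apply: inside => //; rewrite hn].
Qed.

Lemma ext_integrand_clim (T : Type) (F : set_system T) {FF : Filter F} (X Y : T -> C) x y w :
  clim F X x -> clim F Y y -> normc (x - 1) < eta -> normc y < rho -> normc w = 1 ->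
  clim (filter_prod F (ucnb w))
    (fun p => g (X p.1) (rho%:C * p.2) * (rho%:C * p.2 / (rho%:C * p.2 - Y p.1)))
    (g x (rho%:C * w) * (rho%:C * w / (rho%:C * w - y))).
Proof.
move=> hX hY hx hy hw.
have c1 : clim (filter_prod F (ucnb w)) (fun p => rho%:C * p.2) (rho%:C * w).
  by apply: (@clim_prod2 _ _ _ _ _ _ _ (fun v : C => rho%:C * v)); exact: ccirc_rescale.
have c2 : clim (filter_prod F (ucnb w)) (fun p => X p.1) x by exact: clim_prod1.
have c3 : clim (filter_prod F (ucnb w)) (fun p => Y p.1) y by exact: clim_prod1.
apply: climM; first by apply: clim_comp2 => //; case: (hg (circle_shell hx hw)).
apply: climM => //; apply: climV; first by apply: pole_neq0 => //; exact: ltW.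
exact: climB.
Qed.

Lemma ext_integrand_ccirc x y : normc (x - 1) < eta -> normc y < rho ->
  ccirc (fun s => g x (rho%:C * s) * (rho%:C * s / (rho%:C * s - y))).
Proof.
move=> hx hy; apply: ccircM; last by apply: ccircM; [exact: ccirc_rescale|exact: ccirc_pole].
move=> s hs; apply: clim_comp2; [exact: clim_cst|exact: ccirc_rescale|].
by case: (hg (circle_shell hx hs)).
Qed.

Lemma ext_holo x y : normc (x - 1) < eta -> normc y < rho -> holo2 (ext g rho) x y.
Proof.
move=> hx hy; split.
  apply: (@mean_clim _ _ _ _ (fun p s => g p.1 (rho%:C * s) * (rho%:C * s / (rho%:C * s - p.2)))).
  - exact: ext_integrand_ccirc.
  - exists ([set x | normc (x - 1) < eta], [set y | normc (y - 0) < rho]).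
      by split; apply: cnb_open => //; rewrite subr0.
    by move=> [x' y'] /= [hx' hy']; apply: ext_integrand_ccirc => //; rewrite subr0 in hy'.
  - move=> s hs.
    by apply: (@ext_integrand_clim _ _ _ fst snd) => //; [exact: clim_fst|exact: clim_snd].
move=> u v.
pose k := 1 + normc u + normc v.
have k0 : 0 < k by rewrite /k -addrA ltr_pwDl// addr_ge0 ?normc_ge0.
pose d := Num.min (eta - normc (x - 1)) (rho - normc y).
have d0 : 0 < d by rewrite lt_min !subr_gt0 hx.
have small s : normc (s - 0) <= d / 2 / k -> normc (x + s * u - 1) < eta /\ normc (y + s * v) < rho.
  rewrite subr0 ler_pdivlMr// => hs.
  have d1 : d <= eta - normc (x - 1) by rewrite ge_min lexx.
  have d2 : d <= rho - normc y by rewrite ge_min lexx orbT.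
  have su : normc (s * u) <= normc s * k.
    by rewrite normcM ler_wpM2l ?normc_ge0// /k -addrA addrCA lerDl addr_ge0// normc_ge0.
  have sv : normc (s * v) <= normc s * k.
    by rewrite normcM ler_wpM2l ?normc_ge0// /k lerDr addr_ge0// normc_ge0.
  split.
    rewrite addrAC (le_lt_trans (le_normcD _ _))//; lra.
  rewrite (le_lt_trans (le_normcD _ _))//; lra.
apply: (@mean_cdiff _ (fun s w => g (x + s * u) (rho%:C * w) *
    (rho%:C * w / (rho%:C * w - (y + s * v)))) 0 (d / 2 / k)).
- by rewrite !divr_gt0.
- move=> s w /small[h1 h2] hw; apply: cdiffM.
    apply: (@cdiff_eq _ (fun s => g (x + s * u) (rho%:C * w + s * 0))).
      by apply: filterE => s'; rewrite mulr0 addr0.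
    by apply: holo2_line; rewrite mulr0 addr0; apply: hg; exact: circle_shell.
  apply: cdiffM; first exact: cdiff_cst.
  apply: cdiffV; first by apply: pole_neq0 => //; exact: ltW.
  apply: cdiffB; first exact: cdiff_cst.
  apply: cdiffD; first exact: cdiff_cst.
  by apply: cdiffM; [exact: cdiff_id|exact: cdiff_cst].
- move=> s w /small[h1 h2] hw.
  apply: (@ext_integrand_clim _ _ _ (fun s => x + s * u) (fun s => y + s * v)) => //.
    by apply: climD; [exact: clim_cst|apply: climM; [exact: ccont_id|exact: clim_cst]].
  by apply: climD; [exact: clim_cst|apply: climM; [exact: ccont_id|exact: clim_cst]].
Qed.

(** When |x| > 1 the whole vertical disc lies in the shell, so Cauchy's formula holds for g
    itself. *)
Lemma ext_agree_outer x y : normc (x - 1) < eta -> normc y < rho -> 1 < normc x -> ext g rho x y = g x y.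
Proof.
move=> hx hy x1; rewrite [RHS](@cauchy_formula _ (g x) rho)// => z hz.
apply: holo2_snd; apply: hg; split; last exact: inside.
have h1 : 1 < normc x ^+ 2 by rewrite -(expr1n R 2) ltrXn2r// nnegrE normc_ge0.
by rewrite (lt_le_trans h1)// lerDl sqr_ge0.
Qed.

(* The identity theorem is applied on a disc centred at (1 + eta / 8) x / |x|,
   externally tangent to the region where |x|^2 + |y|^2 <= 1. *)
Lemma ext_agree x y : normc (x - 1) < eta / 8 -> normc y < rho ->
  1 < normc x ^+ 2 + normc y ^+ 2 -> ext g rho x y = g x y.
Proof.
move=> hx hy xy1.
have [e0 e1] := (eta0, eta1).
have e8 : eta / 8 <= eta.
  by lra.
have hx8 : normc (x - 1) < eta by exact: lt_le_trans e8.
have [x1|x1] := ltrP 1 (normc x); first exact: ext_agree_outer.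
have nx : `|normc x - 1| < eta / 8.
  by rewrite (le_lt_trans _ hx)// -{1}(normc1 R) le_normcB_dist.
have nx1 : 1 - eta / 8 < normc x by move: nx; rewrite ltr_norml => /andP[]; lra.
have nx0 : 0 < normc x by lra.
pose m : R := 1 + eta / 8.
pose om : C := x / (normc x)%:C.
have xC0 : (normc x)%:C != 0 :> C by rewrite -normc_gt0 normc_real normr_gt0 gt_eqF.
have nom : normc om = 1 by rewrite normcM normcV normc_real ger0_norm ?normc_ge0// divff// gt_eqF.
have omx : om * (normc x)%:C = x by rewrite divfK.
have om1 : normc (om - 1) < eta / 4.
  have -> : om - 1 = (x - 1) + om * (1 - normc x)%:C by rewrite rmorphB rmorph1 mulrBr mulr1 omx; ring.
  rewrite (le_lt_trans (le_normcD _ _))// normcM nom mul1r normc_real distrC.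
  lra.
(* The disc is enlarged by [d] so that it contains x. Its points then have modulus at least |x| - d,
   and since |x| <= 1 half of the excess of |x|^2 + |y|^2 over 1 is small enough to stay outside the
   unit ball. *)
pose d := Num.min ((normc x ^+ 2 + normc y ^+ 2 - 1) / 2) (eta / 8).
have d0 : 0 < d by rewrite lt_min !divr_gt0// subr_gt0.
have d1 : d <= (normc x ^+ 2 + normc y ^+ 2 - 1) / 2 by rewrite ge_min lexx.
have d2 : d <= eta / 8 by rewrite ge_min lexx orbT.
pose T := m - normc x + d.
have inT s : normc s < T -> normc (om * m%:C + s * om - 1) < eta.
  move=> hs; have -> : om * m%:C + s * om - 1 = (om - 1) + om * ((m - 1)%:C + s).
    by rewrite rmorphB rmorph1/=; ring.
  rewrite (le_lt_trans (le_normcD _ _))// normcM nom mul1r.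
  rewrite (le_lt_trans (lerD (lexx _) (le_normcD _ _)))// normc_real /m addrAC subrr add0r.
  rewrite ger0_norm ?divr_ge0 ?ltW//.
  move: hs; rewrite /T /m; lra.
have far s : m - normc s <= normc (om * m%:C + s * om).
  have -> : om * m%:C + s * om = om * (m%:C - - s) by ring.
  rewrite normcM nom mul1r (le_trans _ (le_trans (ler_norm _) (le_normcB_dist _ _)))//.
  by rewrite normcN normc_real lerD2r ler_norm.
have shellT s : normc s < T -> shell b R0 (om * m%:C + s * om) y.
  move=> hs; split; last by apply: inside; [exact: inT|exact: ltW].
  have : (normc x - d) ^+ 2 <= normc (om * m%:C + s * om) ^+ 2.
    have xd : 0 <= normc x - d by lra.
    rewrite lerXn2r ?nnegrE ?normc_ge0// (le_trans _ (far s))//.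
    move: hs; rewrite /T; lra.
  have := sqr_ge0 d; move: d1; rewrite !expr2; nra.
have x1m : normc x <= m by rewrite (le_trans x1)// lerDl divr_ge0// ltW.
have -> : x = om * m%:C + (normc x - m)%:C * om by rewrite rmorphB mulrBl/= [_%:C * om]mulrC omx; ring.
pose E s := ext g rho (om * m%:C + s * om) y - g (om * m%:C + s * om) y.
have y0 s : y = y + s * 0 by rewrite mulr0 addr0.
apply/eqP; rewrite -subr_eq0; apply/eqP.
apply: (@identity_disc _ E T (eta / 16)).
- by rewrite divr_gt0.
- rewrite /T /m; lra.
- by rewrite normc_real distrC ger0_norm ?subr_ge0// ltrDl.
- move=> z hz; apply: cdiffB.
    apply: (@cdiff_eq _ (fun s => ext g rho (om * m%:C + s * om) (y + s * 0))).
      by apply: filterE => s; rewrite -y0.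
    by apply: holo2_line; rewrite -y0; apply: ext_holo => //; exact: inT.
  apply: (@cdiff_eq _ (fun s => g (om * m%:C + s * om) (y + s * 0))).
    by apply: filterE => s; rewrite -y0.
  by apply: holo2_line; rewrite -y0; apply: hg; exact: shellT.
- move=> z hz; apply/eqP; rewrite subr_eq0; apply/eqP; apply: ext_agree_outer => //.
    apply: inT; rewrite hz /T /m; lra.
  by apply: lt_le_trans (far z); rewrite hz /m; lra.
Qed.

End HartogsExtension.

(** * Maps between spheres *)

Section SpherePolarization.
Variable R : realType.
Local Notation C := R[i].

Lemma at_right_clim (a : R) : clim (a^'+) (fun t : R => t%:C) a%:C.
Proof. by move=> e e0; apply: cvg_within; exact: nbhs_real_clim. Qed.

Lemma clim_sqrt_one_sub_sqr : clim ((0 : R)^'+) (fun x : R => (Num.sqrt (1 - x ^+ 2))%:C) (1 : C).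
Proof.
move=> e e0.
near=> x.
have x0 : 0 < x by near: x; exact: nbhs_right_gt.
have x1 : x < 1 by near: x; exact: nbhs_right_lt.
have xe : x < e by near: x; exact: nbhs_right_lt.
have y0 : 0 <= 1 - x ^+ 2 by rewrite subr_ge0 expr_le1// ltW.
rewrite -[X in _ - X]/((1 : R)%:C) -rmorphB normc_real.
have s1 : Num.sqrt (1 - x ^+ 2) <= 1.
  by rewrite -[X in _ <= X]sqrtr1 ler_sqrt// gerBl sqr_ge0.
have s2 := sqr_sqrtr y0; have s0 := sqrtr_ge0 (1 - x ^+ 2).
rewrite distrC ger0_norm ?subr_ge0//.
move: (Num.sqrt _) s0 s1 s2 => s s0 s1 s2; rewrite !expr2 in s2; clear y0.
nra.
Unshelve. all: by end_near. Qed.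

(* On |x| = sigma the point (u, x) lies on the sphere and sigma^2 / x is the
   conjugate of x, so the polarized norm is 1 there; its Laurent coefficients
   can be read off on a fixed circle, where sigma tends to 0. *)
Lemma sphere_polarization (N : nat) (g : 'I_N -> C -> C -> C) (D : C -> C -> Prop)
    (a kappa r : R) (t : C) :
  (forall j x y, D x y -> holo2 (g j) x y) ->
  (forall x y, D x y -> normc x ^+ 2 + normc y ^+ 2 = 1 ->
     \sum_j g j x y * (g j x y)^* = 1) ->
  a ^+ 2 + normc t ^+ 2 = 1 -> 0 < kappa -> 0 < r ->
  (forall (u : R) s, 1 - kappa <= u <= 1 -> normc s <= r ->
     D (u%:C * a%:C + s * - t^*) (u%:C * t + s * a%:C)) ->
  forall s, normc s < r ->
    \sum_j g j (a%:C + s * - t^*) (t + s * a%:C) * (g j a%:C t)^* = 1.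
Proof.
move=> hg hS hat k0 r0 hD s hs.
(* (a, t) and (- conj t, a) form an orthonormal basis, so the argument has squared norm u^2 +
   |s|^2. *)
pose F j (u : R) s := g j (u%:C * a%:C + s * - t^*) (u%:C * t + s * a%:C).
have dF j u z : 1 - kappa <= u <= 1 -> normc z <= r -> cdiff (F j u) z.
  by move=> hu hz; apply: holo2_line; apply: hg; exact: hD.
have one_in : 1 - kappa <= (1 : R) <= 1 by rewrite gerBl (ltW k0) /=.
pose phi z := \sum_j F j 1 z * (F j 1 0)^*.
have dphi z : normc z <= r -> cdiff phi z.
  by move=> hz; apply: cdiff_sum => j; apply: cdiffM; [exact: dF|exact: cdiff_cst].
have F1 j z : F j 1 z = g j (a%:C + z * - t^*) (t + z * a%:C) by rewrite /F rmorph1 !mul1r.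
have F10 j : F j 1 0 = g j a%:C t by rewrite F1 !mul0r !addr0.
have phiE z : phi z = \sum_j g j (a%:C + z * - t^*) (t + z * a%:C) * (g j a%:C t)^*.
  by apply: eq_bigr => j _; rewrite F1 F10.
rewrite -phiE.
have D1 : D a%:C t.
  by have := @hD 1 0 one_in; rewrite rmorph1 !mul1r !mul0r !addr0 normc0; apply; exact: ltW.
have phi0 : phi 0 = 1.
  rewrite phiE -(hS _ _ D1); last by rewrite normc_real real_normK ?num_real.
  by apply: eq_bigr => j _; rewrite !mul0r !addr0.
rewrite -[RHS]phi0; apply: (coef_pos_eq0 hs dphi) => k kpos.
pose U (x : R) := Num.sqrt (1 - x ^+ 2).
(* The two conjugations make this holomorphic in z for x <= |z| <= r. On |z| = x the reflected
   argument is z itself, so [B x] is 1 there; as x tends to 0 it tends to 0 on |z| = r, and [B x]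
   tends to [phi]. *)
pose B (x : R) z := \sum_j F j (U x) z * (F j (U x) ((x ^+ 2)%:C / z)^*)^*.
have near_U : \forall x \near 0^'+, [/\ 0 < x, x <= r, 1 - kappa <= U x <= 1 & U x ^+ 2 + x ^+ 2 = 1].
  near=> x.
  have x0 : 0 < x by near: x; exact: nbhs_right_gt.
  have x1 : x < 1 by near: x; exact: nbhs_right_lt.
  have xr : x < r by near: x; exact: nbhs_right_lt.
  have xk : x < kappa by near: x; exact: nbhs_right_lt.
  have y0 : 0 <= 1 - x ^+ 2 by rewrite subr_ge0 expr_le1// ltW.
  have s1 : U x <= 1 by rewrite /U -[X in _ <= X]sqrtr1 ler_sqrt// gerBl sqr_ge0.
  have s2 : U x ^+ 2 = 1 - x ^+ 2 by exact: sqr_sqrtr.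
  have s0 : 0 <= U x by exact: sqrtr_ge0.
  split=> //; first exact: ltW; last by rewrite s2 subrK.
  rewrite s1 andbT; move: (U x) s0 s1 s2 => v s0 s1 s2; rewrite !expr2 in s2; clear - x0 x1 xk s0 s1 s2.
  nra.
have B0 x : 0 < x -> x <= r -> 1 - kappa <= U x <= 1 -> U x ^+ 2 + x ^+ 2 = 1 -> coef (B x) r k = 0.
  move=> x0 xr hU hU1.
  have small z : x <= normc z -> normc ((x ^+ 2)%:C / z) <= x.
    move=> hz; have z0 := lt_le_trans x0 hz.
    by rewrite normcM normcV normc_real ger0_norm ?sqr_ge0// ler_pdivrMr// expr2 ler_wpM2l// ltW.
  rewrite -(coef_annulus k x0 xr); last first.
    move=> z /andP[z1 z2]; apply: cdiff_sum => j; apply: cdiffM; first exact: dF.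
    have z0 : z != 0 by rewrite -normc_gt0 (lt_le_trans x0).
    apply: (@cdiff_comp _ (fun z => (x ^+ 2)%:C / z) (fun w => (F j (U x) w^*)^*)).
      by apply: cdiffM; [exact: cdiff_cst|apply: cdiffV => //; exact: cdiff_id].
    by apply: cdiff_conj; apply: dF => //; rewrite normc_conj (le_trans (small _ z1)).
  rewrite -(mean_powV x0 kpos); apply: eq_mean => w hw.
  rewrite (_ : B x (x%:C * w) = 1) ?mul1r//.
  have wx : normc (x%:C * w) = x by rewrite normc_scale// ltW.
  have w0 := scale_neq0 x0 hw.
  have cj : ((x ^+ 2)%:C / (x%:C * w))^* = x%:C * w.
    apply: (canLR (@conjcK R)); apply: (mulIf w0).
    by rewrite divfK// mulrC normc_mulJ wx.
  rewrite /B -(hS (( U x)%:C * a%:C + x%:C * w * - t^*) ((U x)%:C * t + x%:C * w * a%:C)).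
  - by apply: eq_bigr => j _; rewrite cj.
  - by apply: hD => //; rewrite wx.
  - apply: complexI; rewrite rmorphD/= -!normc_mulJ.
    have -> : ((U x)%:C * a%:C + x%:C * w * - t^*)^* = (U x)%:C * a%:C + x%:C * w^* * - t.
      by case: (t) (w) => ? ? [? ?]; apply/eqP; rewrite eq_complex/=; apply/andP; split; apply/eqP; ring.
    have -> : ((U x)%:C * t + x%:C * w * a%:C)^* = (U x)%:C * t^* + x%:C * w^* * a%:C.
      by case: (t) (w) => ? ? [? ?]; apply/eqP; rewrite eq_complex/=; apply/andP; split; apply/eqP; ring.
    have tt : t * t^* = (1 - a ^+ 2)%:C by rewrite normc_mulJ -hat addrAC subrr add0r.
    have ww : w * w^* = 1 by rewrite normc_mulJ hw expr1n.
    have -> : ((U x)%:C * a%:C + x%:C * w * - t^*) * ((U x)%:C * a%:C + x%:C * w^* * - t) +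
       ((U x)%:C * t + x%:C * w * a%:C) * ((U x)%:C * t^* + x%:C * w^* * a%:C) =
       (U x)%:C ^+ 2 * (a%:C ^+ 2 + t * t^*) + x%:C ^+ 2 * (w * w^*) * (a%:C ^+ 2 + t * t^*) by ring.
    rewrite tt ww -!rmorphXn/= -!rmorphD/= mulr1 -mulrDl -rmorphD/= hU1 rmorph1 mul1r addrC subrK.
    by rewrite rmorph1.
have cphi : ccirc (fun w => phi (r%:C * w)).
  by apply: ccirc_scale; [exact: ltW|move=> z hz; apply: cdiff_ccont; apply: dphi; rewrite hz].
have lim : clim ((0 : R)^'+) (fun x => coef (B x) r k) (coef phi r k).
  apply: mean_clim.
  - by apply: ccircM => //; exact: ccirc_powV.
  - apply: filterS near_U => x [x0 xr hU hU1].
    apply: ccircM; last exact: ccirc_powV.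
    apply: ccirc_scale; first exact: ltW.
    move=> z hz; apply: cdiff_ccont; apply: cdiff_sum => j; apply: cdiffM; first by apply: dF; rewrite ?hz.
    have z0 : z != 0 by rewrite -normc_gt0 hz.
    apply: (@cdiff_comp _ (fun z => (x ^+ 2)%:C / z) (fun w => (F j (U x) w^*)^*)).
      by apply: cdiffM; [exact: cdiff_cst|apply: cdiffV => //; exact: cdiff_id].
    apply: cdiff_conj; apply: dF => //; rewrite normc_conj normcM normcV normc_real hz.
    by rewrite ger0_norm ?sqr_ge0// ler_pdivrMr// expr2 ler_pM// (ltW x0).
  - move=> w hw.
    have wr : normc (r%:C * w) <= r by rewrite normc_scale// ltW.
    have w0 := scale_neq0 r0 hw.
    have cw : clim (filter_prod (0 : R)^'+ (ucnb w)) (fun p => r%:C * p.2) (r%:C * w).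
      by apply: (@clim_prod2 _ _ _ _ _ _ _ (fun v : C => r%:C * v)); exact: ccirc_rescale.
    have cU : clim (filter_prod (0 : R)^'+ (ucnb w)) (fun p => (U p.1)%:C) 1.
      apply: (@clim_prod1 _ _ _ _ _ _ _ (fun x : R => (U x)%:C)); exact: clim_sqrt_one_sub_sqr.
    have cx : clim (filter_prod (0 : R)^'+ (ucnb w)) (fun p => (p.1)%:C) 0.
      apply: (@clim_prod1 _ _ _ _ _ _ _ (fun x : R => x%:C)); exact: at_right_clim.
    have cF j (z : R * C -> C) z0 : clim (filter_prod (0 : R)^'+ (ucnb w)) z z0 -> normc z0 <= r ->
        clim (filter_prod (0 : R)^'+ (ucnb w)) (fun p => F j (U p.1) (z p)) (F j 1 z0).
      move=> hz hz0; apply: clim_comp2; last first.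
      - by case: (hg j _ _ (hD 1 z0 one_in hz0)).
      - by rewrite rmorph1; apply: climD; apply: climM => //; exact: clim_cst.
      - by rewrite rmorph1; apply: climD; apply: climM => //; exact: clim_cst.
    apply: climM; last first.
      by apply: climV; [rewrite expf_neq0|exact: climX].
    apply: clim_sum => j _; apply: climM; first exact: cF.
    apply: clim_conj; apply: cF; last by rewrite normc0 ltW.
    rewrite -[X in clim _ _ X]conjc0; apply: clim_conj.
    rewrite -(mul0r (r%:C * w)^-1); apply: climM; last exact: climV.
    rewrite -[X in clim _ _ X](expr0n C 2) //.
    apply: clim_near (climX 2 cx); apply: filterE => p; by rewrite rmorphXn.
apply: (clim_unique lim).
apply: clim_near (clim_cst (0 : C)).
by apply: filterS near_U => x [x0 xr hU hU1]; rewrite B0.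
Unshelve. all: by end_near. Qed.

End SpherePolarization.

(** * Jets along the lines through a fixed point *)

Section Jets.
Variable R : realType.
Local Notation C := R[i].

(* Expanding G in its first variable up to order k, the remainder contributes
   s times a holomorphic function, whose mean vanishes. *)
Lemma jet_polynomial (G : C -> C -> C) (al r r' : R) (k : nat) :
  0 < al -> 0 < r -> r < r' ->
  (forall x y, normc x <= al -> normc y < r' -> holo2 G x y) ->
  exists P : {poly C}, forall tau, normc tau * r < al ->
    coef (fun s => G (s * tau) s) r k = P.[tau].
Proof.
move=> al0 r0 rr' hG.
have alw w : normc w = 1 -> normc (al%:C * w) <= al by move=> hw; rewrite normc_scale// ltW.
pose c i y := coef (fun x => G x y) al i.
(* The i-th Taylor term contributes tau^i times the mean of c_i(s) s^(i - k), which does not involve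
   tau. *)
exists (\poly_(i < k.+1) mean (fun w => c i (r%:C * w) * ((r%:C * w) ^+ i * (r%:C * w) ^- k))).
move=> tau htau.
have G_clim (T : Type) (F : set_system T) (FF : Filter F) (Y : T -> C) y w :
    clim F Y y -> normc y < r' -> normc w = 1 ->
    clim (filter_prod F (ucnb w)) (fun p => G (al%:C * p.2) (Y p.1)) (G (al%:C * w) y).
  move=> hY hy hw; apply: clim_comp2.
  - by apply: (@clim_prod2 _ _ _ _ _ _ _ (fun v : C => al%:C * v)); exact: ccirc_rescale.
  - exact: clim_prod1.
  - by case: (hG _ _ (alw _ hw) hy).
have ccirc_G y : normc y < r' -> ccirc (fun v => G (al%:C * v) y).
  move=> hy v hv; apply: clim_comp2; [exact: ccirc_rescale|exact: clim_cst|].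
  by case: (hG _ _ (alw _ hv) hy).
have holoG v y : normc v = 1 -> normc y < r' -> cdiff (fun y => G (al%:C * v) y) y.
  by move=> hv hy; apply: holo2_snd; apply: hG => //; exact: alw.
have dc i y : normc y < r' -> cdiff (c i) y.
  move=> hy; have d0 : 0 < (r' - normc y) / 2 by rewrite divr_gt0// subr_gt0.
  have small s : normc (s - y) <= (r' - normc y) / 2 -> normc s < r'.
    move=> h; have := le_normcD (s - y) y; rewrite subrK; clear - h d0; lra.
  apply: (mean_cdiff d0 (Phi := fun y v => G (al%:C * v) y * (al%:C * v) ^- i)).
    by move=> s w /small hs hw; apply: cdiffM; [exact: holoG|exact: cdiff_cst].
  move=> s w /small hs hw; apply: climM.
    by apply: (@G_clim _ (cnb s) _ id) => //; exact: ccont_id.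
  apply: (@clim_prod2 _ _ _ _ _ _ _ (fun v : C => (al%:C * v) ^- i)); exact: ccirc_powV.
(* The remainder of order k + 1 in the first variable. After multiplication by s^-k one factor s
   survives, and it kills the mean. *)
pose rem y := mean (fun v => G (al%:C * v) y * ((al%:C * v) ^- k.+1 * (al%:C * v / (al%:C * v - y * tau)))).
have drem y : normc y <= r -> cdiff rem y.
  move=> hy; pose d := Num.min ((r' - r) / 2) ((al - normc tau * r) / 2 / (normc tau + 1)).
  have t1 : 0 < normc tau + 1 by rewrite ltr_wpDl// normc_ge0.
  have t0 := normc_ge0 tau.
  have d0 : 0 < d by rewrite lt_min !divr_gt0// subr_gt0.
  have d1 : d <= (r' - r) / 2 by rewrite ge_min lexx.
  have d2 : d * (normc tau + 1) <= (al - normc tau * r) / 2 by rewrite -ler_pdivlMr// ge_min lexx orbT.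
  have small s : normc (s - y) <= d -> normc s < r' /\ normc (s * tau) < al.
    move=> h; have hs : normc s <= r + d.
      by have := le_normcD (s - y) y; rewrite subrK; clear - h hy; lra.
    split; first by clear - hs d1 rr'; lra.
    rewrite normcM mulrC; have : normc tau * normc s <= normc tau * (r + d) by rewrite ler_wpM2l.
    clear - d2 d0 htau t0; nra.
  apply: (mean_cdiff d0 (Phi := fun y v => G (al%:C * v) y *
     ((al%:C * v) ^- k.+1 * (al%:C * v / (al%:C * v - y * tau))))).
    move=> s w /small[hs1 hs2] hw; apply: cdiffM; first exact: holoG.
    apply: cdiffM; first exact: cdiff_cst.
    apply: cdiffM; first exact: cdiff_cst.
    apply: cdiffV; first by apply: pole_neq0 => //; exact: ltW.
    apply: cdiffB; first exact: cdiff_cst.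
    by apply: cdiffM; [exact: cdiff_id|exact: cdiff_cst].
  move=> s w /small[hs1 hs2] hw; apply: climM.
    by apply: (@G_clim _ (cnb s) _ id) => //; exact: ccont_id.
  have cal : clim (filter_prod (cnb s) (ucnb w)) (fun p => al%:C * p.2) (al%:C * w).
    by apply: (@clim_prod2 _ _ _ _ _ _ _ (fun v : C => al%:C * v)); exact: ccirc_rescale.
  apply: climM.
    by apply: climV; [rewrite expf_neq0// scale_neq0|exact: climX].
  apply: climM => //; apply: climV; first by apply: pole_neq0 => //; exact: ltW.
  apply: climB => //; apply: (@clim_prod1 _ _ _ _ _ _ _ (fun s => s * tau)).
  by apply: climM; [exact: ccont_id|exact: clim_cst].
have expand s : normc s <= r -> G (s * tau) s =
    \sum_(i < k.+1) c i s * (s * tau) ^+ i + (s * tau) ^+ k.+1 * rem s.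
  move=> hs; have hs' : normc s < r' by exact: le_lt_trans rr'.
  apply: (@taylor _ (fun x => G x s)).
    by rewrite normcM mulrC (le_lt_trans _ htau)// ler_wpM2l// normc_ge0.
  move=> z hz; apply: (@cdiff_eq _ (fun x => G (0 + x * 1) (s + x * 0))).
    by apply: filterE => x; rewrite add0r mulr1 mulr0 addr0.
  by apply: holo2_line; rewrite add0r mulr1 mulr0 addr0; exact: hG.
have ccirc_c i : ccirc (fun w => c i (r%:C * w)).
  by apply: ccirc_scale; [exact: ltW|move=> z hz; apply: cdiff_ccont; apply: dc; rewrite hz].
have ccirc_term i : ccirc (fun w => c i (r%:C * w) * ((r%:C * w) ^+ i * (r%:C * w) ^- k)).
  apply: ccircM => //; apply: ccircM; last exact: ccirc_powV.
  by apply: ccircX; exact: ccirc_rescale.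
have ccirc_rem : ccirc (fun w => r%:C * w * rem (r%:C * w)).
  apply: ccircM; first exact: ccirc_rescale.
  by apply: ccirc_scale; [exact: ltW|move=> z hz; apply: cdiff_ccont; apply: drem; rewrite hz].
rewrite horner_poly /coef.
rewrite (@eq_mean _ _ (fun w =>
   \sum_(i < k.+1) tau ^+ i * (c i (r%:C * w) * ((r%:C * w) ^+ i * (r%:C * w) ^- k)) +
   tau ^+ k.+1 * (r%:C * w * rem (r%:C * w)))); last first.
  move=> w hw; rewrite expand; last by rewrite normc_scale// ltW.
  have w0 := scale_neq0 r0 hw; set z := r%:C * w in w0 *.
  rewrite mulrDl mulr_suml; congr (_ + _).
    by apply: eq_bigr => i _; rewrite exprMn; ring.
  by rewrite exprMn (exprS z); field; rewrite expf_neq0.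
rewrite meanD; last 2 first.
- by move=> w hw; apply: clim_sum => i _; apply: climM; [exact: clim_cst|exact: ccirc_term].
- by apply: ccircM => //; exact: ccirc_cst.
rewrite (meanZ _ ccirc_rem) (mean_value r0 (F := fun z => z * rem z)); last first.
  by move=> z hz; apply: cdiffM; [exact: cdiff_id|exact: drem].
rewrite mul0r mulr0 addr0 mean_sum; last first.
  by move=> i; apply: ccircM; [exact: ccirc_cst|exact: ccirc_term].
by apply: eq_bigr => i _; rewrite meanZ// mulrC.
Qed.

End Jets.

(** * Rationality *)

Section RationalOnCircle.
Variable R : realType.
Local Notation C := R[i].
Implicit Type e : R.

(* Laurent polynomials on the circle of radius e, where conj t = e^2 / t. *)
Definition laurent e (u : C -> C) :=
  exists m (p : {poly C}), forall t, normc t = e -> t ^+ m * u t = p.[t].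

Lemma laurent_eq e u v : (forall t, normc t = e -> u t = v t) -> laurent e u -> laurent e v.
Proof. by move=> uv [m [p h]]; exists m, p => t ht; rewrite -uv// h. Qed.

Lemma laurent_poly e (p : {poly C}) : laurent e (fun t => p.[t]).
Proof. by exists 0%N, p => t _; rewrite mul1r. Qed.

Lemma laurent_cst e k : laurent e (fun=> k).
Proof. by apply: laurent_eq (laurent_poly e k%:P) => t _; rewrite hornerC. Qed.

Lemma laurent_conj e : laurent e (fun t => t^*).
Proof. by exists 1%N, (e ^+ 2)%:C%:P => t ht; rewrite hornerC expr1 normc_mulJ ht. Qed.

Lemma laurentD e u v : laurent e u -> laurent e v -> laurent e (fun t => u t + v t).
Proof.
move=> [m [p hp]] [n [q hq]]; exists (m + n)%N, ('X^n * p + 'X^m * q) => t ht.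
by rewrite !hornerE -hp// -hq// exprD; ring.
Qed.

Lemma laurentM e u v : laurent e u -> laurent e v -> laurent e (fun t => u t * v t).
Proof.
move=> [m [p hp]] [n [q hq]]; exists (m + n)%N, (p * q) => t ht.
by rewrite hornerM -hp// -hq// exprD; ring.
Qed.

Lemma laurent_sum e (I : Type) (r : seq I) (P : pred I) (F : I -> C -> C) :
  (forall i, laurent e (F i)) -> laurent e (fun t => \sum_(i <- r | P i) F i t).
Proof.
move=> h; elim: r => [|i r IH].
  by apply: laurent_eq (laurent_cst e 0) => t _; rewrite big_nil.
have [Pi|nPi] := boolP (P i).
  by apply: laurent_eq (laurentD (h i) IH) => t _; rewrite big_cons Pi.
by apply: laurent_eq IH => t _; rewrite big_cons (negbTE nPi).
Qed.

Lemma laurent_prod e (I : Type) (r : seq I) (F : I -> C -> C) :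
  (forall i, laurent e (F i)) -> laurent e (fun t => \prod_(i <- r) F i t).
Proof.
move=> h; elim: r => [|i r IH].
  by apply: laurent_eq (laurent_cst e 1) => t _; rewrite big_nil.
by apply: laurent_eq (laurentM (h i) IH) => t _; rewrite big_cons.
Qed.

Lemma laurentX e u n : laurent e u -> laurent e (fun t => u t ^+ n).
Proof.
move=> h; elim: n => [|n IH]; first exact: laurent_cst.
by apply: laurent_eq (laurentM h IH) => t _; rewrite exprS.
Qed.

Lemma laurent_horner_conj e (p : {poly C}) : laurent e (fun t => p.[t^*]).
Proof.
apply: (@laurent_eq _ (fun t => \sum_(i < size p) p`_i * (t^*) ^+ i)).
  by move=> t _; rewrite horner_coef.
by apply: laurent_sum => i; apply: laurentM; [exact: laurent_cst|apply: laurentX; exact: laurent_conj].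
Qed.

Lemma laurent_conj_horner e (p : {poly C}) : laurent e (fun t => (p.[t^*])^*).
Proof.
apply: laurent_eq (laurent_poly e (map_poly (@conjc R) p)) => t _.
by rewrite -{1}[t]conjcK horner_map.
Qed.

Lemma laurent_det e n (A : C -> 'M[C]_n) :
  (forall i j, laurent e (fun t => A t i j)) -> laurent e (fun t => \det (A t)).
Proof.
move=> h; apply: laurent_sum => s.
by apply: laurentM; [exact: laurent_cst|apply: laurent_prod => i].
Qed.

Lemma laurent_mulmx e m n p (A : C -> 'M[C]_(m, n)) (B : C -> 'M[C]_(n, p)) :
  (forall i j, laurent e (fun t => A t i j)) -> (forall i j, laurent e (fun t => B t i j)) ->
  forall i j, laurent e (fun t => (A t *m B t) i j).
Proof.
move=> hA hB i j; apply: (@laurent_eq _ (fun t => \sum_k A t i k * B t k j)).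
  by move=> t _; rewrite mxE.
by apply: laurent_sum => k; exact: laurentM.
Qed.

Lemma laurent_adj e n (A : C -> 'M[C]_n) :
  (forall i j, laurent e (fun t => A t i j)) -> forall i j, laurent e (fun t => (\adj (A t)) i j).
Proof.
move=> h i j; apply: (@laurent_eq _ (fun t => cofactor (A t) j i)).
  by move=> t _; rewrite mxE.
apply: laurentM; first exact: laurent_cst.
apply: laurent_det => i' j'; apply: laurent_eq (h (lift j i') (lift i j')) => t _.
by rewrite !mxE.
Qed.

(* The Gram system of a maximal independent set of the vectors PP k determines
   h t as a rational function of t and conj t. *)
Lemma rational_on_circle N (PP : nat -> 'I_N -> {poly C}) (h : C -> 'I_N -> C) e : 0 < e ->
  (forall t k, normc t = e -> \sum_j h t j * ((PP k j).[t^*])^* = (k == 0)%:R) ->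
  (forall t (u : 'I_N -> C), normc t = e ->
     (forall k, \sum_j (PP k j).[t^*] * u j = 0) -> \sum_j h t j * u j = 0) ->
  exists2 q : {poly C}, q != 0 &
    exists p : 'I_N -> {poly C}, forall t j, normc t = e -> q.[t] * h t j = (p j).[t].
Proof.
move=> e0 h1 h2.
pose X d (ka : 'I_d -> nat) (t : C) := \matrix_(i < d, j < N) (PP (ka i) j).[t^*].
pose Y d (ka : 'I_d -> nat) (t : C) := \matrix_(j < N, i < d) ((PP (ka i) j).[t^*])^*.
(* The maximum is taken over all points of the circle at once, so that the family [ka] attaining it
   at [t0] is maximal at every other t where it is independent. *)
pose Pd d := `[< exists t (ka : 'I_d -> nat), normc t = e /\ row_free (X d ka t) >].
have Pd0 : exists d, Pd d.
  exists 0%N; apply/asboolP; exists e%:C, (fun=> 0%N); split; first by rewrite normc_real gtr0_norm.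
  by rewrite /row_free eqn_leq rank_leq_row.
have PdN d : Pd d -> (d <= N)%N.
  by move=> /asboolP[t [ka [_ /eqP <-]]]; exact: rank_leq_col.
case: (ex_maxnP Pd0 PdN) => d /asboolP[t0 [ka [ht0 free0]]] dmax.
pose G t := X d ka t *m Y d ka t.
(* If v G = 0, then v X has squared norm v X Y (v conjugate transposed) = 0. *)
have gram t : row_free (X d ka t) -> \det (G t) != 0.
  move=> fr; apply/negP => /det0P[v v0 vG].
  suff : v *m X d ka t = 0 by move/eqP; rewrite mulmx_free_eq0// (negbTE v0).
  set w := v *m X d ka t.
  have : (w *m (Y d ka t *m (map_mx (@conjc R) v)^T)) 0 0 = 0.
    by rewrite mulmxA -(mulmxA v) vG mul0mx mxE.
  rewrite mxE; under eq_bigr => j _.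
    rewrite (_ : (Y d ka t *m _) j 0 = (w 0 j)^*); last first.
      rewrite !mxE rmorph_sum; apply: eq_bigr => i _.
      by rewrite !mxE rmorphM mulrC.
    rewrite normc_mulJ.
  over.
  rewrite -rmorph_sum => /(@complexI _ _ 0)/eqP; rewrite psumr_eq0 => [/allP hw|j _]; last exact: sqr_ge0.
  apply/rowP => j; rewrite [RHS]mxE; apply/eqP; rewrite -normc_eq0 -sqrf_eq0.
  exact: hw j (mem_index_enum j).
(* The extra factor det G makes the identity trivial at the points where the Gram determinant
   vanishes. *)
have solve t j : normc t = e -> \det (G t) ^+ 2 * h t j =
    \det (G t) * ((\row_i ((ka i == 0)%:R : C)) *m \adj (G t) *m X d ka t) 0 j.
  move=> ht; have [->|det0] := eqVneq (\det (G t)) 0; first by rewrite expr0n !mul0r.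
  have Gu : G t \in unitmx by rewrite unitmxE unitfE.
  have fr : row_free (X d ka t).
    by apply/row_freeP; exists (Y d ka t *m invmx (G t)); rewrite mulmxA mulmxV.
  (* A vector outside the span would give an independent family of size d + 1 at this t. *)
  have span k : (\row_j (PP k j).[t^*] <= X d ka t)%MS.
    apply: contraT => nle.
    pose ka' (i : 'I_(d + 1)) := match fintype.split i with inl i => ka i | inr _ => k end.
    have XE : X (d + 1)%N ka' t = col_mx (X d ka t) (\row_j (PP k j).[t^*]).
      apply/matrixP => i l; rewrite !mxE /ka'; case: fintype.split => i'; by rewrite !mxE.
    have : Pd (d + 1)%N.
      apply/asboolP; exists t, ka'; split => //.
      rewrite XE /row_free eqn_leq rank_leq_row/= -addsmxE addn1.
      have lt : (X d ka t < X d ka t + \row_j (PP k j).[t^*])%MS.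
        by rewrite ltmxE addsmxSl/= addsmx_sub negb_and nle orbT.
      by move: fr => /eqP {1}<-; exact: rank_ltmx.
    by move/dmax; rewrite addn1 ltnn.
  pose H := \row_j h t j.
  (* Each column of [cokermx] is a functional that kills every jet, hence kills [h t]. *)
  have HX : (H <= X d ka t)%MS.
    rewrite submxE; apply/eqP/rowP => l; rewrite !mxE.
    under eq_bigr do rewrite mxE.
    apply: (h2 t (fun j => cokermx (X d ka t) j l)) => // k.
    have := span k; rewrite submxE => /eqP/rowP/(_ l); rewrite mxE [RHS]mxE => E; rewrite -[RHS]E.
    by apply: eq_bigr => i _; rewrite !mxE.
  have [x xE] := submxP HX.
  have HY : H *m Y d ka t = \row_i (ka i == 0)%:R.
    apply/rowP => i; rewrite !mxE -(h1 t (ka i) ht); apply: eq_bigr => l _.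
    by rewrite !mxE.
  rewrite -HY xE -!mulmxA (mulmxA (X d ka t)) -/(G t) (mulmxA (G t)) mul_mx_adj.
  rewrite mul_scalar_mx -scalemxAr -xE !mxE expr2 mulrA; ring.
have lX i j : laurent e (fun t => X d ka t i j).
  by apply: laurent_eq (laurent_horner_conj e (PP (ka i) j)) => t _; rewrite mxE.
have lY i j : laurent e (fun t => Y d ka t i j).
  by apply: laurent_eq (laurent_conj_horner e (PP (ka j) i)) => t _; rewrite mxE.
have lG i j : laurent e (fun t => G t i j) by exact: laurent_mulmx.
have ldet : laurent e (fun t => \det (G t)) by exact: laurent_det.
have [m [q hq]] := laurentX 2 ldet.
have lr j : laurent e (fun t => \det (G t) * ((\row_i ((ka i == 0)%:R : C)) *m \adj (G t) *m X d ka t) 0 j).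
  apply: laurentM => //; apply: laurent_mulmx => // i' j'.
  apply: (@laurent_mulmx _ _ _ _ (fun=> \row_i ((ka i == 0)%:R : C)) (fun t => \adj (G t))).
    by move=> *; exact: laurent_cst.
  exact: laurent_adj.
have [mj hmj] := choice lr.
have [pj hpj] := choice hmj.
pose M := \sum_j mj j.
have t00 : t0 != 0 by rewrite -normc_gt0 ht0.
(* [M] is a common exponent clearing the negative powers of t in all coordinates; [q] is nonzero
   because the Gram determinant is nonzero at [t0]. *)
exists ('X^M * q).
  apply/negP => /eqP/(congr1 (fun p => p.[t0])); rewrite hornerM hornerXn -hq// horner0 => /eqP.
  by rewrite !mulf_eq0 !expf_eq0 (negbTE t00) (negbTE (gram _ free0)) !andbF.
exists (fun j => 'X^(M - mj j) * 'X^m * pj j) => t j ht.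
have mM : (mj j <= M)%N by rewrite /M (bigD1 j)//= leq_addr.
rewrite !hornerM !hornerXn -hq// -hpj// -solve// -{1}(subnK mM) exprD; ring.
Qed.

End RationalOnCircle.

(** * Rational maps on a disc and their boundary values *)

Section RationalDisc.
Variable R : realType.
Local Notation C := R[i].

Definition nsq N (v : 'I_N -> C) : R := \sum_j normc (v j) ^+ 2.

Lemma nsqE N (v : 'I_N -> C) : \sum_j v j * (v j)^* = (nsq v)%:C.
Proof. by rewrite rmorph_sum; apply: eq_bigr => j _; rewrite normc_mulJ. Qed.

Lemma nsq_ge0 N (v : 'I_N -> C) : 0 <= nsq v.
Proof. by apply: sumr_ge0 => j _; exact: sqr_ge0. Qed.

Lemma normc_nsq N (v : 'I_N -> C) : normc (\sum_j v j * (v j)^*) = nsq v.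
Proof. by rewrite nsqE normc_real ger0_norm// nsq_ge0. Qed.

Lemma nsq_scale N (k : C) (v : 'I_N -> C) : nsq (fun j => k * v j) = normc k ^+ 2 * nsq v.
Proof. by rewrite /nsq mulr_sumr; apply: eq_bigr => j _; rewrite normcM exprMn. Qed.

Lemma clim_nsq (T : Type) (F : set_system T) {FF : Filter F} N (f : 'I_N -> T -> C) (l : 'I_N -> C) :
  (forall j, clim F (f j) (l j)) ->
  clim F (fun t => (nsq (fun j => f j t))%:C) (nsq l)%:C.
Proof.
move=> h; rewrite -nsqE.
apply: (@clim_near _ _ _ _ (fun t => \sum_j f j t * (f j t)^*)).
  by apply: filterE => t; rewrite nsqE.
by apply: clim_sum => j _; apply: climM => //; exact: clim_conj.
Qed.

Lemma ccont_horner (p : {poly C}) z : ccont (fun w => p.[w]) z.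
Proof. by apply: cdiff_ccont; exact: cdiff_horner. Qed.

(** Only the finitely many roots of q matter: those other than [t0] stay at a distance, and [y]
    avoids [t0]. *)
Lemma near_horner_neq0 (T : Type) (F : set_system T) {FF : Filter F} (q : {poly C}) (y : T -> C) t0 :
  q != 0 -> clim F y t0 -> (\forall x \near F, y x != t0) -> \forall x \near F, q.[y x] != 0.
Proof.
move=> q0 hy hne; have [rs qE] := closed_field_poly_normal q.
have {hne} : \forall x \near F, all (fun z => y x != z) rs.
  elim: rs {qE} => [|z rs IH]; first by apply: filterE.
  have hz : \forall x \near F, y x != z.
    have [->//|zt] := eqVneq z t0.
    have z0 : 0 < normc (t0 - z) by rewrite normc_gt0 subr_eq0 eq_sym.
    apply: filterS (hy _ z0) => x; apply: contraTneq => ->.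
    by rewrite normcB ltxx.
  by apply: filterS2 hz IH => x /= -> ->.
apply: filterS => x /allP hx; rewrite qE hornerZ mulf_neq0 ?lead_coef_eq0//.
rewrite horner_prod; elim: rs hx {qE} => [|z rs IH] hx; first by rewrite big_nil oner_eq0.
rewrite big_cons mulf_neq0//; last by apply: IH => w wr; apply: hx; rewrite inE wr orbT.
by rewrite hornerXsubC subr_eq0; apply: hx; rewrite inE eqxx.
Qed.

Lemma at_right_cis : clim ((0 : R)^'+) (@cis R) 1.
Proof.
have -> : (1 : C) = cis 0 by rewrite /cis cos0 sin0.
by move=> e e0; apply: cvg_within; exact: (@cis_rcont R 0 e e0).
Qed.

Lemma at_right_cis_neq1 : \forall x \near (0 : R)^'+, cis x != 1.
Proof.
near=> x; have x0 : 0 < x by near: x; exact: nbhs_right_gt.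
have xp : x < pi by near: x; apply: nbhs_right_lt; exact: pi_gt0.
apply/negP => /eqP/(congr1 (@complex.Im R))/= h.
by have := @sin_gt0_pi _ x; rewrite x0 xp h ltxx => /(_ isT).
Unshelve. all: by end_near. Qed.

(* Once the common zeros of q and p are divided out, h = p / q is holomorphic
   on the closed disc, and the maximum principle applies. *)
Lemma rational_disc_false N (h : 'I_N -> C -> C) (q : {poly C}) (p : 'I_N -> {poly C}) (e T : R) :
  0 < e -> e < T -> q != 0 ->
  (forall j t, normc t < T -> ccont (h j) t) ->
  (forall j t, normc t < T -> q.[t] * h j t = (p j).[t]) ->
  (forall t, e < normc t -> normc t < T -> 1 < nsq (fun j => h j t)) ->
  (forall t, normc t = T -> q.[t] != 0 -> nsq (fun j => (p j).[t] / q.[t]) <= 1) -> False.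
Proof.
move=> e0 eT q0 ch qh h1 bd.
have T0 := lt_trans e0 eT.
(* The greatest common divisor of q and all the p_j, found as a common divisor of maximal size. *)
pose P n := `[< exists d : {poly C}, [/\ size d = n, d %| q & forall j, d %| p j] >].
have P1 : exists n, P n.
  by exists (size (1 : {poly C})); apply/asboolP; exists 1; split => // [|j]; exact: dvd1p.
have Pq n : P n -> (n <= size q)%N.
  by move=> /asboolP[d [<- dq _]]; exact: dvdp_leq.
case: (ex_maxnP P1 Pq) => n /asboolP[d [dn dq dp]] nmax.
pose q' := q %/ d; pose p' j := p j %/ d.
have qE : q = q' * d by rewrite /q' divpK.
have pE j : p j = p' j * d by rewrite /p' divpK.
have d0 : d != 0 by apply: contraNneq q0 => d0; rewrite qE d0 mulr0.
have nocommon c : q'.[c] = 0 -> (exists j, (p' j).[c] != 0).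
  move=> qc; apply: contrapT => /forallNP pc.
  have dv (u : {poly C}) : u.[c] = 0 -> ('X - c%:P) * d %| u * d.
    by move=> uc; rewrite dvdp_mul2r// dvdp_XsubCl; apply/rootP.
  have : P (size (('X - c%:P) * d)).
    apply/asboolP; exists (('X - c%:P) * d); split => //; first by rewrite qE dv.
    by move=> j; rewrite pE dv//; apply/eqP; have /negP := pc j; rewrite negbK.
  by move/nmax; rewrite size_mul ?polyXsubC_eq0// size_XsubC dn ltnn.
(* Cancelling [d] needs d != 0; at its zeros the relation is a limit along t + x with x real,
   decreasing to 0. *)
have rel j t : normc t < T -> q'.[t] * h j t = (p' j).[t].
  move=> tT; pose y (x : R) : C := t + x%:C.
  have hy : clim ((0 : R)^'+) y t.
    rewrite -[X in clim _ _ X]addr0; apply: climD; [exact: clim_cst|exact: at_right_clim].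
  have yt : \forall x \near (0 : R)^'+, y x != t.
    apply: filterS (nbhs_right_gt (0 : R)) => x x0.
    by rewrite /y -subr_eq0 addrAC subrr add0r -normc_gt0 normc_real normr_gt0 gt_eqF.
  have dy := near_horner_neq0 d0 hy yt.
  have c1 : clim ((0 : R)^'+) (fun x => q'.[y x] * h j (y x)) (q'.[t] * h j t).
    apply: climM; first by apply: clim_comp hy _; exact: ccont_horner.
    by apply: clim_comp hy _; exact: ch.
  apply: (clim_unique c1); apply: (@clim_near _ _ _ _ (fun x => (p' j).[y x])); last first.
    by apply: clim_comp hy _; exact: ccont_horner.
  near=> x.
  have yT : normc (y x) < T.
    have : normc (y x - t) < T - normc t by near: x; apply: hy; rewrite subr_gt0.
    by have := le_normcD (y x - t) t; rewrite subrK; lra.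
  have dx : d.[y x] != 0 by near: x; exact: dy.
  apply: (mulIf dx); have := qh j _ yT; rewrite qE pE !hornerM => <-; ring.
(* The bound is given only where q != 0; the remaining points are reached along the circle
   itself. *)
have circ t : normc t = T -> nsq (fun j => (p' j).[t]) <= normc q'.[t] ^+ 2.
  move=> tT; pose y (x : R) : C := t * cis x.
  have t0 : t != 0 by rewrite -normc_gt0 tT.
  have hy : clim ((0 : R)^'+) y t.
    rewrite -[X in clim _ _ X]mulr1; apply: climM; [exact: clim_cst|exact: at_right_cis].
  have yt : \forall x \near (0 : R)^'+, y x != t.
    apply: filterS at_right_cis_neq1 => x; apply: contra_neq => /(congr1 (fun z => t^-1 * z)).
    by rewrite /y mulKf// mulVf.
  have qy := near_horner_neq0 q0 hy yt.
  have cp : clim ((0 : R)^'+) (fun x => (nsq (fun j => (p' j).[y x]))%:C - (normc q'.[y x] ^+ 2)%:C)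
      ((nsq (fun j => (p' j).[t]))%:C - (normc q'.[t] ^+ 2)%:C).
    apply: climB; first by apply: clim_nsq => j; apply: clim_comp hy _; exact: ccont_horner.
    rewrite -normc_mulJ.
    apply: (@clim_near _ _ _ _ (fun x => q'.[y x] * (q'.[y x])^*)).
      by apply: filterE => x; rewrite normc_mulJ.
    have hq : clim ((0 : R)^'+) (fun x => q'.[y x]) q'.[t] by apply: clim_comp hy _; exact: ccont_horner.
    by apply: climM => //; exact: clim_conj.
  rewrite leNgt; apply/negP => lt.
  have lt0 : 0 < nsq (fun j => (p' j).[t]) - normc q'.[t] ^+ 2 by rewrite subr_gt0.
  near (0 : R)^'+ => x.
  have qx : q.[y x] != 0 by near: x; exact: qy.
  have := bd (y x); rewrite normcM normc_cis mulr1 => /(_ tT qx).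
  have [q'x dx] : q'.[y x] != 0 /\ d.[y x] != 0.
    by move: qx; rewrite qE hornerM mulf_eq0 negb_or => /andP.
  have -> : nsq (fun j => (p j).[y x] / q.[y x]) = nsq (fun j => q'.[y x]^-1 * (p' j).[y x]).
    by apply: eq_bigr => j _; rewrite qE pE !hornerM; congr (normc _ ^+ 2); field; rewrite q'x.
  have Q0 : 0 < normc q'.[y x] ^+ 2 by rewrite exprn_gt0// normc_gt0.
  rewrite nsq_scale normcV exprVn mulrC ler_pdivrMr// mul1r => h2.
  have : normc ((nsq (fun j => (p' j).[y x]))%:C - (normc q'.[y x] ^+ 2)%:C -
      ((nsq (fun j => (p' j).[t]))%:C - (normc q'.[t] ^+ 2)%:C)) <
      nsq (fun j => (p' j).[t]) - normc q'.[t] ^+ 2.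
    by near: x; exact: cp.
  rewrite -!rmorphB normc_real ltr_norml => /andP[+ _].
  by clear - h2; lra.
(* At a zero of q' all p'_j vanish too, by [rel] inside the disc and by [circ] on its boundary,
   against [nocommon]. *)
have q'0 t : normc t <= T -> q'.[t] != 0.
  move=> tT; apply/negP => /eqP qt; have [j] := nocommon _ qt; apply/negP; rewrite negbK.
  move: tT; rewrite le_eqVlt => /orP[/eqP tT|tT]; last by rewrite -rel// qt mul0r.
  have := circ _ tT; rewrite qt normc0 expr0n => h2.
  have : nsq (fun j => (p' j).[t]) == 0 by rewrite eq_le h2 nsq_ge0.
  rewrite psumr_eq0 => [/allP/(_ j (mem_index_enum j))|? _]; last exact: sqr_ge0.
  by rewrite /= sqrf_eq0 normc_eq0.
pose t1 : C := ((e + T) / 2)%:C.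
have nt1 : normc t1 = (e + T) / 2 by rewrite normc_real ger0_norm// divr_ge0// addr_ge0// ltW.
have t1T : normc t1 < T by rewrite nt1; clear - eT; lra.
have t1e : e < normc t1 by rewrite nt1; clear - eT; lra.
pose v j := h j t1.
have v1 : 1 < nsq v by exact: h1.
(* The pairing of the map with its value at [t1] reduces the vector case to a scalar function. *)
pose F z := \sum_j (p' j).[z] / q'.[z] * (v j)^*.
have Fv : F t1 = (nsq v)%:C.
  rewrite -nsqE; apply: eq_bigr => j _; congr (_ * _).
  by rewrite -rel// mulrC mulKf// q'0// ltW.
have : normc (F t1) <= (1 + nsq v) / 2.
  apply: (maximum_principle t1T).
    move=> z zT; apply: cdiff_sum => j; apply: cdiffM; last exact: cdiff_cst.
    apply: cdiffM; first exact: cdiff_horner.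
    by apply: cdiffV; [exact: q'0|exact: cdiff_horner].
  move=> z zT; have Q0 : 0 < normc q'.[z] ^+ 2 by rewrite exprn_gt0// normc_gt0 q'0// zT.
  have b1 : nsq (fun j => q'.[z]^-1 * (p' j).[z]) <= 1.
    by rewrite nsq_scale normcV exprVn mulrC ler_pdivrMr// mul1r circ.
  rewrite (le_trans (le_normc_sum _ _ _))//.
  (* The bound a b <= (a^2 + b^2) / 2 stands in for Cauchy-Schwarz: (1 + |v|^2) / 2 is still below
     |v|^2 because |v| > 1. *)
  apply: (@le_trans _ _ (\sum_j (normc (q'.[z]^-1 * (p' j).[z]) ^+ 2 + normc (v j) ^+ 2) / 2)).
    apply: ler_sum => j _; rewrite normcM normc_conj [_ / _]mulrC.
    have := sqr_ge0 (normc (q'.[z]^-1 * (p' j).[z]) - normc (v j)).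
    by rewrite sqrrB; clear; lra.
  rewrite -mulr_suml big_split/= ler_pM2r ?invr_gt0// lerD2r.
  exact: b1.
rewrite Fv normc_real ger0_norm ?nsq_ge0//; clear - v1; lra.
Unshelve. all: by end_near. Qed.

End RationalDisc.

(** * Extension of a shell map across the unit sphere near (1, 0) *)

Section ShellMaps.
Variable R : realType.
Local Notation C := R[i].

Definition bidisc (eta rho : R) (x y : C) := normc (x - 1) < eta /\ normc y < rho.

Lemma normc_sqr_add_complex (x y : C) : normc x ^+ 2 + normc y ^+ 2 = 1 -> normc x <= 1 /\ normc y <= 1.
Proof.
move=> h; have X0 := normc_ge0 x; have Y0 := normc_ge0 y; rewrite !expr2 in h.
by split; nra.
Qed.

(** The last hypothesis is properness as seen by paths. On the sphere it gives norm at most 1 for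
    the extension; the reverse inequality is the limit of |g| > 1. *)
Lemma shell_map_extension N (g : 'I_N -> C -> C -> C) (b R0 : R) :
  `|1 - b| < R0 ->
  (forall j x y, shell b R0 x y -> holo2 (g j) x y) ->
  (forall x y, shell b R0 x y -> 1 < nsq (fun j => g j x y)) ->
  (forall (x0 : R) (X Y : R -> C) (w : 'I_N -> R -> C), x0 < 1 ->
     (forall x, x0 <= x <= 1 -> [/\ rcont X x, rcont Y x & forall j, rcont (w j) x]) ->
     (forall x, x0 <= x -> x < 1 -> shell b R0 (X x) (Y x) /\ forall j, g j (X x) (Y x) = w j x) ->
     ~ shell b R0 (X 1) (Y 1) -> nsq (fun j => w j 1) <= 1) ->
  exists (rho : R) (ge : 'I_N -> C -> C -> C),
    let D := bidisc (rho ^+ 2 / 32) rho in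
    [/\ 0 < rho <= 1, forall j x y, D x y -> holo2 (ge j) x y,
        forall x y, D x y -> normc (x - b%:C) ^+ 2 + normc y ^+ 2 < R0 ^+ 2,
        forall j x y, D x y -> 1 < normc x ^+ 2 + normc y ^+ 2 -> ge j x y = g j x y &
        forall x y, D x y -> normc x ^+ 2 + normc y ^+ 2 = 1 ->
          \sum_j ge j x y * (ge j x y)^* = 1].
Proof.
move=> hb hg g1 hprop.
pose d := R0 - `|1 - b|.
have d0 : 0 < d by rewrite subr_gt0.
have dR : d <= R0 by rewrite gerBl.
(* [d] is the distance from (1, 0) to the outer sphere. Then |x - b| <= R0 - 7 d / 8 and |y| <= d /
   2, which keeps the bidisc in the outer ball. *)
pose rho := Num.min 1 (d / 2).
have rho0 : 0 < rho by rewrite lt_min ltr01 divr_gt0.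
have rho1 : rho <= 1 by rewrite ge_min lexx.
have rhod : rho <= d / 2 by rewrite ge_min lexx orbT.
(* On |y| = rho one has |x|^2 + |y|^2 > (1 - eta)^2 + 4 eta > 1. *)
pose eta := rho ^+ 2 / 4.
have eta0 : 0 < eta by rewrite divr_gt0// exprn_gt0.
have etar : eta <= rho / 4 by rewrite ler_pM2r ?invr_gt0// expr2 ler_piMl// ltW.
have eta1 : eta <= 1 by clear - etar rho1; lra.
have inside (x y : C) : normc (x - 1) < eta -> normc y <= rho ->
    normc (x - b%:C) ^+ 2 + normc y ^+ 2 < R0 ^+ 2.
  move=> hx hy.
  have xb : normc (x - b%:C) <= R0 - d + eta.
    have -> : x - b%:C = (1 - b)%:C + (x - 1) by rewrite rmorphB rmorph1; ring.
    by rewrite (le_trans (le_normcD _ _))// normc_real /d opprB addrCA subrr addr0 lerD2l ltW.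
  have X0 := normc_ge0 (x - b%:C); have Y0 := normc_ge0 y.
  move: (normc _) (normc y) xb X0 Y0 hy => u v xb X0 Y0 hy.
  have u1 : u <= R0 - d * (7 / 8) by clear - xb etar rhod; lra.
  have v1 : v <= d / 2 by exact: le_trans rhod.
  rewrite !expr2; clear - u1 v1 X0 Y0 d0 dR.
  have : u * u <= (R0 - d * (7 / 8)) * (R0 - d * (7 / 8)) by rewrite ler_pM.
  have : v * v <= (d / 2) * (d / 2) by rewrite ler_pM.
  nra.
have outside (x y : C) : normc (x - 1) < eta -> normc y = rho -> 1 < normc x ^+ 2 + normc y ^+ 2.
  move=> hx ->.
  have x1 : 1 - eta < normc x.
    by have := le_normcD (x - (x - 1)) (x - 1); rewrite subrK opprB addrCA subrr addr0 normc1 => _;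
       have := le_trans (ler_norm _) (le_normcB_dist 1 x); rewrite normcB normc1; clear - hx; lra.
  have X1 : (1 - eta) ^+ 2 < normc x ^+ 2.
    by rewrite !expr2; clear - x1 eta1; nra.
  have rE : rho ^+ 2 = 4 * eta by rewrite /eta; field.
  rewrite rE; clear - X1 eta0; rewrite !expr2 in X1 *; nra.
(* The smaller bidisc |x - 1| < eta / 8 is the range of [ext_agree]. *)
have e32 : rho ^+ 2 / 32 = eta / 8 by rewrite /eta; field.
exists rho, (fun j => ext (g j) rho) => D; rewrite /D e32.
have e8 : eta / 8 <= eta by clear - eta0; lra.
have holo j x y : bidisc (eta / 8) rho x y -> holo2 (ext (g j) rho) x y.
  by move=> [hx hy]; apply: (@ext_holo _ b R0 eta rho) => //; [exact: hg|exact: lt_le_trans e8].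
have agree j x y : bidisc (eta / 8) rho x y -> 1 < normc x ^+ 2 + normc y ^+ 2 -> ext (g j) rho x y = g j x y.
  by move=> [hx hy]; apply: (@ext_agree _ b R0 eta rho) => //; exact: hg.
have ins x y : bidisc (eta / 8) rho x y -> normc (x - b%:C) ^+ 2 + normc y ^+ 2 < R0 ^+ 2.
  by move=> [hx hy]; apply: inside; [exact: lt_le_trans e8|exact: ltW].
split => //; first by rewrite rho0.
move=> x y [hx hy] hxy; have [x1 y1] := normc_sqr_add_complex hxy.
pose th := Num.min (eta / 8 - normc (x - 1)) (rho - normc y) / 2.
have th0 : 0 < th by rewrite divr_gt0// lt_min !subr_gt0 hx.
have th1 : th <= (eta / 8 - normc (x - 1)) / 2 by rewrite ler_pM2r ?invr_gt0// ge_min lexx.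
have th2 : th <= (rho - normc y) / 2 by rewrite ler_pM2r ?invr_gt0// ge_min lexx orbT.
pose X (s : R) := (2 - s)%:C * x; pose Y (s : R) := (2 - s)%:C * y.
pose w j (s : R) := ext (g j) rho (X s) (Y s).
have DXY s : 1 - th <= s <= 1 -> bidisc (eta / 8) rho (X s) (Y s).
  move=> /andP[s1 s2]; have s0 : 0 <= 1 - s by rewrite subr_ge0.
  split.
    have -> : X s - 1 = (x - 1) + (1 - s)%:C * x by rewrite /X !rmorphB rmorph1 rmorph_nat; ring.
    rewrite (le_lt_trans (le_normcD _ _))// normcM normc_real ger0_norm//.
    have : (1 - s) * normc x <= 1 - s by rewrite ler_piMr.
    clear - s1 th1 th0; lra.
  have -> : Y s = y + (1 - s)%:C * y by rewrite /Y !rmorphB rmorph1 rmorph_nat; ring.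
  rewrite (le_lt_trans (le_normcD _ _))// normcM normc_real ger0_norm//.
  have : (1 - s) * normc y <= 1 - s by rewrite ler_piMr.
  clear - s1 th2 th0; lra.
have scal s : rcont (fun s : R => (2 - s)%:C) s.
  apply: (@clim_near _ _ _ _ (fun s : R => 2%:C - s%:C)); first by apply: filterE => u; rewrite rmorphB.
  by rewrite /rcont rmorphB; apply: climB; [exact: clim_cst|exact: nbhs_real_clim].
have cX s : rcont X s by apply: climM; [exact: scal|exact: clim_cst].
have cY s : rcont Y s by apply: climM; [exact: scal|exact: clim_cst].
have cw j s : 1 - th <= s <= 1 -> rcont (w j) s.
  by move=> hs; apply: clim_comp2; [exact: cX|exact: cY|case: (holo j _ _ (DXY s hs))].
have nXY s : normc (X s) ^+ 2 + normc (Y s) ^+ 2 = (2 - s) ^+ 2.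
  by rewrite !normcM !exprMn -mulrDr hxy mulr1 normc_real real_normK ?num_real.
have shellXY s : 1 - th <= s -> s < 1 -> shell b R0 (X s) (Y s) /\ forall j, g j (X s) (Y s) = w j s.
  move=> s1 s2; have D' : bidisc (eta / 8) rho (X s) (Y s) by apply: DXY; rewrite s1 ltW.
  have n1 : 1 < normc (X s) ^+ 2 + normc (Y s) ^+ 2.
    by rewrite nXY expr2; clear - s2; nra.
  by split=> [|j]; [split => //; exact: ins|rewrite /w agree].
have lt1 : 1 - th < 1 by rewrite gtrBl.
have in1 : 1 - th <= (1 : R) <= 1 by rewrite (ltW lt1) /=.
have XY1 : X 1 = x /\ Y 1 = y.
  by rewrite /X /Y (_ : 2 - 1 = 1 :> R) ?rmorph1 ?mul1r//; clear; lra.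
have up : nsq (fun j => w j 1) <= 1.
  apply: (hprop (1 - th) X Y w) => //.
    by move=> s hs; split => // j; exact: cw.
  by move=> [+ _]; rewrite nXY (_ : 2 - 1 = 1 :> R) ?expr1n ?ltxx//; clear; lra.
have low : 1 <= nsq (fun j => w j 1).
  rewrite -normc_nsq; apply: (@clim_normc_le _ _ (1^'-) _ (fun s => \sum_j w j s * (w j s)^*)).
    apply: clim_sum => j _; have cj : clim (1^'-) (w j) (w j 1).
      by move=> e e0; apply: cvg_within; exact: (cw j 1 in1).
    by apply: climM => //; exact: clim_conj.
  near=> s; rewrite normc_nsq.
  have [sh gw] : shell b R0 (X s) (Y s) /\ forall j, g j (X s) (Y s) = w j s.
    apply: shellXY; last by near: s; exact: nbhs_left_lt.
    by apply: ltW; near: s; exact: nbhs_left_gt.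
  by rewrite ltW//; have := g1 _ _ sh; rewrite /nsq; under eq_bigr do rewrite gw.
have := nsqE (fun j => w j 1); rewrite (le_anti (introT andP (conj up low))).
by rewrite /w; case: XY1 => -> ->.
Unshelve. all: by end_near. Qed.

End ShellMaps.

(** * Rationality on a vertical slice, and the contradiction *)

Section ShellMapsRational.
Variable R : realType.
Local Notation C := R[i].

Lemma coef_cst (k0 : C) (r : R) k : 0 < r -> coef (fun=> k0) r k = k0 * (k == 0)%:R.
Proof.
move=> r0; rewrite /coef meanZ; last exact: ccirc_powV.
case: k => [|k]; last by rewrite mean_powV.
congr (_ * _); rewrite -[RHS](mean_cst (1 : C)); apply: eq_mean => s _.
by rewrite expr0 invr1.
Qed.

Lemma coef_sum N (F : 'I_N -> C -> C) (u : 'I_N -> C) (r : R) k : 0 < r ->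
  (forall j z, normc z = r -> ccont (F j) z) ->
  coef (fun s => \sum_j F j s * u j) r k = \sum_j coef (F j) r k * u j.
Proof.
move=> r0 hF; rewrite /coef.
rewrite (@eq_mean _ _ (fun s => \sum_j u j * (F j (r%:C * s) * (r%:C * s) ^- k))); last first.
  by move=> s _; rewrite mulr_suml; apply: eq_bigr => j _; ring.
have cj j : ccirc (fun s => F j (r%:C * s) * (r%:C * s) ^- k).
  apply: ccircM; last exact: ccirc_powV.
  by apply: ccirc_scale; [exact: ltW|exact: hF].
rewrite mean_sum; last by move=> j; apply: ccircM; [exact: ccirc_cst|exact: cj].
by apply: eq_bigr => j _; rewrite meanZ// mulrC.
Qed.

(* For z = (a, t) on the sphere, the complex tangent line at z passes through
   the fixed point (1 / a, 0).  The jets of the map at that point along the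
   line depend polynomially on conj t, span the value at z, and have known
   inner products with it. *)
Lemma sphere_map_rational N (ge : 'I_N -> C -> C -> C) (rho : R) :
  let D := bidisc (rho ^+ 2 / 32) rho in
  0 < rho <= 1 -> (forall j x y, D x y -> holo2 (ge j) x y) ->
  (forall x y, D x y -> normc x ^+ 2 + normc y ^+ 2 = 1 ->
     \sum_j ge j x y * (ge j x y)^* = 1) ->
  exists (a e : R) (q : {poly C}) (p : 'I_N -> {poly C}),
    [/\ 0 < e < rho / 2, a ^+ 2 + e ^+ 2 = 1, normc (a%:C - 1) < rho ^+ 2 / 32, q != 0 &
        forall j t, normc t = e -> q.[t] * ge j a%:C t = (p j).[t]].
Proof.
move=> D /andP[rho0 rho1] holo sph.
pose eta := rho ^+ 2 / 32.
have eta0 : 0 < eta by rewrite divr_gt0// exprn_gt0.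
have etar : eta <= rho / 32 by rewrite ler_pM2r ?invr_gt0// expr2 ler_piMl// ltW.
(* A quarter of the bidisc's width keeps the points (a, t), |t| = e, together with the pieces of
   tangent lines of length rho / 2, inside [D]. *)
pose e := eta / 4.
have e0 : 0 < e by rewrite divr_gt0.
have er : e <= rho / 128 by rewrite /e; clear - etar; lra.
have e2 : e ^+ 2 <= eta / 16.
  by rewrite /e expr2; clear - eta0 etar rho1; nra.
pose a := Num.sqrt (1 - e ^+ 2).
have a2 : a ^+ 2 = 1 - e ^+ 2.
  by rewrite sqr_sqrtr// subr_ge0 (le_trans e2)//; clear - etar rho1; lra.
have a0 : 0 <= a by exact: sqrtr_ge0.
have a1 : a <= 1.
  have := sqr_ge0 e; rewrite !expr2 in a2 *; clear - a0 a2; nra.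
have a1e : 1 - a <= e ^+ 2 by rewrite expr2 in a2; clear - a0 a1 a2; nra.
have ahalf : 1 / 2 <= a by clear - a1e e2 etar rho1; lra.
have apos : 0 < a by clear - ahalf; lra.
have aC0 : a%:C != 0 :> C by rewrite -normc_gt0 normc_real gtr0_norm.
have aae : a ^+ 2 + e ^+ 2 = 1 by rewrite a2 subrK.
have a1C : normc (a%:C - 1) = 1 - a.
  by rewrite -[X in _ - X]/((1 : R)%:C) -rmorphB normc_real distrC ger0_norm// subr_ge0.
have dom t (u : R) s : normc t = e -> 1 - eta / 4 <= u <= 1 -> normc s <= rho / 2 ->
    D (u%:C * a%:C + s * - t^*) (u%:C * t + s * a%:C).
  move=> ht /andP[u1 u2] hs.
  have u0 : 0 <= u by clear - u1 etar rho1; lra.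
  have s0 := normc_ge0 s.
  have m1 : normc s * e <= eta / 8.
    have : normc s * e <= rho / 2 * e by rewrite ler_wpM2r// ltW.
    by rewrite /e; clear - rho1 eta0; nra.
  split.
    have -> : u%:C * a%:C + s * - t^* - 1 = (a%:C - 1) + (u - 1)%:C * a%:C + s * - t^*.
      by rewrite rmorphB rmorph1; ring.
    rewrite (le_lt_trans (le_normcD _ _))//.
    rewrite (le_lt_trans (lerD (le_normcD _ _) (lexx _)))//.
    rewrite !normcM normcN normc_conj ht a1C !normc_real distrC ger0_norm ?subr_ge0// ger0_norm//.
    have : (1 - u) * a <= 1 - u by rewrite ler_piMr// subr_ge0.
    rewrite -/eta; clear - a1e e2 u1 m1 eta0; lra.
  rewrite (le_lt_trans (le_normcD _ _))// !normcM ht !normc_real ger0_norm// ger0_norm//.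
  have : u * e <= e by rewrite ler_piMl// ltW.
  have : normc s * a <= normc s by rewrite ler_piMr.
  clear - hs er rho0; lra.
have tangent t s : normc t = e -> normc s < rho / 2 ->
    \sum_j ge j (a%:C + s * - t^*) (t + s * a%:C) * (ge j a%:C t)^* = 1.
  move=> ht; have k0 : 0 < eta / 4 by exact: e0.
  have r20 : 0 < rho / 2 by rewrite divr_gt0.
  apply: (@sphere_polarization _ N ge D a (eta / 4) (rho / 2)) => //; first by rewrite ht.
  by move=> u z; exact: dom.
(* The circle |y| = r1 on a tangent line encloses y = t, and on it the parameter (y - t) / a stays
   below rho / 2. *)
pose r1 := rho / 8.
have r10 : 0 < r1 by rewrite divr_gt0.
(* The origin is moved to (1 / a, 0), the common point of the tangent lines. *)
pose G j x y := ge j ((a^-1)%:C + x) y.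
have ia : normc ((a^-1)%:C - 1) <= eta / 8.
  have -> : (a^-1)%:C - 1 = ((1 - a) / a)%:C.
    rewrite -[X in _ - X]/((1 : R)%:C) -rmorphB; congr _%:C; field; exact: lt0r_neq0.
  rewrite normc_real ger0_norm ?divr_ge0 ?subr_ge0// ler_pdivrMr//.
  clear - a1e e2 ahalf eta0; nra.
have DG x y : normc x <= eta / 2 -> normc y < rho -> D ((a^-1)%:C + x) y.
  move=> hx hy; split => //; rewrite addrAC (le_lt_trans (le_normcD _ _))//.
  rewrite -/eta; clear - ia hx eta0; lra.
have hG j x y : normc x <= eta / 2 -> normc y < rho -> holo2 (G j) x y.
  move=> hx hy; have [c1 d1] := holo j _ _ (DG x y hx hy); split.
    apply: (@clim_comp2 _ _ _ _ (fun p => (a^-1)%:C + p.1) snd (ge j)) => //.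
      by apply: climD; [exact: clim_cst|exact: clim_fst].
    exact: clim_snd.
  move=> u v; apply: cdiff_eq (d1 u v); apply: filterE => s.
  by rewrite /G addrA.
have jets (kj : nat * 'I_N) : exists P : {poly C}, forall tau, normc tau * r1 < eta / 2 ->
    coef (fun s => G kj.2 (s * tau) s) r1 kj.1 = P.[tau].
  apply: (@jet_polynomial _ (G kj.2) (eta / 2) r1 rho) => //.
    by rewrite divr_gt0.
    by rewrite /r1; clear - rho0; lra.
  by move=> x y; exact: hG.
have [P hP] := choice jets.
(* Substituting the slope tau = - conj t / a turns the jets into polynomials in conj t. *)
pose PP k j := P (k, j) \Po ((- (a^-1)%:C)%:P * 'X).
pose tau (t : C) := - (a^-1)%:C * t^*.
have htau t : normc t = e -> normc (tau t) <= eta / 2.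
  move=> ht; rewrite normcM normcN normc_real normc_conj ht ger0_norm ?invr_ge0//.
  rewrite mulrC ler_pdivrMr// /e; clear - ahalf eta0; nra.
have htau1 t : normc t = e -> normc (tau t) * r1 < eta / 2.
  move=> /htau h; have t0 := normc_ge0 (tau t); rewrite /r1; clear - h t0 rho0 rho1 eta0; nra.
have PPE k j t : normc t = e -> (PP k j).[t^*] = coef (fun s => G j (s * tau t) s) r1 k.
  move=> ht; rewrite (hP (k, j))//=; last exact: htau1.
  by rewrite /PP horner_comp !hornerE.
(* The point of the tangent line with second coordinate s, in its two parametrizations: from (1 / a,
   0) and from (a, t). They agree because a^2 + |t|^2 = 1. *)
have line t s : normc t = e ->
    (a^-1)%:C + s * tau t = a%:C + (s - t) / a%:C * - t^* /\ s = t + (s - t) / a%:C * a%:C.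
  move=> ht; have ttE : t * t^* = 1 - a%:C ^+ 2.
    by rewrite normc_mulJ ht -rmorphXn -[X in _ = X - _]/((1 : R)%:C) -rmorphB a2; congr _%:C; clear; lra.
  split; last by rewrite divfK// addrC subrK.
  apply: (mulIf aC0); rewrite /tau (_ : (a^-1)%:C = a%:C^-1); last by rewrite fmorphV.
  have -> : (a%:C^-1 + s * (- a%:C^-1 * t^*)) * a%:C = 1 - s * t^* by field.
  have -> : (a%:C + (s - t) / a%:C * - t^*) * a%:C = a%:C ^+ 2 - s * t^* + t * t^* by field.
  by rewrite ttE; ring.
have smallG t s : normc t = e -> normc s <= r1 -> normc (s * tau t) <= eta / 2 /\ normc s < rho.
  move=> ht hs; have r1rho : r1 < rho by rewrite /r1; clear - rho0; lra.
  split; last exact: le_lt_trans r1rho.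
  have r11 : r1 <= 1 by rewrite (le_trans (ltW r1rho)).
  by rewrite normcM -[X in _ <= X]mul1r ler_pM ?normc_ge0// ?htau// (le_trans hs).
have dL t j s : normc t = e -> normc s <= r1 -> cdiff (fun s => G j (s * tau t) s) s.
  move=> ht hs; apply: (@cdiff_eq _ (fun s => G j (0 + s * tau t) (0 + s * 1))).
    by apply: filterE => z; rewrite !add0r mulr1.
  by apply: holo2_line; rewrite !add0r mulr1; have [h1 h2] := smallG t s ht hs; exact: hG.
have e_r1 : e < r1 by rewrite /r1; clear - er rho0; lra.
have onL t s : normc t = e -> normc s <= r1 ->
    \sum_j G j (s * tau t) s * (ge j a%:C t)^* = 1.
  move=> ht hs; have [l1 l2] := line t s ht.
  rewrite -[RHS](@tangent t ((s - t) / a%:C) ht); last first.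
    rewrite normcM normcV normc_real gtr0_norm// ltr_pdivrMr//.
    have := le_normcD s (- t); rewrite normcN ht.
    rewrite /r1 in hs; clear - hs er rho0 ahalf; nra.
  by apply: eq_bigr => j _; rewrite -l2 /G l1.
have [||q q0 [p hqp]] := @rational_on_circle R N PP (fun t j => ge j a%:C t) e e0.
- move=> t k ht.
  rewrite -[LHS]conjcK rmorph_sum.
  rewrite (_ : \sum_j _ = \sum_j (PP k j).[t^*] * (ge j a%:C t)^*); last first.
    by apply: eq_bigr => j _; rewrite rmorphM/= conjcK mulrC.
  rewrite (_ : \sum_j _ = coef (fun s => \sum_j G j (s * tau t) s * (ge j a%:C t)^*) r1 k); last first.
    rewrite coef_sum//; first by apply: eq_bigr => j _; rewrite PPE.
    by move=> j z hz; apply: cdiff_ccont; apply: dL; rewrite ?hz.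
  rewrite (_ : coef _ r1 k = coef (fun=> 1) r1 k); last first.
    by apply: eq_mean => s hs; rewrite onL// normc_scale// ltW.
  by rewrite coef_cst// mul1r conjc_nat.
(* If [u] kills all the jets, the pairing with [u] vanishes along the line, in particular at s = t,
   which is the point (a, t). *)
- move=> t u ht hu.
  have [l1 _] := line t t ht; rewrite subrr !mul0r addr0 in l1.
  rewrite (_ : \sum_j _ = \sum_j G j (t * tau t) t * u j); last by rewrite /G l1.
  apply: (@coef_eq0 _ (fun s => \sum_j G j (s * tau t) s * u j) r1); first by rewrite ht.
    by move=> z hz; apply: cdiff_sum => j; apply: cdiffM; [exact: dL|exact: cdiff_cst].
  move=> k; rewrite coef_sum//; last first.
    by move=> j z hz; apply: cdiff_ccont; apply: dL; rewrite ?hz.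
  by rewrite -[RHS](hu k); apply: eq_bigr => j _; rewrite PPE.
exists a, e, q, p; split => //.
- by rewrite e0; clear - er rho0; lra.
- rewrite a1C -/eta; clear - a1e e2 eta0; lra.
- by move=> j t; exact: hqp.
Qed.

(** On the slice x = a the closed unit ball is |t| <= e and the outer ball is |t| < T. The rational
    expression found on |t| = e spreads over this disc and supplies the limits at |t| = T to which
    properness applies. *)
Theorem shell_map_false N (g : 'I_N -> C -> C -> C) (b R0 : R) :
  `|1 - b| < R0 ->
  (forall j x y, shell b R0 x y -> holo2 (g j) x y) ->
  (forall x y, shell b R0 x y -> 1 < nsq (fun j => g j x y)) ->
  (forall (x0 : R) (X Y : R -> C) (w : 'I_N -> R -> C), x0 < 1 ->
     (forall x, x0 <= x <= 1 -> [/\ rcont X x, rcont Y x & forall j, rcont (w j) x]) ->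
     (forall x, x0 <= x -> x < 1 -> shell b R0 (X x) (Y x) /\ forall j, g j (X x) (Y x) = w j x) ->
     ~ shell b R0 (X 1) (Y 1) -> nsq (fun j => w j 1) <= 1) ->
  False.
Proof.
move=> hb hg g1 hprop.
have [rho [ge [/andP[rho0 rho1] holo ins agree sph]]] := shell_map_extension hb hg g1 hprop.
have rho01 : 0 < rho <= 1 by rewrite rho0.
have [a [e [q [p [/andP[e0 er] ae a1 q0 hqp]]]]] := sphere_map_rational rho01 holo sph.
have Da t : normc t < rho -> bidisc (rho ^+ 2 / 32) rho a%:C t by move=> ht; split.
have abE : normc (a%:C - b%:C) ^+ 2 = (a - b) ^+ 2.
  by rewrite -rmorphB normc_real real_normK ?num_real.
have T20 : rho ^+ 2 <= R0 ^+ 2 - (a - b) ^+ 2.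
  rewrite leNgt; apply/negP => h.
  (* Were T < rho, the point (a, sqrt m) would lie in the bidisc but not in the outer ball; the
     maximum with 0 makes the square root meaningful. *)
  pose m := Num.max 0 (R0 ^+ 2 - (a - b) ^+ 2).
  have m0 : 0 <= m by rewrite le_max lexx.
  have mr : m < rho ^+ 2 by rewrite gt_max h exprn_gt0.
  have m1 : R0 ^+ 2 - (a - b) ^+ 2 <= m by rewrite le_max lexx orbT.
  have sm : normc ((Num.sqrt m)%:C : C) = Num.sqrt m by rewrite normc_real ger0_norm// sqrtr_ge0.
  have := ins _ _ (Da (Num.sqrt m)%:C _); rewrite sm abE sqr_sqrtr//.
  have -> : Num.sqrt m < rho by rewrite -(ltr_pXn2r (n := 2))// ?nnegrE ?sqrtr_ge0 ?(ltW rho0)// sqr_sqrtr.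
  by move=> /(_ isT); clear - m1; lra.
pose T := Num.sqrt (R0 ^+ 2 - (a - b) ^+ 2).
have T2 : T ^+ 2 = R0 ^+ 2 - (a - b) ^+ 2.
  by rewrite sqr_sqrtr// (le_trans _ T20)// sqr_ge0.
have Tr : rho <= T.
  by rewrite -(ler_pXn2r (n := 2))// ?nnegrE ?sqrtr_ge0 ?(ltW rho0)// T2.
have T0 : 0 < T by exact: lt_le_trans Tr.
have eT : e < T by clear - er Tr rho0; lra.
have shellT t : e < normc t -> normc t < T -> shell b R0 a%:C t.
  move=> h1 h2; split; last first.
    rewrite abE; have : normc t ^+ 2 < T ^+ 2 by rewrite ltr_pXn2r// nnegrE ?normc_ge0// ltW.
    by rewrite T2; clear; lra.
  rewrite normc_real real_normK ?num_real// -ae ltrD2l ltr_pXn2r// nnegrE ?normc_ge0// ltW//.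
(* The extension near the centre glued to g further out; both are defined and agree for e < |t| <
   rho. *)
pose h j t := if normc t < rho / 2 then ge j a%:C t else g j a%:C t.
have geg j t : e < normc t -> normc t < rho -> ge j a%:C t = g j a%:C t.
  move=> h1 h2; apply: agree; first exact: Da.
  by have [] := shellT t h1 (lt_le_trans h2 Tr).
have hgE j t : e < normc t -> normc t < T -> h j t = g j a%:C t.
  move=> h1 h2; rewrite /h; case: ifPn => // h3; apply: geg => //.
  by clear - h3 rho0; lra.
have dh j t : normc t < T -> cdiff (h j) t.
  move=> tT; have [t2|t2] := ltrP (normc t) (rho / 2).
    apply: (@cdiff_eq _ (ge j a%:C)).
      have : \forall w \near cnb t, normc (w - 0) < rho / 2 by apply: cnb_open; rewrite subr0.
      by apply: filterS => w; rewrite subr0 /h => ->.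
    by apply: holo2_snd; apply: holo; apply: Da; clear - t2 rho0; lra.
  have et : e < normc t by exact: lt_le_trans t2.
  apply: (@cdiff_eq _ (g j a%:C)); last by apply: holo2_snd; apply: hg; exact: shellT.
  have n1 : \forall w \near cnb t, normc (w - 0) < T by apply: cnb_open; rewrite subr0.
  have n2 : \forall w \near cnb t, normc (w - t) < normc t - e by apply: cnb_ball; rewrite subr_gt0.
  apply: filterS2 n1 n2 => w; rewrite subr0 => w1 w2; rewrite hgE//.
  have := le_normcD (t - w) w; rewrite subrK normcB; clear - w2; lra.
apply: (@rational_disc_false _ N h q p e T) => //.
- by move=> j t /(dh j)/cdiff_ccont.
- move=> j t tT; apply/eqP; rewrite -subr_eq0; apply/eqP.
  apply: (@identity_disc _ (fun t => q.[t] * h j t - (p j).[t]) T e) => //.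
    move=> z zT; apply: cdiffB; last exact: cdiff_horner.
    by apply: cdiffM; [exact: cdiff_horner|exact: dh].
  by move=> z ze; rewrite /h ze er hqp// subrr.
- move=> t h1 h2; have := g1 _ _ (shellT t h1 h2).
  by rewrite /nsq; under [X in _ -> _ < X]eq_bigr do rewrite hgE//.
move=> t tT qt.
(* Near a boundary point that is not a pole, the radius meets no pole and stays outside the unit
   ball. *)
have qn : \forall x \near (1 : R), q.[x%:C * t] != 0 /\ e / T < x.
  have cx : clim (nbhs (1 : R)) (fun x : R => q.[x%:C * t]) q.[1%:C * t].
    apply: (@clim_comp _ _ _ _ _ (fun z => q.[z])); last exact: ccont_horner.
    by apply: climM; [exact: nbhs_real_clim|exact: clim_cst].
  have q1 : 0 < normc q.[1%:C * t] by rewrite normc_gt0 rmorph1 mul1r.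
  near=> x; split.
    by apply: (@normcV_lt _ _ q.[1%:C * t]); near: x; exact: cx.
  by near: x; apply: lt_nbhsr; rewrite ltr_pdivrMr// mul1r.
have [/= d d0 hd] : nbhs_ball (1 : R) (fun x => q.[x%:C * t] != 0 /\ e / T < x) by exact/nbhs_ballP.
have in_d x : 1 - d / 2 <= x <= 1 -> q.[x%:C * t] != 0 /\ e / T < x.
  move=> /andP[x1 x2]; apply: hd; rewrite /ball/= ger0_norm ?subr_ge0//.
  by clear - x1 d0; lra.
(* The path (a, x t) leaves the shell through the outer sphere at x = 1. *)
have := hprop (1 - d / 2) (fun=> a%:C) (fun x => x%:C * t) (fun j x => (p j).[x%:C * t] / q.[x%:C * t]).
rewrite rmorph1 mul1r; apply.
- by rewrite gtrBl divr_gt0.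
- move=> x /in_d[qx _].
  have cx : rcont (fun x : R => x%:C * t) x by apply: climM; [exact: nbhs_real_clim|exact: clim_cst].
  split => // [|j]; first exact: clim_cst.
  apply: climM; first by apply: clim_comp cx _; exact: ccont_horner.
  by apply: climV => //; apply: clim_comp cx _; exact: ccont_horner.
- move=> x x1 x2; have [qx ex] : q.[x%:C * t] != 0 /\ e / T < x by apply: in_d; rewrite x1 ltW.
  have x0 : 0 < x by apply: lt_trans ex; rewrite divr_gt0.
  have nx : normc (x%:C * t) = x * T by rewrite normcM normc_real gtr0_norm// tT.
  have n1 : e < normc (x%:C * t) by rewrite nx -ltr_pdivrMr.
  have n2 : normc (x%:C * t) < T by rewrite nx gtr_pMl.
  split; first exact: shellT.
  move=> j; rewrite -hgE//; apply: (mulfI qx); rewrite mulrCA divff// mulr1.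
  apply/eqP; rewrite -subr_eq0; apply/eqP.
  apply: (@identity_disc _ (fun t => q.[t] * h j t - (p j).[t]) T e) => //.
    move=> z zT; apply: cdiffB; last exact: cdiff_horner.
    by apply: cdiffM; [exact: cdiff_horner|exact: dh].
  by move=> z ze; rewrite /h ze er hqp// subrr.
by move=> [_]; rewrite abE tT T2 addrC subrK ltxx.
Unshelve. all: by end_near. Qed.

End ShellMapsRational.

(** * Proper maps between balls *)

Section RowTopology.
Variable R : realType.
Local Notation C := R[i].
(** The radii of library balls are elements of [R[i]]; a positive one has zero imaginary part, so
    its real part serves as real radius. *)
Lemma nbhs_cnb (z : C) : nbhs z = cnb z.
Proof.
rewrite predeqE => A; split.
  move=> /nbhs_ballP[e /= e0 he].
  have [e1 e2] : Im e = 0 /\ 0 < Re e by move: e0; rewrite ltcE/= => /andP[/eqP -> ->].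
  exists (Re e) => // w hw; apply: he.
  rewrite /ball/= normc_def ltcE/= e1 eqxx /=.
  by rewrite normcB in hw; case: (z - w) hw.
move=> [e e0 he]; apply/nbhs_ballP; exists e%:C; first by rewrite /= ltcR.
move=> w; rewrite /ball/= normc_def ltcR => hw; apply: he.
by rewrite normcB; case: (z - w) hw.
Qed.

Lemma nbhs_rowP n (z : 'rV[C]_n) (A : set 'rV[C]_n) : nbhs z A <->
  exists2 e : R, 0 < e & forall w : 'rV[C]_n, (forall j, normc (w 0 j - z 0 j) < e) -> A w.
Proof.
split.
  case=> P /= hP PA.
  have /choice[e he] : forall j, exists e : R, 0 < e /\ forall w, normc (w - z 0 j) < e -> P 0 j w.
    by move=> j; have := hP 0 j; rewrite nbhs_cnb => -[e e0 h]; exists e.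
  pose m := \big[Num.min/1]_j e j.
  exists m; first by apply: lt_bigmin => // j _; case: (he j).
  move=> w hw; apply: PA => i j; rewrite (ord1 i); case: (he j) => _; apply.
  by apply: lt_le_trans (hw j) _; exact: bigmin_le.
move=> [e e0 h]; exists (fun i j w => normc (w - z i j) < e).
  by move=> i j; rewrite nbhs_cnb; exact: cnb_ball.
by move=> w hw; apply: h => j; exact: hw.
Qed.

Lemma differentiable_coord_cont n N (f : 'rV[C]_n -> 'rV[C]_N) z j : differentiable f z ->
  clim (nbhs z) (fun w => f w 0 j) (f z 0 j).
Proof.
move=> /differentiable_continuous h e e0.
have : nbhs (f z) [set w : 'rV[C]_N | normc (w 0 j - f z 0 j) < e].
  by apply/nbhs_rowP; exists e => // w; exact.
exact: h.
Qed.

Lemma differentiable_coord_line n N (f : 'rV[C]_n -> 'rV[C]_N) z v j : differentiable f z ->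
  cdiff (fun s => f (z + s *: v) 0 j) 0.
Proof.
move=> /(@diff_derivable _ _ _ f z v) h.
move: h; rewrite /derivable => /cvg_ex[l hl].
exists (fun s => if s == 0 then l 0 j else s^-1 * (f (z + s *: v) 0 j - f z 0 j)).
  rewrite /ccont eqxx => e e0.
  have : nbhs l [set w : 'rV[C]_N | normc (w 0 j - l 0 j) < e] by apply/nbhs_rowP; exists e => // w; exact.
  move=> /hl H.
  have {H} : dnbhs (0 : C) [set s | normc ((s^-1 *: (f (s *: v + z) - f z)) 0 j - l 0 j) < e] by exact: H.
  rewrite /dnbhs /within /= nbhs_cnb => -[d d0 hd]; exists d => // s hs.
  case: eqVneq => [_|s0]; first by rewrite subrr normc0.
  by have := hd s hs s0; rewrite !mxE [s *: v + z]addrC.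
apply: filterE => s; rewrite scale0r addr0 subr0.
case: eqVneq => [->|s0]; first by rewrite scale0r addr0 mulr0 addr0.
by rewrite mulrAC mulVf// mul1r [RHS]addrC subrK.
Qed.

Definition nsqv n (z : 'rV[C]_n) := nsq (fun j => z 0 j).

Lemma coord_clim n (z : 'rV[C]_n) j : clim (nbhs z) (fun w => w 0 j) (z 0 j).
Proof. by move=> e e0; apply/nbhs_rowP; exists e => // w; exact. Qed.

Lemma clim_row n (T : Type) (F : set_system T) {FF : Filter F} (f : T -> 'rV[C]_n) (l : 'rV[C]_n) :
  (forall j, clim F (fun t => f t 0 j) (l 0 j)) -> f @ F `=>` nbhs l.
Proof.
move=> h A /nbhs_rowP[e e0 hA].
have : \forall t \near F, forall j, normc (f t 0 j - l 0 j) < e by apply: filter_forall => j; exact: h.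
by apply: filterS => t; exact: hA.
Qed.

Lemma nsqv_clim n (c z : 'rV[C]_n) : clim (nbhs z) (fun w => (nsqv (w - c))%:C) (nsqv (z - c))%:C.
Proof.
apply: clim_nsq => j.
apply: (@clim_near _ _ _ _ (fun w : 'rV[C]_n => w 0 j - c 0 j)).
  by apply: filterE => w; rewrite !mxE.
by rewrite !mxE; apply: climB; [exact: coord_clim|exact: clim_cst].
Qed.

Lemma enorm_lt n (z : 'rV[C]_n) (r : R) : 0 < r -> (enorm z < r) = (nsqv z < r ^+ 2).
Proof.
move=> r0; rewrite -(ltr_pXn2r (n := 2))// ?nnegrE ?sqrtr_ge0 ?(ltW r0)//.
by rewrite sqr_sqrtr// nsq_ge0.
Qed.

Lemma closure_eball n (c z : 'rV[C]_n) (r : R) : 0 < r ->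
  closure (eball c r) z <-> nsqv (z - c) <= r ^+ 2.
Proof.
move=> r0; split.
  move=> h; rewrite leNgt; apply/negP => lt.
  have d0 : 0 < nsqv (z - c) - r ^+ 2 by rewrite subr_gt0.
  have [w [/= hw1 hw2]] := h _ (@nsqv_clim n c z _ d0).
  move: hw2; rewrite -rmorphB normc_real ltr_norml => /andP[+ _].
  by move: hw1; rewrite /eball/= enorm_lt//; clear; lra.
move=> h B /nbhs_rowP[e e0 hB].
pose M := 1 + \sum_j normc ((z - c) 0 j).
have M0 : 0 < M by rewrite ltr_pwDl// sumr_ge0// => j _; exact: normc_ge0.
(* Contracting towards the centre by 1 - s enters the open ball and moves each coordinate by less
   than [e]. *)
pose s := Num.min (e / M / 2) (1 / 2).
have s0 : 0 < s by rewrite lt_min !divr_gt0.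
have s1 : s <= 1 / 2 by rewrite ge_min lexx orbT.
have sM : s * M < e.
  have : s <= e / M / 2 by rewrite ge_min lexx.
  by rewrite mulrAC ler_pdivlMr// => /le_lt_trans; apply; rewrite ltr_pdivrMr// ltr_pMr// ltr1n.
exists (c + (1 - s)%:C *: (z - c)); split.
  rewrite /eball/= enorm_lt// addrAC subrr add0r.
  have -> : nsqv ((1 - s)%:C *: (z - c)) = (1 - s) ^+ 2 * nsqv (z - c).
    rewrite -[(1 - s) ^+ 2]real_normK ?num_real// -normc_real -nsq_scale.
    by apply: eq_bigr => j _; rewrite mxE.
  have r2 : 0 < r ^+ 2 by rewrite exprn_gt0.
  have n0 : 0 <= nsqv (z - c) by exact: nsq_ge0.
  apply: (@le_lt_trans _ _ ((1 - s) ^+ 2 * r ^+ 2)); first by rewrite ler_wpM2l// sqr_ge0.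
  rewrite gtr_pMl// expr2; clear - s0 s1; nra.
apply: hB => j.
have -> : (c + (1 - s)%:C *: (z - c)) 0 j - z 0 j = - s%:C * (z - c) 0 j.
  by rewrite !mxE rmorphB rmorph1; ring.
rewrite normcM normcN normc_real gtr0_norm// (le_lt_trans _ sM)// ler_wpM2l ?(ltW s0)//.
rewrite /M (bigD1 j)//= addrCA lerDl addr_ge0// sumr_ge0// => i _; exact: normc_ge0.
Qed.

Lemma unit_ballE n : unit_ball R n = eball 0 1.
Proof. by rewrite predeqE => z; rewrite /unit_ball /eball/= subr0. Qed.

Lemma closure_unit_ball n (z : 'rV[C]_n) : closure (unit_ball R n) z <-> nsqv z <= 1.
Proof. by rewrite unit_ballE closure_eball// subr0 expr1n. Qed.

(** The Euclidean triangle inequality, from a weighted coordinatewise estimate instead of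
    Cauchy-Schwarz. *)
Lemma nsqvD_lt n (u v : 'rV[C]_n) (p q : R) : 0 < p -> 0 < q ->
  nsqv u < p ^+ 2 -> nsqv v <= q ^+ 2 -> nsqv (u + v) < (p + q) ^+ 2.
Proof.
move=> p0 q0 hu hv.
(* With these weights equality holds when the two norms are in the ratio p : q. *)
apply: (@le_lt_trans _ _ ((1 + q / p) * nsqv u + (1 + p / q) * nsqv v)).
  rewrite /nsqv /nsq !mulr_sumr -big_split/=; apply: ler_sum => j _.
  rewrite mxE; set a := normc (u 0 j); set b := normc (v 0 j).
  apply: (@le_trans _ _ ((a + b) ^+ 2)).
    by rewrite ler_pXn2r// ?nnegrE ?addr_ge0 ?normc_ge0// le_normcD.
  rewrite -subr_ge0 (_ : _ - _ = (q * a - p * b) ^+ 2 / (p * q)).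
    by rewrite divr_ge0 ?sqr_ge0// mulr_ge0// ltW.
  by field; rewrite !gt_eqF.
have -> : (p + q) ^+ 2 = (1 + q / p) * p ^+ 2 + (1 + p / q) * q ^+ 2.
  by field; rewrite !gt_eqF.
have a0 : 0 < 1 + q / p by rewrite addr_gt0// divr_gt0.
have b0 : 0 < 1 + p / q by rewrite addr_gt0// divr_gt0.
by apply: ltr_leD; [rewrite ltr_pM2l|rewrite ler_pM2l].
Qed.

Lemma compact_coord_bounded n (K : set 'rV[C]_n) j : compact K ->
  exists B : R, forall z, K z -> normc (z 0 j) <= B.
Proof.
move=> /compact_near_coveringP/(_ _ (pinfty_nbhs R) (fun B z => normc (z 0 j) <= B) _) H.
have {}H : \forall B \near +oo, K `<=` (fun z => normc (z 0 j) <= B).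
  apply: H => z _.
  exists ([set w : 'rV[C]_n | normc (w 0 j - z 0 j) < 1], [set B | normc (z 0 j) + 1 <= B]).
    by split => /=; [exact: coord_clim|exact: nbhs_pinfty_ge (num_real _)].
  move=> [w B] /= [hw hB]; apply: le_trans hB.
  by have := le_normcD (w 0 j - z 0 j) (z 0 j); rewrite subrK; clear - hw; lra.
near (pinfty_nbhs R) => B.
exists B; have : K `<=` (fun z => normc (z 0 j) <= B) by near: B.
by move=> h z /h.
Unshelve. all: by end_near. Qed.

Lemma pair_sum n (i0 i1 : 'I_n) (x y : C) (F : 'I_n -> C -> C) : i0 != i1 -> (forall j, F j 0 = 0) ->
  \sum_j F j (if j == i0 then x else if j == i1 then y else 0) = F i0 x + F i1 y.
Proof.
move=> i01 F0; rewrite (bigD1 i0)//= eqxx; congr (_ + _).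
have i10 : i1 != i0 by rewrite eq_sym.
rewrite (bigD1 i1)//= (negbTE i10) eqxx big1 ?addr0//.
by move=> j /andP[/negbTE -> /negbTE ->].
Qed.

(** [e1] points from c towards the origin, so that the origin gets a nonnegative first coordinate
    when c becomes the centre; it is arbitrary when c = 0. *)
Lemma orthonormal_pair n (c : 'rV[C]_n) : (2 <= n)%N -> exists e1 e2 : 'rV[C]_n,
  c = - (enorm c)%:C *: e1 /\
  forall x y, nsqv (x *: e1 + y *: e2) = normc x ^+ 2 + normc y ^+ 2.
Proof.
move=> hn; pose i0 : 'I_n := Ordinal (ltnW hn); pose i1 : 'I_n := Ordinal hn.
have i01 : i0 != i1 by [].
pose dv x y : 'rV[C]_n := \row_j (if j == i0 then x else if j == i1 then y else 0).
have ndv x y : nsqv (dv x y) = normc x ^+ 2 + normc y ^+ 2.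
  apply: complexI; rewrite -nsqE rmorphD/= -!normc_mulJ.
  rewrite -(@pair_sum n i0 i1 x y (fun _ z => z * z^*))//; last by move=> j; rewrite mul0r.
  by apply: eq_bigr => j _; rewrite mxE.
have [e1 [ce1 ne1]] : exists e1 : 'rV[C]_n, c = - (enorm c)%:C *: e1 /\ nsqv e1 = 1.
  have [c0|c0] := eqVneq (enorm c) 0.
    exists (dv 1 0); split; last by rewrite ndv normc1 normc0 expr1n expr0n addr0.
    apply/rowP => j; rewrite c0 oppr0 scale0r mxE; apply/eqP; rewrite -normc_eq0 -sqrf_eq0.
    have : nsqv c == 0 by rewrite -(@sqr_sqrtr _ (nsqv c)) ?nsq_ge0// sqrf_eq0; apply/eqP.
    rewrite psumr_eq0 => [/allP/(_ j (mem_index_enum j))//|? _]; exact: sqr_ge0.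
  have cp : 0 < enorm c by rewrite lt_def c0 sqrtr_ge0.
  exists (- (enorm c)^-1%:C *: c); split.
    by rewrite scalerA mulrNN -rmorphM/= divff// scale1r.
  have -> : nsqv (- (enorm c)^-1%:C *: c) = normc (- (enorm c)^-1%:C) ^+ 2 * nsqv c.
    by rewrite -nsq_scale; apply: eq_bigr => j _; rewrite mxE.
  rewrite normcN normc_real ger0_norm ?invr_ge0 ?sqrtr_ge0// -(@sqr_sqrtr _ (nsqv c)) ?nsq_ge0//.
  by rewrite -exprMn mulVf// expr1n.
have [e2 [oe2 ne2]] : exists e2 : 'rV[C]_n, \sum_j e1 0 j * (e2 0 j)^* = 0 /\ nsqv e2 = 1.
  pose a := e1 0 i0; pose b := e1 0 i1.
  have odv x y : \sum_j e1 0 j * (dv x y 0 j)^* = a * x^* + b * y^*.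
    rewrite -(@pair_sum n i0 i1 x y (fun j z => e1 0 j * z^*))//; last by move=> j; rewrite conjc0 mulr0.
    by apply: eq_bigr => j _; rewrite mxE.
  pose m := normc b ^+ 2 + normc a ^+ 2.
  have [m0|m0] := eqVneq m 0.
    exists (dv 1 0); split; last by rewrite ndv normc1 normc0 expr1n expr0n addr0.
    have a0 : a = 0.
      apply/eqP; rewrite -normc_eq0 -sqrf_eq0; apply/eqP.
      have := sqr_ge0 (normc a); have := sqr_ge0 (normc b); rewrite /m in m0; clear - m0; lra.
    by rewrite odv a0 mul0r conjc0 mulr0 addr0.
  have mp : 0 <= m by rewrite addr_ge0// sqr_ge0.
  pose k : C := (Num.sqrt m)^-1%:C.
  (* Among vectors supported on two coordinates, (- conj b, conj a) is orthogonal to [e1], whatever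
     its other entries are. *)
  exists (dv (k * - b^*) (k * a^*)); split.
    rewrite odv !rmorphM rmorphN/= !conjcK; ring.
  rewrite ndv !normcM normcN !normc_conj normc_real ger0_norm ?invr_ge0 ?sqrtr_ge0//.
  by rewrite !exprMn exprVn sqr_sqrtr// -mulrDr mulVf.
exists e1, e2; split => // x y.
apply: complexI; rewrite -nsqE rmorphD/= -!normc_mulJ.
have E1 : \sum_j e1 0 j * (e1 0 j)^* = 1 by rewrite nsqE -[nsq _]/(nsqv e1) ne1.
have E2 : \sum_j e2 0 j * (e2 0 j)^* = 1 by rewrite nsqE -[nsq _]/(nsqv e2) ne2.
have oe1 : \sum_j e2 0 j * (e1 0 j)^* = 0.
  have : (\sum_j e1 0 j * (e2 0 j)^*)^* = 0 by rewrite oe2 conjc0.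
  rewrite rmorph_sum => E; rewrite -[RHS]E.
  by apply: eq_bigr => j _; rewrite rmorphM/= conjcK mulrC.
have -> : x * x^* + y * y^* = x * x^* * \sum_j e1 0 j * (e1 0 j)^* + x * y^* * \sum_j e1 0 j * (e2 0 j)^* +
   y * x^* * \sum_j e2 0 j * (e1 0 j)^* + y * y^* * \sum_j e2 0 j * (e2 0 j)^*.
  by rewrite E1 E2 oe2 oe1; ring.
rewrite !mulr_sumr -!big_split/=; apply: eq_bigr => j _.
by rewrite !mxE rmorphD !rmorphM/=; ring.
Qed.

End RowTopology.

Section ProperMaps.
Variable R : realType.
Local Notation C := R[i].

Lemma no_proper_map_from_exterior n N (U : set 'rV[C]_N) (f : 'rV[C]_n -> 'rV[C]_N) : (2 <= n)%N ->
  U `<=` unit_ball R N ->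
  holomorphic_on (~` closure (unit_ball R n)) f ->
  ~ proper_map (~` closure (unit_ball R n)) U f.
Proof.
move=> hn UB hf [fU _ fprop].
pose i0 : 'I_n := Ordinal (ltnW hn); pose i1 : 'I_n := Ordinal hn.
(* One coordinate of the line is constantly 2, so the line misses the closed unit ball. *)
pose z0 : 'rV[C]_n := \row_j (if j == i0 then 2 else 0).
pose v : 'rV[C]_n := \row_j (if j == i1 then 1 else 0).
have Lext s : (~` closure (unit_ball R n)) (z0 + s *: v).
  rewrite /setC/= closure_unit_ball => h.
  have : normc ((z0 + s *: v) 0 i0) ^+ 2 <= 1.
    apply: le_trans h; rewrite /nsqv /nsq (bigD1 i0)//= lerDl sumr_ge0// => j _; exact: sqr_ge0.
  rewrite !mxE eqxx /= mulr0 addr0 (_ : 2 = (2 : R)%:C :> C); last by rewrite rmorph_nat.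
  rewrite normc_real ger0_norm//.
  by rewrite expr2 -natrM lern1.
have fz0 s : f (z0 + s *: v) = f z0.
  apply/rowP => j; have := @liouville _ (fun s => f (z0 + s *: v) 0 j) 1.
  rewrite scale0r addr0; apply.
    move=> t; apply: (@cdiff_eq _ (fun s => f (z0 + t *: v + (s - t) *: v) 0 j)).
      by apply: filterE => w; rewrite -addrA -scalerDl [t + _]addrC subrK.
    apply: (@cdiff_comp _ (fun s => s - t) (fun s => f (z0 + t *: v + s *: v) 0 j)).
      by apply: cdiffB; [exact: cdiff_id|exact: cdiff_cst].
    by rewrite subrr; apply: differentiable_coord_line; apply: hf; exact: Lext.
  move=> t; have := UB _ (fU _ (Lext t)); rewrite /unit_ball/= => lt.
  have n1 : nsqv (f (z0 + t *: v)) < 1.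
    by rewrite -(expr1n R 2) -enorm_lt.
  rewrite -(ler_pXn2r (n := 2))// ?nnegrE ?normc_ge0// expr1n; apply: le_trans (ltW n1).
  by rewrite /nsqv /nsq (bigD1 j)//= lerDl sumr_ge0// => i _; exact: sqr_ge0.
have KU : [set f z0] `<=` U.
  by move=> _ ->; rewrite -(fz0 0); apply: fU; exact: Lext.
(* The fibre over [f z0] would be compact, but it contains the whole line. *)
have [B hB] := compact_coord_bounded i1 (fprop _ KU (@compact_set1 _ (f z0))).
have := hB (z0 + (`|B| + 1)%:C *: v); rewrite !mxE eqxx /= mulr1 add0r normc_real.
rewrite (@ger0_norm _ (`|B| + 1)) ?addr_ge0// => h.
have : `|B| + 1 <= B by apply: h; split; [exact: Lext|rewrite /= fz0].
by have := ler_norm B; lra.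
Qed.

Lemma no_proper_map_from_shell n N (c : 'rV[C]_n) (r : R) (f : 'rV[C]_n -> 'rV[C]_N) : (2 <= n)%N ->
  unit_ball R n `&` eball c r !=set0 ->
  unit_ball R n `\` closure (eball c r) !=set0 ->
  holomorphic_on (unit_ball R n `\` closure (eball c r)) f ->
  ~ proper_map (unit_ball R n `\` closure (eball c r)) (~` closure (unit_ball R N)) f.
Proof.
move=> hn [u [u1 uc]] [v [v1 vc]] hf [fV _ fprop].
have r0 : 0 < r by apply: le_lt_trans uc; exact: sqrtr_ge0.
have [e1 [e2 [cE nE]]] := orthonormal_pair c hn.
pose k := enorm c.
have k0 : 0 <= k by exact: sqrtr_ge0.
have nc : nsqv c = k ^+ 2 by rewrite sqr_sqrtr// nsq_ge0.
(* Dividing lengths by r makes the removed ball the unit ball; the outer ball is then centred at (b,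
   0) with radius 1 / r. *)
pose b := k / r; pose R0 := r^-1.
have unit_lt n' (z : 'rV[C]_n') : unit_ball R n' z <-> nsqv z < 1.
  by rewrite /unit_ball/= enorm_lt// expr1n.
have nsqN n' (z : 'rV[C]_n') : nsqv (- z) = nsqv z.
  by apply: eq_bigr => j _; rewrite mxE normcN.
(* The point (1, 0) lies in the outer ball, that is |r - k| < 1: the balls meet, so k < 1 + r, and
   their difference is not empty, so r < 1 + k. *)
have hb : `|1 - b| < R0.
  have kr : k < 1 + r.
    rewrite -(ltr_pXn2r (n := 2))// ?nnegrE ?addr_ge0 ?(ltW r0)// -nc.
    have -> : c = u + - (u - c) by rewrite opprB addrCA subrr addr0.
    apply: nsqvD_lt => //; first by rewrite expr1n; apply/unit_lt.
    by rewrite nsqN; apply: ltW; rewrite -enorm_lt.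
  have rk : r < 1 + k.
    rewrite -(ltr_pXn2r (n := 2))// ?nnegrE ?addr_ge0 ?(ltW r0)//.
    have vr : r ^+ 2 < nsqv (v - c).
      by rewrite ltNge; apply/negP => h; apply: vc; apply/closure_eball.
    (* [nsqvD_lt] asks for positive radii, so concentric balls are treated apart. *)
    have [kz|kz] := eqVneq k 0.
      rewrite kz addr0; have c0 : c = 0 by rewrite cE -/k kz oppr0 scale0r.
      rewrite c0 subr0 in vr; have /unit_lt := v1; rewrite expr1n; exact: lt_trans.
    apply: lt_trans vr _; apply: nsqvD_lt => //.
    - by rewrite lt_def kz.
    - by rewrite expr1n; apply/unit_lt.
    - by rewrite nsqN nc.
  rewrite /R0 -(ltr_pM2r r0) mulVf ?gt_eqF// -{1}(gtr0_norm r0) -normrM mulrBl mul1r divfK ?gt_eqF//.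
  rewrite ltr_norml; apply/andP; split; [clear - kr|clear - rk]; lra.
pose P x y : 'rV[C]_n := c + r%:C *: (x *: e1 + y *: e2).
have scal n' (a : C) (z : 'rV[C]_n') : nsqv (a *: z) = normc a ^+ 2 * nsqv z.
  by rewrite -nsq_scale; apply: eq_bigr => j _; rewrite mxE.
have Pc x y : nsqv (P x y - c) = r ^+ 2 * (normc x ^+ 2 + normc y ^+ 2).
  by rewrite /P addrAC subrr add0r scal nE normc_real gtr0_norm.
have rC0 : r%:C != 0 :> C by rewrite -normc_gt0 normc_real normr_gt0 gt_eqF.
have P0 x y : nsqv (P x y) = r ^+ 2 * (normc (x - b%:C) ^+ 2 + normc y ^+ 2).
  have -> : P x y = r%:C *: ((x - b%:C) *: e1 + y *: e2).
    rewrite /P {1}cE -/k (_ : k%:C = r%:C * b%:C); last by rewrite -rmorphM/= /b mulrCA divff ?mulr1// gt_eqF.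
    by rewrite !scalerDr !scalerA mulrBr scalerBl addrCA addrA scaleNr -!scalerA addrC.
  by rewrite scal nE normc_real gtr0_norm.
have PU x y : (unit_ball R n `\` closure (eball c r)) (P x y) <-> shell b R0 x y.
  have r2 : 0 < r ^+ 2 by rewrite exprn_gt0.
  split.
    move=> [/unit_lt h1 h2]; split.
      rewrite -(ltr_pM2l r2) mulr1 -Pc ltNge; apply/negP => h; apply: h2; exact/closure_eball.
    by rewrite -(ltr_pM2l r2) -P0 /R0 exprVn mulfV ?gt_eqF.
  move=> [h1 h2]; split.
    by apply/unit_lt; rewrite P0 -(mulfV (lt0r_neq0 r2)) ltr_pM2l// -exprVn.
  by move/(closure_eball _ _ r0); rewrite Pc -[X in _ <= X]mulr1 ler_pM2l// leNgt h1.
have shiftP x y u' v' s : P (x + s * u') (y + s * v') = P x y + s *: (r%:C *: (u' *: e1 + v' *: e2)).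
  by apply/rowP => j; rewrite !mxE; ring.
have Plim (T : Type) (F : set_system T) (FF : Filter F) (X Y : T -> C) x y :
    clim F X x -> clim F Y y -> (fun t => P (X t) (Y t)) @ F `=>` nbhs (P x y).
  move=> hX hY; apply: clim_row => j.
  apply: (@clim_near _ _ _ _ (fun t => c 0 j + r%:C * (X t * e1 0 j + Y t * e2 0 j))).
    by apply: filterE => t; rewrite !mxE.
  rewrite !mxE; apply: climD; first exact: clim_cst.
  apply: climM; first exact: clim_cst.
  by apply: climD; apply: climM => //; exact: clim_cst.
apply: (@shell_map_false R N (fun j x y => f (P x y) 0 j) b R0) => //.
- move=> j x y /PU hP; have df := hf _ hP; split.
    move=> e e0; have := differentiable_coord_cont j df e0.
    by have := @Plim _ _ _ fst snd x y (@clim_fst _ x y) (@clim_snd _ x y); apply.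
  move=> u' v'; have := differentiable_coord_line (r%:C *: (u' *: e1 + v' *: e2)) j df.
  by apply: cdiff_eq; apply: filterE => s; rewrite -shiftP.
- move=> x y /PU hP; have := fV _ hP; rewrite /setC/= closure_unit_ball => /negP.
  by rewrite -ltNge.
move=> x0 X Y w x01 cXYw onX notU; rewrite leNgt; apply/negP => w1.
pose W (x : R) : 'rV[C]_N := \row_j w j x.
(* If the limit had norm above 1, the values along the closed path would form a compact subset of
   the target, whose preimage is compact and contains the path near its end. *)
pose K := W @` `[x0, 1].
have KV : K `<=` ~` closure (unit_ball R N).
  move=> _ [x + <-]; rewrite /= in_itv/= => /andP[xx0 x1].
  move: x1; rewrite le_eqVlt => /predU1P[->|x1].
    move=> /closure_unit_ball; apply/negP; rewrite -ltNge.
    by rewrite (_ : nsqv (W 1) = nsq (fun j => w j 1))//; apply: eq_bigr => j _; rewrite mxE.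
  have [/PU sh gw] := onX x xx0 x1.
  have -> : W x = f (P (X x) (Y x)) by apply/rowP => j; rewrite mxE gw.
  exact: fV.
have Kc : compact K.
  apply: continuous_compact; last exact: segment_compact.
  apply: continuous_in_subspaceT => x; rewrite inE/= in_itv/= => hx.
  have [_ _ cw] := cXYw x hx.
  apply: clim_row => j; rewrite mxE; apply: (@clim_near _ _ _ _ (w j)); last exact: cw.
  by apply: filterE => t; rewrite mxE.
have lim1 (Z : R -> C) : rcont Z 1 -> clim (1^'-) Z (Z 1).
  by move=> h e e0; apply: cvg_within; exact: h.
have in1 : x0 <= (1 : R) <= 1 by rewrite (ltW x01) /=.
have [cX1 cY1 _] := cXYw 1 in1.
have Fl := Plim _ (1^'-) _ X Y _ _ (lim1 _ cX1) (lim1 _ cY1).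
pose F : set_system 'rV[C]_n := (fun x => P (X x) (Y x)) @ 1^'-.
have FP : F ((unit_ball R n `\` closure (eball c r)) `&` f @^-1` K).
  rewrite /F /fmap/=; near=> x.
  have [xx0 x1] : x0 <= x /\ x < 1.
    split; last by near: x; exact: nbhs_left_lt.
    by apply: ltW; near: x; exact: nbhs_left_gt.
  have [/PU sh gw] := onX x xx0 x1; split => //=.
  by exists x; [rewrite /= in_itv/= xx0 ltW|apply/rowP => j; rewrite mxE gw].
(* The cluster point lies in the domain and must be the end of the path, which was assumed to be
   outside. *)
have [p [[pU _] clp]] := fprop K KV Kc F _ FP.
apply: notU; apply/PU; suff -> : P (X 1) (Y 1) = p by [].
apply/rowP => j; apply/eqP; rewrite -subr_eq0 -normc_eq0 eq_le normc_ge0 andbT leNgt; apply/negP => d0.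
set d := normc _ in d0.
have d2 : 0 < d / 2 by rewrite divr_gt0.
have A1 : F [set z : 'rV[C]_n | normc (z 0 j - P (X 1) (Y 1) 0 j) < d / 2].
  by apply: Fl; exact: coord_clim.
have A2 : nbhs p [set z : 'rV[C]_n | normc (z 0 j - p 0 j) < d / 2] by exact: coord_clim.
have [z [/= z1 z2]] := clp _ _ A1 A2.
have : d < d; last by rewrite ltxx.
rewrite {1}/d (_ : _ - _ = (z 0 j - p 0 j) - (z 0 j - P (X 1) (Y 1) 0 j)); last by ring.
by rewrite (le_lt_trans (le_normcD _ _))// normcN (splitr d) ltrD.
Unshelve. all: by end_near. Qed.

End ProperMaps.

(** If the closed ball of radius r covers the unit ball, the first domain is empty and every f is
    vacuously proper and holomorphic on it; hence the nonemptiness premise of the first claim. *)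
Theorem proposition1p5 (R : realType) (n N : nat) (hn : (2 <= n)%N)
    (c : 'rV[R[i]]_n) (r : R) (c' : 'rV[R[i]]_N) (r' : R)
    (hcr : unit_ball R n `&` eball c r !=set0)
    (hcr' : unit_ball R N `&` eball c' r' !=set0) :
  (unit_ball R n `\` closure (eball c r) !=set0 ->
   ~ exists f : 'rV[R[i]]_n -> 'rV[R[i]]_N,
       holomorphic_on (unit_ball R n `\` closure (eball c r)) f /\
       proper_map (unit_ball R n `\` closure (eball c r))
                  (~` closure (unit_ball R N)) f) /\
  ~ exists f : 'rV[R[i]]_n -> 'rV[R[i]]_N,
      holomorphic_on (~` closure (unit_ball R n)) f /\
      proper_map (~` closure (unit_ball R n))
                 (unit_ball R N `\` closure (eball c' r')) f.
Proof.
split=> [nonempty [f [hf pf]]|[f [hf pf]]].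
  exact: (no_proper_map_from_shell hn hcr nonempty hf pf).
by apply: (no_proper_map_from_exterior hn _ hf pf) => z [].
Qed.
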